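(* Let $f:N\to{\bf C}^m$ be a slant immersion of an $n$-dimensional differentiable manifold $N$ into the complex Euclidean $m$-space ${\bf C}^m$. If $N$ is compact, then $f$ is totally real.
   Context: ${\bf C}^m$ has its standard flat Kaehler structure with complex structure $J_0$; $N$ has no boundary and positive dimension, and carries the induced metric. The immersion is slant if, for nonzero $X\in T_xN$, the angle between $J_0X$ and the tangent space $T_xN$ is a constant independent of $x\in N$ and of $X$. It is totally real if $J_0(T_xN)\subseteq T_x^\perp N$ for all $x$ (i.e. this constant is $\pi/2$). *)

(* Defs.v *)
From HB Require Import structures.
From mathcomp Require Import all_boot all_order all_algebra.
From mathcomp Require Import complex.
From mathcomp Require Import all_classical all_reals all_analysis.

Set Implicit Arguments.
Unset Strict Implicit.
Unset Printing Implicit Defensive.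

Import Order.TTheory GRing.Theory Num.Theory.
Import numFieldNormedType.Exports.

Local Open Scope classical_set_scope.
Local Open Scope ring_scope.

(* [W] is meant to be open: ['d g x] is the Frechet differential of [g] on the
   whole space, and only depends on the germ of [g] at [x]. *)
Fixpoint Ck_on (R : realType) (U V : normedModType R) (k : nat) (g : U -> V)
    (W : set U) : Prop :=
  match k with
  | 0 => forall x, W x -> {for x, continuous g}
  | k'.+1 => (forall x, W x -> differentiable g x) /\
             (forall v : U, Ck_on k' (fun x => 'd g x v) W)
  end.

Definition smooth_on (R : realType) (U V : normedModType R) (g : U -> V)
    (W : set U) : Prop :=
  forall k, Ck_on k g W.

(* [chart_map] is only meaningful on [chart_dom], and [chart_inv] only on
   [chart_codom]; both are arbitrary elsewhere. *)
Record chart (R : realType) (n : nat) (T : topologicalType) := Chart {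
  chart_dom : set T;
  chart_map : T -> 'rV[R]_n;
  chart_inv : 'rV[R]_n -> T;
  chart_codom := chart_map @` chart_dom;
  chart_dom_open : open chart_dom;
  chart_codom_open : open chart_codom;
  chart_mapK : forall x, chart_dom x -> chart_inv (chart_map x) = x;
  chart_map_continuous :
    forall x, chart_dom x -> {for x, continuous chart_map};
  chart_inv_continuous :
    forall y, chart_codom y -> {for y, continuous chart_inv} }.

Definition smooth_transition (R : realType) (n : nat) (T : topologicalType)
    (c d : chart R n T) : Prop :=
  smooth_on (fun y => chart_map d (chart_inv c y))
            (chart_map c @` (chart_dom c `&` chart_dom d)).

(* Manifolds without boundary. The atlas is not required to be maximal: it
   determines a unique maximal one, and the notions below do not depend on the
   choice of an atlas of the same differentiable structure. *)
Record smoothManifold (R : realType) (n : nat) := SmoothManifold {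
  carrier :> topologicalType;
  manifold_hausdorff : hausdorff_space carrier;
  manifold_second_countable : @second_countable carrier;
  atlas : set (chart R n carrier);
  atlas_cover : forall x : carrier, exists2 c, atlas c & chart_dom c x;
  atlas_compatible :
    forall c d, atlas c -> atlas d -> smooth_transition c d }.

Section ComplexSpace.
Variables (R : realType) (m : nat).
Implicit Types (u v w : 'rV[R[i]]_m) (W : set 'rV[R[i]]_m).

Definition J0 v : 'rV[R[i]]_m := ('i)%C *: v.

Definition inner u v : R := complex.Re (\sum_j u 0 j * ((v 0 j)^*)%C).

Definition enorm v : R := Num.sqrt (inner v v).

Definition angle u v : R := acos (inner u v / (enorm u * enorm v)).

Definition angle_to_subspace v W : R :=
  inf [set angle v w | w in [set w | W w /\ w != 0]].

Definition orthogonal_complement W : set 'rV[R[i]]_m :=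
  [set v | forall w, W w -> inner v w = 0].

End ComplexSpace.

Section Immersions.
Variables (R : realType) (n m : nat) (N : smoothManifold R n).
Variable f : N -> 'rV[R[i]]_m.

Definition re_in_chart (c : chart R n N) (j : 'I_m) (y : 'rV[R]_n) : R :=
  complex.Re (f (chart_inv c y) 0 j).

Definition im_in_chart (c : chart R n N) (j : 'I_m) (y : 'rV[R]_n) : R :=
  complex.Im (f (chart_inv c y) 0 j).

Definition smooth_map : Prop :=
  forall c, atlas c -> forall j,
    smooth_on (re_in_chart c j) (chart_codom c) /\
    smooth_on (im_in_chart c j) (chart_codom c).

(* df_x applied to the tangent vector with coordinates [v] in the chart [c]. *)
Definition differential (c : chart R n N) (x : N) (v : 'rV[R]_n) :
    'rV[R[i]]_m :=
  \row_j (('d (re_in_chart c j) (chart_map c x) v : R) +i*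
          ('d (im_in_chart c j) (chart_map c x) v : R))%C.

Definition immersion : Prop :=
  smooth_map /\
  forall c x, atlas c -> chart_dom c x -> injective (differential c x).

(* T_xN as a real subspace of C^m, i.e. identified with its image under df_x;
   all charts around [x] give the same image. The induced metric is then the
   restriction of [inner]. *)
Definition tangent_space (x : N) : set 'rV[R[i]]_m :=
  [set X | exists c v, [/\ atlas c, chart_dom c x & X = differential c x v]].

Definition slant_immersion : Prop :=
  immersion /\
  exists theta : R, forall x X, tangent_space x X -> X != 0 ->
    angle_to_subspace (J0 X) (tangent_space x) = theta.

Definition totally_real : Prop :=
  forall x,
    @J0 R m @` tangent_space x `<=` orthogonal_complement (tangent_space x).

End Immersions.

(* Main.v *)
Require Import Defs.
From HB Require Import structures.
From mathcomp Require Import all_boot all_order all_algebra.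
From mathcomp Require Import complex.
From mathcomp Require Import all_classical all_reals all_analysis.
From mathcomp Require Import perm ring lra.

Set Implicit Arguments.
Unset Strict Implicit.
Unset Printing Implicit Defensive.

Import Order.TTheory GRing.Theory Num.Theory.
Import numFieldNormedType.Exports.

Local Open Scope classical_set_scope.
Local Open Scope ring_scope.

(* Let [w] be the pull-back of the Kaehler form and [al] that of [sum_j x_j dy_j],
   so that [w = d al]. If [w] degenerates at one point, the slant angle is [pi / 2]
   and the immersion is totally real. Otherwise [w] is symplectic, and the vector
   field [X] dual to [al] satisfies [L_X w = - w]; it therefore contracts the volume
   density [rho = sqrt |det w|]: [div (rho X) = - (n / 2) rho]. On a closed manifold
   the integral of a divergence is 0, while that of [rho] is positive: a
   contradiction. In the integral, [rho] is split by a partition of unity, the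
   derivatives of which along [X] add up to 0, and only the change of variables
   formula for compactly supported functions is needed. *)

(** * Compactly supported functions *)

(** Behind the overview stands the fact that an exact form [w] cannot be symplectic on a closed
    manifold: $w^{n/2}$ would be exact with nonzero integral. A vector field and a density take the
    place of wedge powers and Stokes. As [al] is pulled back from ${\bf C}^m$, [X] is global, and
    Cartan's formula with $dw = 0$ gives $L_X w = d(i_X w) = - d al = - w$. Up to sign and constant
    [rho] is $w^{n/2}$, whence the factor $n/2$; pointwise this is a matrix identity between the
    inverse of [w] and the first derivatives of [w] and [al]. The absolute value makes [rho]
    transform by $|\det J|$, as charts with no chosen orientation require. The obstacle is
    globalisation. The derivative along [X] of a partition function can be integrated only in a
    chart containing its support, whereas these derivatives cancel only when added at the same
    point. Multiplying by a second copy of the partition places each product in two charts; the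
    change of variables moves it from one to the other, where the sum over the first index is 0. *)

Section CompactSupport.
Variable R : realType.

(** A form of local compactness that is stable under products, so that the same lemmas serve the
    line, R^n and products of the two. *)
Definition compact_balls (V : normedModType R) :=
  forall L : R, compact [set x : V | `|x| <= L].

(* Vanishing outside some ball: this is compactness of the support when
   [compact_balls V] holds. *)
Definition cc (V : normedModType R) (f : V -> R) :=
  continuous f /\ exists L : R, forall x, L < `|x| -> f x = 0.

Lemma continuous_norm (U V : normedModType R) (f : U -> V) :
  (forall x (e : R), 0 < e ->
    exists2 d : R, 0 < d & forall y, `|x - y| < d -> `|f x - f y| <= e) ->
  continuous f.
Proof.
move=> h x; apply/cvgrPdist_le => e e0; have [d d0 hd] := h x e e0.
by apply/nbhs_ballP; exists d => //= y; rewrite -ball_normE/= => /hd.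
Qed.

Lemma continuous_compT (U V W : normedModType R) (f : V -> W) (g : U -> V) :
  continuous g -> continuous f -> continuous (fun x => f (g x)).
Proof. by move=> cg cf x; apply: continuous_comp; [exact: cg|exact: cf]. Qed.

Lemma cc_support (V : normedModType R) (f : V -> R) : cc f ->
  exists2 L : R, 0 < L & forall x, L < `|x| -> f x = 0.
Proof.
move=> [_ [L hL]]; exists (`|L| + 1); first by rewrite ltr_wpDl.
by move=> x hx; apply: hL; apply: le_lt_trans hx; rewrite ler_wpDr// ler_norm.
Qed.

Lemma ccD (V : normedModType R) (f g : V -> R) :
  cc f -> cc g -> cc (fun x => f x + g x).
Proof.
move=> cf cg; have [L L0 hL] := cc_support cf.
have [M M0 hM] := cc_support cg; case: cf cg => cf _ [cg _]; split.
  by move=> x; apply: cvgD; [exact: cf|exact: cg].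
exists (L + M) => x hx; rewrite hL ?hM ?addr0//; apply: le_lt_trans hx.
  by rewrite lerDr ltW.
by rewrite lerDl ltW.
Qed.

Lemma ccMl (V : normedModType R) (f g : V -> R) :
  continuous f -> cc g -> cc (fun x => f x * g x).
Proof.
move=> cf [cg [L hL]]; split.
  by move=> x; apply: cvgM; [exact: cf|exact: cg].
by exists L => x hx; rewrite hL// mulr0.
Qed.

Lemma ccZ (V : normedModType R) (k : R) (f : V -> R) :
  cc f -> cc (fun x => k * f x).
Proof. by apply: ccMl => x; exact: cvg_cst. Qed.

Lemma ccN (V : normedModType R) (f : V -> R) : cc f -> cc (fun x => - f x).
Proof.
by move=> /(ccZ (-1)); under eq_fun do rewrite mulN1r.
Qed.

Lemma ccB (V : normedModType R) (f g : V -> R) :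
  cc f -> cc g -> cc (fun x => f x - g x).
Proof. by move=> cf /ccN; exact: ccD. Qed.

Lemma cc_sum (V : normedModType R) (I : Type) (s : seq I) (P : pred I)
    (F : I -> V -> R) :
  (forall i, P i -> cc (F i)) -> cc (fun x => \sum_(i <- s | P i) F i x).
Proof.
move=> cF; elim: s => [|i s IH].
  under eq_fun do rewrite big_nil.
  by split; [move=> x; exact: cvg_cst|exists 0].
under eq_fun do rewrite big_cons.
by case Pi: (P i) => //; apply: ccD => //; exact: cF.
Qed.

(** Heine-Cantor on a ball of radius [L + 1], one unit larger than the support: from a point beyond
    it, a step shorter than 1 stays off the support. *)
Lemma cc_unif (V : normedModType R) (f : V -> R) :
  compact_balls V -> cc f -> forall e : R, 0 < e ->
  exists2 d : R, 0 < d & forall x y, `|x - y| < d -> `|f x - f y| <= e.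
Proof.
move=> cV cf e e0; have [L L0 hL] := cc_support cf; case: cf => cf _.
pose P (d : R) (x : V) := forall y, `|x - y| < d -> `|f x - f y| <= e.
have /compact_near_coveringP ncov := cV (L + 1).
have : \forall d \near 0^'+, [set x : V | `|x| <= L + 1] `<=` P d.
  apply: ncov => x _.
  have /cvgr_dist_le /(_ (e / 2)) := cf x.
  rewrite divr_gt0// => /(_ isT) /nbhs_ballP[r /= r0 hr].
  exists (ball x (r / 2), [set d | d <= r / 2]) => /=.
    by split; [apply: nbhsx_ballx|apply: nbhs_right_le]; rewrite divr_gt0.
  move=> [z d] /= [xz dr] y zy; rewrite (splitr e).
  rewrite (le_trans (ler_distD (f x) _ _))// lerD//.
    rewrite distrC; apply: hr; apply: le_ball xz; lra.
  apply: hr; rewrite -ball_normE/= (splitr r).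
  rewrite (le_lt_trans (ler_distD z _ _))// ltrD//.
    by move: xz; rewrite -ball_normE.
  exact: lt_le_trans zy _.
move=> h1.
have h0 : \forall d \near 0^'+, (0 < d :> R) /\ (d <= 1 :> R).
  by apply: filterI; [exact: nbhs_right_gt|exact: nbhs_right_le].
have [d [hd [d0 d1]]] : exists d : R,
    ([set x : V | `|x| <= L + 1] `<=` P d) /\ 0 < d /\ d <= 1.
  by apply: (@filter_ex _ (0^'+ : set_system R)); exact: filterI.
exists d => // x y xy; have [xL|xL] := leP `|x| (L + 1); first exact: hd.
rewrite !hL ?subrr ?normr0 ?ltW//.
  suff : `|x| <= `|y| + `|x - y| by move=> ?; lra.
  by rewrite addrC -{1}(subrK y x) ler_normD.
lra.
Qed.

Lemma cc_bounded (V : normedModType R) (f : V -> R) :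
  compact_balls V -> cc f -> exists2 B : R, 0 < B & forall x, `|f x| <= B.
Proof.
move=> cV cf; have [L L0 hL] := cc_support cf; case: (cf) => cfc _.
have /compact_bounded[M [_ hM]] : compact (f @` [set x : V | `|x| <= L]).
  by apply: continuous_compact => //; exact: continuous_subspaceT.
exists (`|M| + 1); first by rewrite ltr_wpDl.
have M1 : M < `|M| + 1 by rewrite ltr_pwDr// ler_norm.
move=> x; have [xL|xL] := leP `|x| L; first by apply: hM => //; exists x.
by rewrite hL// normr0 ltW// ltr_wpDl.
Qed.

Lemma compact_balls_R : compact_balls R.
Proof.
move=> L; rewrite (_ : [set _ | _] = `[- L, L]%classic).
  exact: segment_compact.
by apply/seteqP; split => x; rewrite /= in_itv/= ler_norml.
Qed.

Lemma compact_balls_rV n : compact_balls 'rV[R]_n.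
Proof.
move=> L; apply: bounded_closed_compact.
  exists L; split; first exact: num_real.
  by move=> M LM x /= xL; exact: le_trans xL (ltW LM).
have -> : [set x : 'rV[R]_n | `|x| <= L] = (fun x => `|x|) @^-1` [set t | t <= L].
  by [].
by apply: closed_comp; [move=> x _; exact: norm_continuous|exact: closed_le].
Qed.

Lemma compact_balls_prod (U V : normedModType R) :
  compact_balls U -> compact_balls V -> compact_balls (U * V)%type.
Proof.
move=> cU cV L; rewrite (_ : [set _ | _] =
  [set x : U | `|x| <= L] `*` [set x : V | `|x| <= L]).
  by apply: compact_setX.
by apply/seteqP; split => -[x y] /=; rewrite prod_normE/= ge_max => /andP.
Qed.

End CompactSupport.

(** * Integration on the line *)

Section LineIntegral.
Variable R : realType.
Implicit Types f g : R -> R.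

Definition line_int f : R := Rintegral (@lebesgue_measure R) setT f.

Lemma cc_integrable f : cc f -> (@lebesgue_measure R).-integrable setT (EFin \o f).
Proof.
move=> cf; have [L L0 hL] := cc_support cf; case: cf => cf _.
have -> : EFin \o f = (EFin \o f) \_ `[- L, L].
  apply/funext => x; rewrite patchE; case: ifPn => // /negP xL.
  rewrite /= hL// ltNge; apply/negP => xL'; apply: xL.
  by rewrite inE/= in_itv/= -ler_norml.
have mI : measurable (`[- L, L]%classic : set (measurableTypeR R)).
  exact: measurable_itv.
apply: (proj1 (integrable_mkcond _ mI)).
apply: continuous_compact_integrable; first exact: (@segment_compact R).
exact: continuous_subspaceT.
Qed.

Lemma line_intD f g : cc f -> cc g ->
  line_int (fun t => f t + g t) = line_int f + line_int g.
Proof. by move=> cf cg; apply: RintegralD => //; exact: cc_integrable. Qed.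

Lemma line_intZ k f : cc f -> line_int (fun t => k * f t) = k * line_int f.
Proof. by move=> cf; apply: RintegralZl => //; exact: cc_integrable. Qed.

Lemma line_int_ge0 f : (forall t, 0 <= f t) -> 0 <= line_int f.
Proof. by move=> f0; apply: Rintegral_ge0. Qed.

Lemma Rintegral_segment_cst (a b c : R) : a <= b ->
  Rintegral (@lebesgue_measure R) `[a, b] (fun=> c) = c * (b - a).
Proof.
move=> ab; rewrite Rintegral_cst; last exact: measurable_itv.
congr (c * _); apply: (etrans (congr1 fine (lebesgue_measure_itv `[a, b]))).
rewrite /= lte_fin; move: ab.
by rewrite le_eqVlt => /predU1P[->|->] //; rewrite ltxx subrr.
Qed.

Lemma line_int_segment f (L : R) : (forall t, L < `|t| -> f t = 0) ->
  line_int f = Rintegral (@lebesgue_measure R) `[- L, L] f.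
Proof.
move=> hL; rewrite [RHS]Rintegral_mkcond; congr Rintegral; apply/funext => x.
rewrite patchE; case: ifPn => // /negP xL.
rewrite hL// ltNge; apply/negP => xL'; apply: xL.
by rewrite inE/= in_itv/= -ler_norml.
Qed.

Lemma line_int_bound f (L B : R) : cc f -> 0 <= L -> 0 <= B ->
  (forall t, L < `|t| -> f t = 0) -> (forall t, `|f t| <= B) ->
  `|line_int f| <= B * (2 * L).
Proof.
move=> cf L0 B0 hL hB.
have mI : measurable (`[- L, L]%classic : set (measurableTypeR R)).
  exact: measurable_itv.
have iI : (@lebesgue_measure R).-integrable `[- L, L] (EFin \o f).
  exact: (integrableS measurableT mI (@subsetT _ _) (cc_integrable cf)).
rewrite (line_int_segment hL).
apply: (le_trans (le_normr_Rintegral mI iI)).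
have -> : B * (2 * L) = Rintegral (@lebesgue_measure R) `[- L, L] (fun=> B).
  by rewrite Rintegral_segment_cst ?opprK ?mulr2n ?mulrDl ?mul1r//; lra.
apply: le_Rintegral => //.
- exact: integrable_norm iI.
- apply: continuous_compact_integrable; first exact: (@segment_compact R).
  by apply: continuous_subspaceT => x; exact: cvg_cst.
Qed.

(** By continuity [f] stays above half of [f p] on a segment of positive length starting at [p]. *)
Lemma line_int_gt0 f p : cc f -> (forall t, 0 <= f t) -> 0 < f p ->
  0 < line_int f.
Proof.
move=> cf f0 fp; have [cf' _] := cf.
have /cvgr_dist_le /(_ (f p / 2)) := cf' p.
rewrite divr_gt0// => /(_ isT) /nbhs_ballP[r /= r0 hr].
pose I := `[p, p + r / 2]%classic : set (measurableTypeR R).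
have mI : measurable I by exact: measurable_itv.
apply: (@lt_le_trans _ _ (Rintegral (@lebesgue_measure R) I (fun=> f p / 2))).
  by rewrite Rintegral_segment_cst ?lerDl; nra.
rewrite Rintegral_mkcond; apply: le_Rintegral => //.
- rewrite -restrict_EFin; apply: (proj1 (integrable_mkcond _ mI)).
  apply: continuous_compact_integrable; first exact: (@segment_compact R).
  by apply: continuous_subspaceT => x; exact: cvg_cst.
- exact: cc_integrable.
move=> x _; rewrite patchE; case: ifPn => [|_]; last exact: f0.
rewrite inE /I/= in_itv/= => /andP[px xp].
have : `|f p - f x| <= f p / 2.
  apply: hr; rewrite -ball_normE/= distrC ger0_norm ?subr_ge0//; lra.
by rewrite ler_norml => /andP[_]; lra.
Qed.

Lemma cc_affine f (a b : R) : a != 0 -> cc f -> cc (fun t => f (a * t + b)).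
Proof.
move=> a0 cf; have [L L0 hL] := cc_support cf; case: cf => cf _; split.
  move=> x; apply: (@continuous_comp _ _ _ (fun t => a * t + b) f); last exact: cf.
  apply: cvgD; last exact: cvg_cst.
  by apply: cvgM; [exact: cvg_cst|exact: cvg_id].
exists ((L + `|b|) / `|a|) => x.
rewrite ltr_pdivrMr ?normr_gt0// -normrM mulrC => hx; apply: hL.
have : `|a * x| <= `|a * x + b| + `|b|.
  by rewrite -{1}(addrK b (a * x)) ler_normB.
lra.
Qed.

(** Nonnegativity is what the substitution theorem on the whole line asks for; [line_int_affine]
    reaches general functions through positive and negative parts. *)
Lemma line_int_affine_pos f (a b : R) : 0 < a -> cc f -> (forall t, 0 <= f t) ->
  line_int (fun t => f (a * t + b)) = a^-1 * line_int f.
Proof.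
move=> a0 cf f0; pose F (t : R) := a * t + b.
have dF (x : R) : is_derive x (1 : R) F a.
  have -> : F = (a \*: (id : R -> R)) + cst b by apply/funext.
  by apply: is_derive_eq; rewrite addr0 /GRing.scale/= mulr1.
have F1 : derive1 F = cst a.
  by apply/funext => x; rewrite derive1E; apply: derive_val.
have FNy : F x @[x --> -oo%R] --> -oo%R.
  apply/cvgrNyPle => A; have := nbhs_ninfty_le (num_real ((A - b) / a)).
  by apply: filterS => x xA; rewrite /F -lerBrDr mulrC -ler_pdivlMr.
have Fy : F x @[x --> +oo%R] --> +oo%R.
  apply/cvgryPge => A; have := nbhs_pinfty_ge (num_real ((A - b) / a)).
  by apply: filterS => x xA; rewrite /F -lerBlDr mulrC -ler_pdivrMr.
have -> : line_int f = a * line_int (fun t => f (F t)).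
  rewrite -line_intZ; last by apply: cc_affine => //; rewrite gt_eqF.
  rewrite /line_int /Rintegral.
  rewrite (@increasing_ge0_integration_by_substitutionT R F f)//.
  - by congr fine; apply: eq_integral => x _; rewrite /= F1 /cst/= mulrC.
  - by move=> x y xy; rewrite /F ltrD2r ltr_pM2l.
  - by rewrite F1 => x; exact: cvg_cst.
  - by rewrite F1; exact: is_cvg_cst.
  - by rewrite F1; exact: is_cvg_cst.
  - by case: cf.
by rewrite mulrA mulVf ?gt_eqF// mul1r.
Qed.

Lemma line_int_affine_ge0 f (a b : R) : a != 0 -> cc f -> (forall t, 0 <= f t) ->
  line_int (fun t => f (a * t + b)) = `|a|^-1 * line_int f.
Proof.
move=> a0 cf f0; have [ap|an|a00] := ltgtP a 0; last by rewrite a00 eqxx in a0.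
  (* A negative slope is reduced to a positive one by reflecting a symmetric segment that contains
     the support. *)
  rewrite ltr0_norm// -(@line_int_affine_pos f (- a) b) ?oppr_gt0//.
  have cfa : cc (fun t => f (- a * t + b)) by apply: cc_affine; rewrite ?oppr_eq0.
  have [L L0 hL] := cc_support cfa.
  rewrite (line_int_segment hL) (@line_int_segment _ L); last first.
    by move=> t; rewrite -normrN => /hL; rewrite mulrNN.
  have LL : - L <= L by lra.
  have := @integration_by_substitution_oppr R (fun t => f (- a * t + b)) _ _ LL.
  rewrite opprK => sub; apply: (congr1 fine); apply/esym.
  rewrite sub; last by case: cfa => cfa _; exact: continuous_subspaceT.
  by apply: eq_integral => t _; rewrite /= mulrNN.
by rewrite line_int_affine_pos// gtr0_norm.
Qed.

Lemma line_int_affine f (a b : R) : a != 0 -> cc f ->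
  line_int (fun t => f (a * t + b)) = `|a|^-1 * line_int f.
Proof.
move=> a0 cf; pose fp t := Num.max (f t) 0; pose fm t := Num.max (- f t) 0.
have fE t : f t = fp t - fm t.
  by rewrite /fp /fm; case: (leP (f t) 0) => h; case: (leP (- f t) 0) => h' /=; lra.
have cmax g : cc g -> cc (fun t => Num.max (g t) 0).
  move=> [cg [L hL]]; split; last by exists L => x /hL ->; rewrite maxxx.
  by move=> x; apply: continuous_max; [exact: cg|exact: cvg_cst].
have cp : cc fp by exact: cmax.
have cm : cc fm by apply: cmax; exact: ccN.
have p0 t : 0 <= fp t by rewrite le_max lexx orbT.
have m0 t : 0 <= fm t by rewrite le_max lexx orbT.
have intB g h : cc g -> cc h ->
    line_int (fun t => g t - h t) = line_int g - line_int h.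
  move=> cg ch; rewrite line_intD//; last exact: ccN.
  congr (_ + _); rewrite -[RHS]mulN1r -line_intZ//.
  by congr line_int; apply/funext => t; rewrite mulN1r.
have -> : f = fun t => fp t - fm t by apply/funext.
rewrite [RHS](_ : _ = `|a|^-1 * (line_int fp - line_int fm)); last by rewrite -intB.
rewrite intB; [|exact: cc_affine..].
by rewrite !line_int_affine_ge0// mulrBr.
Qed.

End LineIntegral.

(** * Bounded functionals and Fubini *)

Section Fubini.
Variable R : realType.

Lemma segment_int_near (f : R -> R) (x r e : R) : cc f -> 0 <= r -> 0 <= e ->
  (forall y, `|x - y| <= r -> `|f x - f y| <= e) ->
  `|Rintegral (@lebesgue_measure R) `[x, x + r] f - r * f x| <= r * e.
Proof.
move=> cf r0 e0 hf; have xr : x <= x + r by lra.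
have mI : measurable (`[x, x + r]%classic : set (measurableTypeR R)).
  exact: measurable_itv.
have icont (g : R -> R) : continuous g ->
    (@lebesgue_measure R).-integrable `[x, x + r] (EFin \o g).
  move=> cg; apply: continuous_compact_integrable; first exact: (@segment_compact R).
  exact: continuous_subspaceT.
have cst_cont (c : R) : continuous (fun _ : R => c) by move=> ?; exact: cvg_cst.
have [cfc _] := cf.
have -> : r * f x = Rintegral (@lebesgue_measure R) `[x, x + r] (fun=> f x).
  by rewrite Rintegral_segment_cst// mulrC; congr (_ * _); ring.
rewrite -RintegralB//; [|exact: icont..].
have cB : continuous (fun y => f y - f x).
  by move=> y; apply: cvgB; [exact: cfc|exact: cvg_cst].
apply: (le_trans (le_normr_Rintegral mI _)); first exact: icont.
have -> : r * e = Rintegral (@lebesgue_measure R) `[x, x + r] (fun=> e).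
  by rewrite Rintegral_segment_cst// mulrC; congr (_ * _); ring.
apply: le_Rintegral => //.
- by apply: icont => y; apply: cvg_norm; exact: cB.
- exact: icont.
move=> y /=; rewrite in_itv/= => /andP[xy yr]; rewrite distrC; apply: hf.
by rewrite distrC ger0_norm; lra.
Qed.

Lemma segment_intD (f : R -> R) (a b c : R) : cc f -> a <= b -> b <= c ->
  Rintegral (@lebesgue_measure R) `[a, c] f =
  Rintegral (@lebesgue_measure R) `[a, b] f +
  Rintegral (@lebesgue_measure R) `[b, c] f.
Proof.
move=> [cf _] ab bc.
have icont (x y : R) : (@lebesgue_measure R).-integrable `[x, y] (EFin \o f).
  apply: continuous_compact_integrable; first exact: (@segment_compact R).
  exact: continuous_subspaceT.
apply/eqP; rewrite addrC -subr_eq Rintegral_itvB ?bnd_simp//.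
rewrite Rintegral_itv_obnd_cbnd//.
apply: (integrableS _ _ _ (icont b c)); [exact: measurable_itv|exact: measurable_itv|].
by apply: subset_itvr; rewrite bnd_simp.
Qed.

Lemma riemann_sum_near (f : R -> R) (a r e : R) (N : nat) :
  cc f -> 0 <= r -> 0 <= e ->
  (forall x y, `|x - y| <= r -> `|f x - f y| <= e) ->
  `|Rintegral (@lebesgue_measure R) `[a, a + N%:R * r] f -
    \sum_(k < N) r * f (a + k%:R * r)| <= (N%:R * r) * e.
Proof.
move=> cf r0 e0 hf; elim: N => [|N IH].
  by rewrite !mul0r addr0 set_itv1 Rintegral_set1 big_ord0 subr0 normr0.
have Nr : 0 <= N%:R * r by rewrite mulr_ge0.
have E : a + N.+1%:R * r = (a + N%:R * r) + r by rewrite -addn1 natrD; ring.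
rewrite (@segment_intD _ _ (a + N%:R * r))// ?E; [|lra..].
rewrite big_ord_recr/=.
have := @segment_int_near f (a + N%:R * r) r e cf r0 e0 (hf _).
move: IH; rewrite -addn1 natrD.
set A := Rintegral _ _ _; set B := Rintegral _ _ _; set S := \sum_(_ < _) _.
set T := r * _ => IH1 IH2.
have -> : A + B - (S + T) = (A - S) + (B - T) by ring.
by apply: (le_trans (ler_normD _ _)); lra.
Qed.

(** A Radon measure seen as a functional: linear, and bounded uniformly on the functions supported
    in a given ball. Fubini is proved for such functionals, so that it can be iterated over the
    coordinates. *)
Record bounded_functional (V : normedModType R) (beta : (V -> R) -> R) : Prop := {
  bfD : forall f g, cc f -> cc g -> beta (fun x => f x + g x) = beta f + beta g;
  bfZ : forall k f, cc f -> beta (fun x => k * f x) = k * beta f;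
  bf_bound : forall L : R, exists2 C : R, 0 <= C &
    forall f B, cc f -> 0 <= B -> (forall x, L < `|x| -> f x = 0) ->
      (forall x, `|f x| <= B) -> `|beta f| <= C * B }.

Lemma bfB (V : normedModType R) (beta : (V -> R) -> R) f g :
  bounded_functional beta -> cc f -> cc g ->
  beta (fun x => f x - g x) = beta f - beta g.
Proof.
move=> hb cf cg; rewrite (bfD hb)//; last exact: ccN.
congr (_ + _); rewrite -[RHS]mulN1r -(bfZ hb)//.
by congr beta; apply/funext => t; rewrite mulN1r.
Qed.

Lemma bf0 (V : normedModType R) (beta : (V -> R) -> R) :
  bounded_functional beta -> beta (fun=> 0) = 0.
Proof.
move=> hb; have c0 : cc (fun _ : V => 0 : R).
  by split; [move=> x; exact: cvg_cst|exists 0].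
rewrite -[RHS](mul0r (beta (fun=> 0))) -(bfZ hb 0 c0).
by congr beta; apply/funext => x; rewrite mul0r.
Qed.

Lemma bf_sum (V : normedModType R) (beta : (V -> R) -> R) (I : Type) (s : seq I)
    (F : I -> V -> R) : bounded_functional beta -> (forall i, cc (F i)) ->
  beta (fun x => \sum_(i <- s) F i x) = \sum_(i <- s) beta (F i).
Proof.
move=> hb cF; elim: s => [|i s IH].
  by rewrite big_nil; under eq_fun do rewrite big_nil; exact: bf0.
rewrite big_cons -IH -(bfD hb)//; last exact: cc_sum.
by congr beta; apply/funext => x; rewrite big_cons.
Qed.

Lemma line_int_bf : @bounded_functional R (@line_int R).
Proof.
split; [exact: line_intD|exact: line_intZ|].
move=> L; exists (2 * `|L|); first by rewrite mulr_ge0.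
move=> f B cf B0 hL hB; rewrite mulrC; apply: line_int_bound => //.
by move=> t tL; apply: hL; apply: le_lt_trans tL; exact: ler_norm.
Qed.

Variables (V W : normedModType R).
Hypotheses (cV : compact_balls V) (cW : compact_balls W).

Lemma cc_slice (F : V * W -> R) v : cc F -> cc (fun w => F (v, w)).
Proof.
move=> [cF [L hL]]; split.
  move=> w; apply: (@continuous_comp _ _ _ (fun w => (v, w)) F); last exact: cF.
  by apply: cvg_pair; [exact: cvg_cst|exact: cvg_id].
by exists L => w hw; apply: hL; rewrite prod_normE/= lt_max hw orbT.
Qed.

Lemma cc_slice_r (F : V * W -> R) w : cc F -> cc (fun v => F (v, w)).
Proof.
move=> [cF [L hL]]; split.
  move=> v; apply: (@continuous_comp _ _ _ (fun v => (v, w)) F); last exact: cF.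
  by apply: cvg_pair; [exact: cvg_id|exact: cvg_cst].
by exists L => v hv; apply: hL; rewrite prod_normE/= lt_max hv.
Qed.

(** Two nearby slices of the uniformly continuous [F] differ by a small function supported in a
    fixed ball, which [bf_bound] controls. *)
Lemma cc_param (F : V * W -> R) beta : bounded_functional beta -> cc F ->
  cc (fun v => beta (fun w => F (v, w))).
Proof.
move=> hb cF; have [L L0 hL] := cc_support cF; split; last first.
  exists L => v hv; rewrite -[RHS](bf0 hb); congr beta; apply/funext => w.
  by apply: hL; rewrite prod_normE/= lt_max hv.
have [C C0 hC] := bf_bound hb L.
move=> v; apply/cvgrPdist_le => e e0.
have C1 : 0 < C + 1 by rewrite ltr_wpDl.
have [d d0 hd] := cc_unif (compact_balls_prod cV cW) cF (divr_gt0 e0 C1).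
apply/nbhs_ballP; exists d => //= v' vv'.
rewrite -(bfB hb); [|exact: cc_slice..].
apply: (@le_trans _ _ (C * (e / (C + 1)))); last first.
  by rewrite mulrCA ger_pMr// ler_pdivrMr// mul1r; lra.
apply: hC.
- by apply: ccB; exact: cc_slice.
- by rewrite divr_ge0// ltW.
- move=> w hw; rewrite !hL ?subrr// prod_normE/= lt_max hw orbT//.
- move=> w; apply: hd; rewrite prod_normE/= gt_max subrr normr0 d0 andbT.
  by move: vv'; rewrite -ball_normE.
Qed.

End Fubini.

Section Swap.
Variables (R : realType) (W : normedModType R).
Hypothesis cW : compact_balls W.

(** A Riemann sum in [t] is a finite linear combination, with which [beta] commutes; by uniform
    continuity of [F] both sides are close to it. *)
Lemma line_int_swap (F : R * W -> R) (beta : (W -> R) -> R) :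
  bounded_functional beta -> cc F ->
  line_int (fun t => beta (fun w => F (t, w))) =
  beta (fun w => line_int (fun t => F (t, w))).
Proof.
move=> hb cF; have [L L0 hL] := cc_support cF.
have cR := @compact_balls_R R.
pose swapF (p : W * R) := F (p.2, p.1).
have csF : cc swapF.
  case: cF => cF [M hM]; split.
    move=> p; apply: (@continuous_comp _ _ _ (@unstable.swap W R) F); last exact: cF.
    exact: swap_continuous.
  exists M => p hp; apply: hM; move: hp; rewrite !prod_normE/=.
  by rewrite maxC.
have cl : cc (fun t => beta (fun w => F (t, w))) := cc_param cR cW hb cF.
have cr : cc (fun w => line_int (fun t => F (t, w))).
  exact: (cc_param cW cR (@line_int_bf R) csF).
have [C C0 hC] := bf_bound hb L.
apply/eqP; rewrite -subr_eq0 -normr_le0; apply/ler_addgt0Pl => e e0; rewrite addr0.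
(* Each side misses the Riemann sum by at most [2 * L * C * e']; the denominator exceeds the sum of
   the two factors by [2 * L], hence is positive even for [C = 0]. *)
pose e' := e / (2 * L * (2 * C + 1)).
have LC0 : 0 < 2 * L * (2 * C + 1) by rewrite mulr_gt0 ?mulr_gt0//; lra.
have e'0 : 0 < e' by rewrite divr_gt0.
have [d d0 hd] := cc_unif (compact_balls_prod cR cW) cF e'0.
have [N [N0 Nd]] : exists N : nat, (0 < N)%N /\ 2 * L / N%:R < d.
  exists (Num.truncn (2 * L / d)).+1; split => //.
  rewrite ltr_pdivrMr// (mulrC d) -ltr_pdivrMr//.
  by apply: truncnS_gt.
pose r := 2 * L / N%:R.
have r0 : 0 < r by rewrite divr_gt0 ?mulr_gt0// ltr0n.
have Nr : N%:R * r = 2 * L by rewrite mulrC divfK// pnatr_eq0 -lt0n.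
have LE : - L + N%:R * r = L by rewrite Nr; ring.
have hl t : L < `|t| -> beta (fun w => F (t, w)) = 0.
  move=> tL; rewrite -[RHS](bf0 hb); congr beta; apply/funext => w.
  by apply: hL; rewrite prod_normE/= lt_max tL.
have hosc t s w : `|t - s| <= r -> `|F (t, w) - F (s, w)| <= e'.
  move=> ts; apply: hd; rewrite prod_normE/= gt_max subrr normr0 d0 andbT.
  exact: le_lt_trans Nd.
pose S := \sum_(k < N) r * beta (fun w => F (- L + k%:R * r, w)).
have h1 : `|line_int (fun t => beta (fun w => F (t, w))) - S| <= 2 * L * (C * e').
  rewrite (line_int_segment hl).
  have := @riemann_sum_near R _ (- L) r (C * e') N cl (ltW r0).
  rewrite LE Nr; apply; first by rewrite mulr_ge0// ltW.
  move=> x y xy; rewrite -(bfB hb); [|exact: cc_slice..].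
  apply: hC.
  - by apply: ccB; exact: cc_slice.
  - exact: ltW.
  - move=> w hw; rewrite !hL ?subrr// prod_normE/= lt_max hw orbT//.
  - by move=> w; exact: hosc.
have cs k : cc (fun w => r * F (- L + k%:R * r, w)) by apply/ccZ/cc_slice.
have SE : S = beta (fun w => \sum_(k < N) r * F (- L + k%:R * r, w)).
  rewrite (bf_sum _ hb) => [|k]; last exact: cs.
  by apply: eq_bigr => k _; rewrite (bfZ hb)//; exact: cc_slice.
have h2 : `|S - beta (fun w => line_int (fun t => F (t, w)))| <= C * (2 * L * e').
  rewrite SE -(bfB hb)//; last by apply: cc_sum => k _; exact: cs.
  apply: hC.
  - by apply: ccB => //; apply: cc_sum => k _; exact: cs.
  - by rewrite ltW// mulr_gt0// mulr_gt0.
  - move=> w hw; rewrite big1 => [|k _].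
      rewrite sub0r; have -> : (fun t => F (t, w)) = (fun=> 0).
        by apply/funext => t; apply: hL; rewrite prod_normE/= lt_max hw orbT.
      by rewrite (bf0 (@line_int_bf R)) oppr0.
    by rewrite hL ?mulr0// prod_normE/= lt_max hw orbT.
  - move=> w; rewrite distrC (@line_int_segment _ _ L); last first.
      by move=> t tL; apply: hL; rewrite prod_normE/= lt_max tL.
    have := @riemann_sum_near R (fun t => F (t, w)) (- L) r e' N.
    rewrite LE Nr; apply; [exact: cc_slice_r|exact: ltW|exact: ltW|].
    by move=> x y; exact: hosc.
apply: (le_trans (ler_distD S _ _)).
apply: (le_trans (lerD h1 h2)).
have -> : e = 2 * L * (2 * C + 1) * e' by rewrite /e' mulrC divfK// gt_eqF.
have : 0 < 2 * L * e' by rewrite mulr_gt0// mulr_gt0.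
by clearbody e'; move: (e') => z; nra.
Qed.

End Swap.

(** * Integration on R^n *)

Section VolumeIntegral.
Variable R : realType.

Definition vcons n (t : R) (v : 'rV[R]_n) : 'rV[R]_n.+1 :=
  row_mx (const_mx t : 'rV[R]_1) v.

(** An iterated integral, which on the one-point space R^0 is evaluation; its basic properties then
    follow by induction on the dimension. *)
Fixpoint vol_int n : ('rV[R]_n -> R) -> R :=
  match n with
  | 0 => fun f => f 0
  | n'.+1 => fun f => line_int (fun t => vol_int (fun v : 'rV_n' => f (vcons t v)))
  end.

Lemma rV_norm_leP n (v : 'rV[R]_n) (B : R) : 0 <= B ->
  reflect (forall i, `|v 0 i| <= B) (`|v| <= B).
Proof.
move=> B0; apply: (iffP idP) => [vB i|h].
  apply: le_trans vB; rewrite [leRHS]/Num.Def.normr/= mx_normrE.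
  by apply: (le_trans _ (le_bigmax _ _ (0, i))).
rewrite [leLHS]/Num.Def.normr/= mx_normrE; apply/bigmax_leP; split => //.
by move=> [i j] _ /=; rewrite (ord1 i).
Qed.

Lemma rV_entry_le n (v : 'rV[R]_n) i : `|v 0 i| <= `|v|.
Proof. by have /rV_norm_leP -> := lexx `|v|. Qed.

Lemma vconsEl n t (v : 'rV[R]_n) (j : 'I_1) : vcons t v 0 (lshift n j) = t.
Proof. by apply: etrans (row_mxEl _ _ _ _) _; rewrite mxE. Qed.

Lemma vconsEr n t (v : 'rV[R]_n) j : vcons t v 0 (rshift 1 j) = v 0 j.
Proof. exact: row_mxEr. Qed.

Lemma vcons_norm n t (v : 'rV[R]_n) : `|vcons t v| = Num.max `|t| `|v|.
Proof.
apply/eqP; rewrite eq_le; apply/andP; split.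
  apply/rV_norm_leP => [|i]; first by rewrite le_max normr_ge0.
  rewrite le_max; case: (@split_ordP 1 n i) => j ->.
    by rewrite vconsEl lexx.
  by rewrite vconsEr rV_entry_le orbT.
rewrite ge_max; apply/andP; split.
  by have := rV_entry_le (vcons t v) (lshift n (0 : 'I_1)); rewrite vconsEl.
apply/rV_norm_leP => // i.
by have := rV_entry_le (vcons t v) (rshift 1 i); rewrite vconsEr.
Qed.

Lemma vconsB n t s (v w : 'rV[R]_n) : vcons t v - vcons s w = vcons (t - s) (v - w).
Proof.
have E (a b : 'rV[R]_n.+1) i : (a - b) 0 i = a 0 i - b 0 i by rewrite !mxE.
apply/rowP => i; rewrite E; case: (@split_ordP 1 n i) => j ->.
  by rewrite !vconsEl.
by rewrite !vconsEr !mxE.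
Qed.

Lemma vconsD n t s (v w : 'rV[R]_n) : vcons t v + vcons s w = vcons (t + s) (v + w).
Proof.
have E (a b : 'rV[R]_n.+1) i : (a + b) 0 i = a 0 i + b 0 i by rewrite !mxE.
apply/rowP => i; rewrite E; case: (@split_ordP 1 n i) => j ->.
  by rewrite !vconsEl.
by rewrite !vconsEr !mxE.
Qed.

Lemma vcons_surj n (w : 'rV[R]_n.+1) : exists t v, w = vcons t v.
Proof.
exists ((w : 'rV_(1 + n)) 0 (lshift n (0 : 'I_1))), (rsubmx (w : 'rV_(1 + n))).
apply/rowP => i; case: (@split_ordP 1 n i) => j ->.
  by rewrite vconsEl (ord1 j).
by rewrite vconsEr mxE.
Qed.

Lemma vcons_continuous n : continuous (fun p : R * 'rV[R]_n => vcons p.1 p.2).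
Proof.
move=> p; apply/cvgrPdist_lt => e e0.
apply/(@nbhs_ballP R (R * 'rV[R]_n)%type); exists e => //= q.
by rewrite -ball_normE/= vconsB vcons_norm prod_normE.
Qed.

Lemma cc_vcons n (f : 'rV[R]_n.+1 -> R) : cc f ->
  cc (fun p : R * 'rV[R]_n => f (vcons p.1 p.2)).
Proof.
move=> [cf [L hL]]; split.
  move=> p.
  by apply: (@continuous_comp _ _ _ (fun p : R * 'rV_n => vcons p.1 p.2) f);
    [exact: vcons_continuous|exact: cf].
by exists L => p hp; apply: hL; rewrite vcons_norm -prod_normE.
Qed.

Lemma cc_vcons_slice n (f : 'rV[R]_n.+1 -> R) t : cc f ->
  cc (fun v => f (vcons t v)).
Proof. by move=> /cc_vcons /(cc_slice t). Qed.

Lemma vol_int_bf n : bounded_functional (@vol_int n).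
Proof.
elim: n => [|n IH].
  split => //= L; exists 1 => // f B _ B0 _ hB; rewrite mul1r; exact: hB.
have cl (f : 'rV[R]_n.+1 -> R) : cc f ->
    cc (fun t => vol_int (fun v : 'rV_n => f (vcons t v))).
  move=> /cc_vcons; apply: cc_param => //; first exact: compact_balls_R.
  exact: compact_balls_rV.
split.
- move=> f g cf cg /=; rewrite -line_intD; [|exact: cl..].
  by congr line_int; apply/funext => t; rewrite (bfD IH)//; exact: cc_vcons_slice.
- move=> k f cf /=; rewrite -line_intZ; last exact: cl.
  by congr line_int; apply/funext => t; rewrite (bfZ IH)//; exact: cc_vcons_slice.
move=> L; have [C C0 hC] := bf_bound IH L.
exists (C * (2 * `|L|)); first by rewrite !mulr_ge0.
move=> f B cf B0 hL hB /=; rewrite mulrAC; apply: line_int_bound => //.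
- exact: cl.
- exact: mulr_ge0.
- move=> t tL; have -> : (fun v => f (vcons t v)) = (fun=> 0).
    apply/funext => v; apply: hL; rewrite vcons_norm lt_max.
    by rewrite (le_lt_trans (ler_norm L)).
  exact: bf0.
- move=> t; apply: hC => //; first exact: cc_vcons_slice.
  by move=> v hv; apply: hL; rewrite vcons_norm lt_max hv orbT.
Qed.

Lemma cc_vol_slice n (f : 'rV[R]_n.+1 -> R) : cc f ->
  cc (fun t => vol_int (fun v : 'rV_n => f (vcons t v))).
Proof.
move=> /cc_vcons; apply: cc_param; [exact: compact_balls_R|exact: compact_balls_rV|].
exact: vol_int_bf.
Qed.

Lemma vol_int_ge0 n (f : 'rV[R]_n -> R) : (forall x, 0 <= f x) -> 0 <= vol_int f.
Proof. by elim: n f => [|n IH] f f0 //=; apply: line_int_ge0 => t; exact: IH. Qed.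

Lemma vol_int_gt0 n (f : 'rV[R]_n -> R) p : cc f -> (forall x, 0 <= f x) ->
  0 < f p -> 0 < vol_int f.
Proof.
elim: n f p => [|n IH] f p cf f0 fp /=; first by rewrite (thinmx0 p) in fp.
have [t [v pE]] := vcons_surj p; rewrite pE in fp.
apply: (@line_int_gt0 _ _ t); first exact: cc_vol_slice.
  by move=> s; exact: vol_int_ge0.
by apply: (IH _ v) => //; exact: cc_vcons_slice.
Qed.

(** The outer variable is exchanged by [line_int_swap], the remaining ones by induction with the
    outer variable frozen. *)
Lemma vol_int_swap n (W : normedModType R) (F : 'rV[R]_n * W -> R)
    (beta : (W -> R) -> R) : compact_balls W -> bounded_functional beta -> cc F ->
  vol_int (fun v => beta (fun w => F (v, w))) =
  beta (fun w => vol_int (fun v => F (v, w))).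
Proof.
move=> cW hb; elim: n F => [|n IH] F cF //=.
(* With [v] as last factor, [cc_param] shows that integrating [v] out leaves a compactly supported
   function of the pair [(t, w)]. *)
pose G (p : (R * W) * 'rV[R]_n) := F (vcons p.1.1 p.2, p.1.2).
have cG : cc G.
  case: cF => cF [L hL]; split.
    move=> p; apply: (@continuous_comp _ _ _
      (fun p : (R * W) * 'rV[R]_n => (vcons p.1.1 p.2, p.1.2)) F); last exact: cF.
    apply/cvgrPdist_lt => e e0.
    apply/(@nbhs_ballP R ((R * W) * 'rV[R]_n)%type); exists e => //= q.
    rewrite -ball_normE/= !prod_normE/= vconsB vcons_norm !gt_max.
    by move=> /andP[/andP[-> ->] ->].
  exists L => p hp; apply: hL; move: hp; rewrite !prod_normE/= vcons_norm.
  by rewrite !lt_max => /orP[/orP[->|->]|->]; rewrite ?orbT.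
have cVn := @compact_balls_rV R n.
have cR := @compact_balls_R R.
have cH := cc_param (compact_balls_prod cR cW) cVn (vol_int_bf n) cG.
rewrite -(line_int_swap cW hb cH); congr line_int; apply/funext => t.
have ct : cc (fun p : 'rV[R]_n * W => F (vcons t p.1, p.2)).
  case: cF => cF [L hL]; split.
    move=> p; apply: (@continuous_comp _ _ _
      (fun p : 'rV[R]_n * W => (vcons t p.1, p.2)) F); last exact: cF.
    apply/cvgrPdist_lt => e e0.
    apply/(@nbhs_ballP R ('rV[R]_n * W)%type); exists e => //= q.
    rewrite -ball_normE/= !prod_normE/= vconsB vcons_norm !gt_max.
    by rewrite subrr normr0 e0.
  exists L => p hp; apply: hL; move: hp; rewrite !prod_normE/= vcons_norm.
  by rewrite !lt_max => /orP[->|->]; rewrite ?orbT.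
exact: (IH _ ct).
Qed.

Lemma cc_translate (V : normedModType R) (f : V -> R) a : cc f -> cc (fun v => f (v + a)).
Proof.
move=> [cf [L hL]]; split.
  move=> x; apply: (@continuous_comp _ _ _ (fun v => v + a) f); last exact: cf.
  by apply: cvgD; [exact: cvg_id|exact: cvg_cst].
exists (L + `|a|) => x hx; apply: hL.
have : `|x| <= `|x + a| + `|a| by rewrite -{1}(addrK a x) ler_normB.
by move: hx; lra.
Qed.

Lemma vol_int_translate n (f : 'rV[R]_n -> R) a : cc f ->
  vol_int (fun v => f (v + a)) = vol_int f.
Proof.
elim: n f a => [|n IH] f a cf /=; first by congr f; rewrite !thinmx0.
have [s [b ->]] := vcons_surj a.
transitivity (line_int (fun t => vol_int (fun v => f (vcons (t + s) v)))).
  congr line_int; apply/funext => t; rewrite -[RHS](IH _ b).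
    by congr vol_int; apply/funext => v; rewrite vconsD.
  exact: cc_vcons_slice.
have := @line_int_affine R (fun t => vol_int (fun v => f (vcons t v))) 1 s.
rewrite oner_eq0 normr1 invr1 mul1r => <- //; last exact: cc_vol_slice.
by congr line_int; apply/funext => t; rewrite mul1r.
Qed.

Lemma mulmxr_continuous m n (A : 'M[R]_(m, n)) : continuous (fun v : 'rV[R]_m => v *m A).
Proof.
apply: continuous_norm => v e e0.
have C0 : 0 < \sum_i \sum_j `|A i j| + 1.
  by rewrite ltr_wpDl// sumr_ge0// => i _; rewrite sumr_ge0.
exists (e / (\sum_i \sum_j `|A i j| + 1)); first exact: divr_gt0.
move=> w vw; rewrite -mulmxBl.
apply/rV_norm_leP => [|j]; first exact: ltW.
rewrite mxE (le_trans (ler_norm_sum _ _ _))//.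
apply: (@le_trans _ _ (\sum_i `|v - w| * `|A i j|)).
  by apply: ler_sum => i _; rewrite normrM ler_wpM2r// rV_entry_le.
rewrite -mulr_sumr; apply: (@le_trans _ _ (`|v - w| * (\sum_i \sum_j `|A i j| + 1))).
  rewrite ler_wpM2l// ler_wpDr// ler_sum// => i _.
  by rewrite (bigD1 j)//= lerDl sumr_ge0.
by rewrite -ler_pdivlMr// ltW.
Qed.

Lemma cc_mulmx n (f : 'rV[R]_n -> R) (A : 'M[R]_n) : A \in unitmx -> cc f ->
  cc (fun v => f (v *m A)).
Proof.
move=> uA cf; have [L L0 hL] := cc_support cf; case: cf => cf _; split.
  by apply: (@continuous_compT R _ _ _ f _ (@mulmxr_continuous _ _ A)); exact: cf.
have [k k0 hk] := @linear_lipschitz _ _ _ (mulmxr (invmx A) : {linear 'rV[R]_n -> 'rV[R]_n})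
  (@mulmxr_continuous _ _ (invmx A)).
exists (k * L) => v hv; apply: hL; rewrite -(ltr_pM2l k0); apply: lt_le_trans hv _.
by have := hk (v *m A); rewrite /= mulmxK.
Qed.

Lemma vcons_mul n (t : R) (v : 'rV[R]_n) (a : 'M[R]_1) b c (d : 'M[R]_n) :
  vcons t v *m (block_mx a b c d : 'M[R]_(1 + n)) =
  row_mx (const_mx t *m a + v *m c) (const_mx t *m b + v *m d).
Proof. exact: (@mul_row_block _ 1 1 n 1 n (const_mx t) v a b c d). Qed.

(** For a fixed tail [v] the map is affine of slope [a] in the first coordinate, so the integral
    over that coordinate is moved innermost. *)
Lemma vol_int_lblock n (f : 'rV[R]_n.+1 -> R) (a : R) (c : 'cV[R]_n) :
  a != 0 -> cc f ->
  vol_int (fun x => f (x *m (block_mx a%:M 0 c 1%:M : 'M[R]_(1 + n)))) =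
  `|a|^-1 * vol_int f.
Proof.
move=> a0 cf; set A := block_mx _ _ _ _.
have dA : \det (A : 'M[R]_(1 + n)) = a.
  by rewrite det_lblock det1 mulr1 det_scalar expr1.
have uA : (A : 'M[R]_n.+1) \in unitmx.
  by rewrite unitmxE (dA : \det (A : 'M[R]_n.+1) = a) unitfE.
have AE t v : vcons t v *m A = vcons (a * t + (v *m c) 0 0) v.
  rewrite vcons_mul mulmx0 add0r mulmx1; congr row_mx.
  rewrite mul_mx_scalar; apply/rowP => i; rewrite !(ord1 i) !mxE; congr (_ + _).
have cA := cc_vcons (cc_mulmx uA cf).
have cB := cc_vcons cf.
have cVn := @compact_balls_rV R n.
rewrite /= (line_int_swap cVn (vol_int_bf n) cA) (line_int_swap cVn (vol_int_bf n) cB).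
rewrite -(bfZ (vol_int_bf n)); last first.
  have cW := @compact_balls_R R.
  pose G (p : 'rV[R]_n * R) := f (vcons p.2 p.1).
  apply: (@cc_param R _ _ cVn cW G _ (line_int_bf R)).
  case: cB => cB [L hL]; split.
    move=> p; apply: (@continuous_comp _ _ _ (@unstable.swap _ R)
      (fun p : R * 'rV_n => f (vcons p.1 p.2))); last exact: cB.
    exact: swap_continuous.
  by exists L => p; rewrite prod_normE maxC => hp; apply: (hL (p.2, p.1)).
congr vol_int; apply/funext => v /=; rewrite -(@line_int_affine _ _ a ((v *m c) 0 0))//; last first.
  exact: (cc_slice_r v cB).
by congr line_int; apply/funext => t; rewrite AE.
Qed.

(** Gaussian elimination: an invertible matrix with nonzero corner is a product of two block
    triangular ones, one treated by [vol_int_lblock] and the other by induction. *)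
Lemma vol_int_mulmx n (f : 'rV[R]_n -> R) (A : 'M[R]_n) : A \in unitmx -> cc f ->
  vol_int (fun v => f (v *m A)) = `|\det A|^-1 * vol_int f.
Proof.
elim: n f A => [|n IH] f A uA cf.
  by rewrite /= det_mx00 normr1 invr1 mul1r mul0mx.
(* Such a matrix fixes the first coordinate [t] and acts on the tail by [S] followed by a
   translation depending on [t]. *)
have ublock (g : 'rV[R]_n.+1 -> R) (b : 'rV[R]_n) (S : 'M[R]_n) : cc g ->
    S \in unitmx ->
    vol_int (fun x => g (x *m (block_mx 1%:M b 0 S : 'M[R]_(1 + n)))) =
    `|\det S|^-1 * vol_int g.
  move=> cg uS /=; rewrite -line_intZ; last exact: cc_vol_slice.
  congr line_int; apply/funext => t.
  have cs := cc_vcons_slice t cg.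
  rewrite -(vol_int_translate (const_mx t *m b) cs).
  rewrite -IH//; last exact: (cc_translate (const_mx t *m b) cs).
  congr vol_int; apply/funext => v; congr g.
  by rewrite vcons_mul mulmx0 addr0 mulmx1 addrC.
have pivot (B : 'M[R]_(1 + n)) (g : 'rV[R]_n.+1 -> R) : cc g -> B \in unitmx ->
    B 0 0 != 0 -> vol_int (fun x => g (x *m B)) = `|\det B|^-1 * vol_int g.
  move=> cg uB B0; pose a := B 0 0; pose b := ursubmx B; pose c := dlsubmx B.
  (* The Schur complement of the corner entry, for which [B = P *m Q]. *)
  pose S := drsubmx B - a^-1 *: (c *m b).
  pose P : 'M[R]_(1 + n) := block_mx a%:M 0 c 1%:M.
  pose Q : 'M[R]_(1 + n) := block_mx 1%:M (a^-1 *: b) 0 S.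
  have BE : B = P *m Q.
    rewrite /P /Q mulmx_block !mulmx1 !mulmx0 !mul0mx !addr0 !mul1mx.
    rewrite mul_scalar_mx scalerA mulfV// scale1r -scalemxAr addrC subrK.
    rewrite -{1}(submxK B); congr block_mx.
    by apply/matrixP => i j; rewrite !(ord1 i) !(ord1 j) !mxE mulr1n; congr (B _ _);
      apply/val_inj.
  have dB : \det B = a * \det S.
    by rewrite BE det_mulmx /P /Q det_lblock det_ublock !det1 det_scalar expr1 mulr1 mul1r.
  have uS : S \in unitmx.
    by move: uB; rewrite !unitmxE dB unitrM => /andP[].
  have dQ : \det (Q : 'M[R]_(1 + n)) = \det S by rewrite det_ublock det1 mul1r.
  have uQ : (Q : 'M[R]_n.+1) \in unitmx.
    by rewrite unitmxE (dQ : \det (Q : 'M[R]_n.+1) = _) -unitmxE.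
  rewrite dB normrM invfM -mulrA -(@ublock g (a^-1 *: b))//.
  rewrite -(@vol_int_lblock _ _ a c)//; last exact: (cc_mulmx uQ cg).
  by congr vol_int; apply/funext => x; rewrite BE mulmxA.
pose A' : 'M[R]_(1 + n) := A.
have [a0|] := eqVneq (A' 0 0) 0; last exact: pivot.
have [c0|/rV0Pn[i ci]] := eqVneq (dlsubmx A')^T 0.
  have : \det A' = 0.
    rewrite -(submxK A') (_ : ulsubmx A' = 0); last first.
      apply/matrixP => i j; rewrite !(ord1 i) !(ord1 j) !mxE -[RHS]a0.
      by congr (A' _ _); apply/val_inj.
    by rewrite -(trmxK (dlsubmx A')) c0 trmx0 det_ublock det0 mul0r.
  by move: uA; rewrite unitmxE unitfE => /eqP.
(* The corner is 0, but invertibility gives a nonzero entry below it, in row [i] of the lower block.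
   The shear [E], of determinant 1, adds this row to the top one. *)
pose E : 'M[R]_(1 + n) := block_mx 1%:M (delta_mx 0 i) 0 1%:M.
have -> : vol_int (fun v => f (v *m A)) = vol_int (fun v => f (v *m (E *m A'))).
  have := @ublock _ (delta_mx 0 i) 1%:M (cc_mulmx uA cf) (unitmx1 _ _).
  rewrite det1 normr1 invr1 mul1r => <-.
  by congr vol_int; apply/funext => x; rewrite mulmxA.
have dE : \det (E *m A') = \det A by rewrite det_mulmx det_ublock !det1 !mul1r.
rewrite pivot//; first by rewrite dE.
  by rewrite unitmxE dE -unitmxE.
rewrite -(submxK A') mulmx_block -rowE mul1mx.
have -> : (0 : 'I_(1 + n)) = lshift n 0 by apply/val_inj.
rewrite block_mxEul !mxE (_ : A' _ _ = 0) ?add0r; last first.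
  by rewrite -[RHS]a0; congr (A' _ _); apply/val_inj.
by move: ci; rewrite !mxE.
Qed.

End VolumeIntegral.

(** * Derivatives along a line, and the vanishing integral of a derivative *)

Section DirectionalDerivative.
Variables (R : realType) (V : normedModType R).
Implicit Types (f : V -> R) (x e : V).

Lemma is_derive_line f x e (s : R) : derivable f (x + s *: e) e ->
  is_derive s (1 : R) (fun h : R => f (x + h *: e)) ('D_e f (x + s *: e)).
Proof.
move=> df.
have E : (fun h : R => h^-1 *: (((fun h : R => f (x + h *: e)) \o shift s) (h *: (1 : R)) -
    f (x + s *: e))) =
    (fun h : R => h^-1 *: ((f \o shift (x + s *: e)) (h *: e) - f (x + s *: e))).
  apply/funext => h /=; congr (_ *: (f _ - _)).
  have -> : h *: (1 : R) = h by exact: mulr1.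
  by rewrite scalerDl addrCA.
by split; rewrite /derivable /derive E.
Qed.

Lemma mvt_line f x e (h : R) : 0 < h ->
  (forall s, 0 <= s <= h -> derivable f (x + s *: e) e) ->
  exists2 c, 0 < c < h & f (x + h *: e) - f x = h * 'D_e f (x + c *: e).
Proof.
move=> h0 df; pose g (s : R) := f (x + s *: e).
have dg s : 0 <= s <= h -> is_derive s (1 : R) g ('D_e f (x + s *: e)).
  by move=> sh; apply: is_derive_line; exact: df.
have [] := @MVT R g (fun s => 'D_e f (x + s *: e)) 0 h h0.
- by move=> s; rewrite in_itv/= => /andP[s0 sh]; apply: dg; rewrite !ltW.
- apply: continuous_in_subspaceT => s; rewrite inE/= in_itv/= => sh.
  by apply/differentiable_continuous/derivable1_diffP; case: (dg s sh).
- move=> c; rewrite in_itv/= => ch; rewrite /g scale0r addr0 subr0 => ->.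
  by exists c => //; rewrite mulrC.
Qed.

End DirectionalDerivative.

Section VolumeDerivative.
Variables (R : realType) (n : nat).
Implicit Types (f : 'rV[R]_n -> R).

(** By translation invariance the difference quotient [q] has integral 0; by the mean value theorem
    it is uniformly close to the derivative, with support in a fixed ball. *)
Lemma vol_int_derive0 f e : cc f -> (forall x, derivable f x e) ->
  cc (fun x => 'D_e f x) -> vol_int (fun x => 'D_e f x) = 0.
Proof.
move=> cf df cdf; have [L L0 hL] := cc_support cf.
have [M M0 hM] := cc_support cdf.
have [C C0 hC] := bf_bound (@vol_int_bf R n) (L + M + `|e|).
apply/eqP; rewrite -normr_le0; apply/ler_addgt0Pl => eps eps0; rewrite addr0.
have C1 : 0 < C + 1 by rewrite ltr_wpDl.
have [d d0 hd] := cc_unif (@compact_balls_rV R n) cdf (divr_gt0 eps0 C1).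
(* The bound [h <= 1] keeps the translated support in the ball fixed above, and [h * |e| < d] limits
   the oscillation of the derivative along the step to [eps / (C + 1)]. *)
pose h : R := Num.min 1 (d / (2 * (`|e| + 1))).
have e1 : 0 < `|e| + 1 by rewrite ltr_wpDl.
have h0 : 0 < h by rewrite lt_min ltr01 divr_gt0// mulr_gt0.
have h1 : h <= 1 by rewrite ge_min lexx.
have hed : h * `|e| < d.
  have : h <= d / (2 * (`|e| + 1)) by rewrite ge_min lexx orbT.
  rewrite ler_pdivlMr ?mulr_gt0// => hh.
  have : 0 <= h * `|e| by rewrite mulr_ge0// ltW.
  by nra.
pose q x := h^-1 * (f (x + h *: e) - f x).
have cq : cc q by apply: ccZ; apply: ccB => //; exact: cc_translate.
have q0 : vol_int q = 0.
  rewrite (bfZ (@vol_int_bf R n)); last by apply: ccB => //; exact: cc_translate.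
  rewrite (bfB (@vol_int_bf R n))//; last exact: cc_translate.
  by rewrite vol_int_translate// subrr mulr0.
rewrite -[X in `|X|](subr0) -q0 -(bfB (@vol_int_bf R n))//.
apply: (@le_trans _ _ (C * (eps / (C + 1)))); last first.
  by rewrite mulrCA ger_pMr// ler_pdivrMr// mul1r; lra.
apply: hC.
- exact: ccB.
- by rewrite divr_ge0// ltW.
- move=> x hx; rewrite hM; last by move: hx; have := normr_ge0 e; lra.
  rewrite /q !hL ?subrr ?mulr0 ?subrr//.
    by move: hx; have := normr_ge0 e; lra.
  have : `|x| <= `|x + h *: e| + `|h *: e| by rewrite -{1}(addrK (h *: e) x) ler_normB.
  rewrite normrZ gtr0_norm//.
  have : h * `|e| <= `|e| by rewrite ler_piMl.
  by have := normr_ge0 e; lra.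
- move=> x; have [c /andP[c0 ch] E] := mvt_line h0 (fun s _ => df (x + s *: e)).
  rewrite /q E mulKf ?gt_eqF//; apply: hd.
  rewrite opprD addrA subrr add0r normrN normrZ gtr0_norm//.
  by apply: le_lt_trans hed; rewrite ler_wpM2r// ltW.
Qed.

End VolumeDerivative.

(** * Compactness arguments *)

Section CompactUniform.
Variable R : realType.

(** The common pattern of uniform continuity, boundedness and uniform differentiability on a compact
    set: scales valid near each point are merged into one by the near-covering form of
    compactness. *)
Lemma compact_uniform (V : normedModType R) (K : set V) (P : R -> V -> Prop) :
  compact K ->
  (forall p, K p -> exists2 d : R, 0 < d &
    forall q r, `|p - q| < d -> 0 < r < d -> P r q) ->
  exists2 d : R, 0 < d & forall p, K p -> P d p.
Proof.
move=> /compact_near_coveringP ncov h.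
have pos : \forall d \near 0^'+, (0 < d :> R) by exact: nbhs_right_gt.
suff hP : \forall d \near 0^'+, K `<=` P d.
  suff [d [d0 hd]] : exists d : R, 0 < d /\ K `<=` P d by exists d.
  by apply: (@filter_ex _ (0^'+ : set_system R)); exact: filterI.
apply: ncov => p /h[d d0 hd].
exists (ball p d, [set r | 0 < r < d]) => /=.
  split; first exact: nbhsx_ballx.
  by near=> r; apply/andP; split; near: r; [exact: nbhs_right_gt|exact: nbhs_right_lt].
by move=> [q r] /=; rewrite -ball_normE/= => -[]; exact: hd.
Unshelve. all: by end_near. Qed.

Lemma compact_unif_continuous (V : normedModType R) (K : set V) (f : V -> R) (e : R) :
  compact K -> (forall x, K x -> {for x, continuous f}) -> 0 < e ->
  exists2 d : R, 0 < d & forall p, K p -> forall v, `|v| < d -> `|f (p + v) - f p| <= e.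
Proof.
move=> cK cf e0; apply: (compact_uniform cK) => p /cf /cvgrPdist_le /(_ (e / 2)).
rewrite divr_gt0// => /(_ isT) /nbhs_ballP[d /= d0 hd].
exists (d / 2); first by rewrite divr_gt0.
move=> q r pq /andP[r0 rd] v vr; rewrite (splitr e).
rewrite (le_trans (ler_distD (f p) _ _))// lerD//; last first.
  by apply: hd; rewrite -ball_normE/=; lra.
rewrite distrC; apply: hd; rewrite -ball_normE/= opprD addrA.
by apply: le_lt_trans (ler_normB _ _) _; lra.
Qed.

Lemma compact_bounded_for (V : normedModType R) (K : set V) (f : V -> R) :
  compact K -> (forall x, K x -> {for x, continuous f}) ->
  exists2 M : R, 0 < M & forall x, K x -> `|f x| <= M.
Proof.
move=> cK cf.
(* Boundedness fits [compact_uniform] once the bound is sought as the inverse of the scale. *)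
have [d d0 hd] : exists2 d : R, 0 < d & forall p, K p -> `|f p| <= d^-1.
  apply: (compact_uniform cK) => p /cf /cvgrPdist_le /(_ 1 ltr01).
  move=> /nbhs_ballP[d /= d0 hd].
  have f1 : 0 < `|f p| + 1 by rewrite ltr_wpDl.
  exists (Num.min d (`|f p| + 1)^-1).
    by rewrite lt_min d0 invr_gt0.
  move=> q r; rewrite lt_min => /andP[pq _] /andP[r0].
  rewrite lt_min => /andP[_ rf].
  have fq : `|f p - f q| <= 1 by apply: hd; rewrite -ball_normE.
  apply: (@le_trans _ _ (`|f p| + 1)).
    have : `|f q| <= `|f p| + `|f p - f q|.
      by rewrite distrC -{1}(subrK (f p) (f q)) addrC ler_normD.
    by lra.
  by rewrite -[leLHS]invrK lef_pV2 ?posrE ?invr_gt0// ltW.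
by exists d^-1 => //; rewrite invr_gt0.
Qed.

Lemma compact_open_thicken (V : normedModType R) (K U : set V) :
  compact K -> open U -> K `<=` U ->
  exists2 d : R, 0 < d & forall p v, K p -> `|v| < d -> U (p + v).
Proof.
move=> cK oU KU.
have [d d0 hd] : exists2 d : R, 0 < d & forall p, K p -> forall v, `|v| < d -> U (p + v).
  apply: (compact_uniform cK) => p Kp.
  have /nbhs_ballP[d /= d0 hd] := open_nbhs_nbhs (conj oU (KU _ Kp)).
  exists (d / 2); first by rewrite divr_gt0.
  move=> q r pq /andP[r0 rd] v vr; apply: hd; rewrite -ball_normE/= opprD addrA.
  by apply: le_lt_trans (ler_normB _ _) _; lra.
by exists d => // p v /hd; exact.
Qed.

Lemma compact_thicken (V : normedModType R) (K : set V) (d : R) :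
  compact_balls V -> compact K ->
  compact [set x | exists p v, [/\ K p, `|v| <= d & x = p + v]].
Proof.
move=> cV cK; have -> : [set x | exists p v, [/\ K p, `|v| <= d & x = p + v]] =
    (fun p : V * V => p.1 + p.2) @` (K `*` [set v | `|v| <= d]).
  apply/seteqP; split => [x [p [v [Kp vd ->]]]|x [[p v] [/= Kp vd] <-]].
    by exists (p, v).
  by exists p, v.
apply: continuous_compact; last exact: compact_setX.
apply: continuous_subspaceT => -[p v] /=.
exact: add_continuous.
Qed.

(** Off [K], whose complement is open, the function is locally 0; on [K] continuity is given. This
    is how functions known in one chart become functions on the whole space. *)
Lemma cc_extend (V : normedModType R) (K W : set V) (f : V -> R) :
  compact K -> (forall x, K x -> W x) ->
  (forall x, W x -> {for x, continuous f}) -> (forall x, ~ K x -> f x = 0) -> cc f.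
Proof.
move=> cK KW cf f0; split; last first.
  have /compact_bounded[M [_ hM]] := cK.
  have M1 : M < `|M| + 1 by rewrite ltr_pwDr// ler_norm.
  exists (`|M| + 1) => x hx; apply: f0 => /(hM _ M1).
  by move=> /=; rewrite leNgt hx.
move=> x; have [Kx|nKx] := pselect (K x); first by apply: cf; exact: KW.
have oK : open (~` K).
  by apply: closed_openC; exact: (compact_closed (@norm_hausdorff _ V)).
have nK : \forall y \near x, (~` K) y by exact: open_nbhs_nbhs.
by apply: (@near_cst_continuous _ _ 0); apply: filterS nK => y /f0.
Qed.

End CompactUniform.

(** * Uniform first-order expansions *)

Section UniformDifferentiability.
Variable R : realType.

Lemma norm_mulmx_le m n (v : 'rV[R]_m) (A : 'M[R]_(m, n)) :
  `|v *m A| <= `|v| * \sum_i \sum_j `|A i j|.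
Proof.
apply/rV_norm_leP => [|j].
  by rewrite mulr_ge0// sumr_ge0// => i _; rewrite sumr_ge0.
rewrite mxE (le_trans (ler_norm_sum _ _ _))// mulr_sumr ler_sum// => i _.
rewrite normrM ler_pM// ?rV_entry_le//.
by rewrite (bigD1 j)//= lerDl sumr_ge0.
Qed.

Lemma diff_jacobian m n (g : 'rV[R]_m -> 'rV[R]_n) x v : 'd g x v = v *m jacobian g x.
Proof. by rewrite /jacobian mul_rV_lin1. Qed.

Lemma continuous_for_eq (V : normedModType R) (f g : V -> R) x : f =1 g ->
  {for x, continuous f} -> {for x, continuous g}.
Proof. by move=> /funext ->. Qed.

Lemma continuous_for_norm (V : normedModType R) (f : V -> R) x :
  {for x, continuous f} -> {for x, continuous (fun y => `|f y| : R)}.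
Proof. by move=> cf; apply: cvg_norm; exact: cf. Qed.

Lemma continuous_forM (V : normedModType R) (f g : V -> R) x :
  {for x, continuous f} -> {for x, continuous g} ->
  {for x, continuous (fun y => f y * g y : R)}.
Proof. by move=> cf cg; apply: cvgM; [exact: cf|exact: cg]. Qed.

Lemma continuous_forD (V : normedModType R) (f g : V -> R) x :
  {for x, continuous f} -> {for x, continuous g} ->
  {for x, continuous (fun y => f y + g y : R)}.
Proof. by move=> cf cg; apply: cvgD; [exact: cf|exact: cg]. Qed.

Lemma continuous_forN (V : normedModType R) (f : V -> R) x :
  {for x, continuous f} -> {for x, continuous (fun y => - f y : R)}.
Proof. by move=> cf; apply: cvgN; exact: cf. Qed.

Lemma continuous_for_comp (U V W : normedModType R) (f : V -> W) (g : U -> V) x :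
  {for x, continuous g} -> {for g x, continuous f} ->
  {for x, continuous (fun y => f (g y))}.
Proof. by move=> cg cf; apply: continuous_comp; [exact: cg|exact: cf]. Qed.

Lemma continuous_for_open_eq (V : normedModType R) (f g : V -> R) (W : set V) x :
  open W -> W x -> (forall y, W y -> f y = g y) ->
  {for x, continuous f} -> {for x, continuous g}.
Proof.
move=> oW Wx fg cf; rewrite /prop_for/continuous_at -fg//.
apply: cvg_trans cf; apply: near_eq_cvg.
have nW : \forall y \near x, W y by exact: open_nbhs_nbhs.
by apply: filterS nW => y /fg ->.
Qed.

Lemma continuous_for_pair (U V : normedModType R) (z : U) (y : V) :
  {for y, continuous (fun y : V => (z, y))}.
Proof. by apply: cvg_pair; [exact: cvg_cst|exact: cvg_id]. Qed.

Lemma continuous_for_sum (V : normedModType R) (I : Type) (s : seq I)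
    (F : I -> V -> R) x : (forall i, {for x, continuous (F i)}) ->
  {for x, continuous (fun y => \sum_(i <- s) F i y)}.
Proof.
move=> cF; elim: s => [|i s IH].
  apply: (@continuous_for_eq _ (fun=> 0)); last exact: cvg_cst.
  by move=> y; rewrite big_nil.
apply: (@continuous_for_eq _ (fun y => F i y + \sum_(i <- s) F i y)).
  by move=> y; rewrite big_cons.
by apply: cvgD; [exact: cF|exact: IH].
Qed.

Lemma continuous_for_prod (V : normedModType R) (I : Type) (s : seq I)
    (F : I -> V -> R) x : (forall i, {for x, continuous (F i)}) ->
  {for x, continuous (fun y => \prod_(i <- s) F i y)}.
Proof.
move=> cF; elim: s => [|i s IH].
  apply: (@continuous_for_eq _ (fun=> 1)); last exact: cvg_cst.
  by move=> y; rewrite big_nil.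
apply: (@continuous_for_eq _ (fun y => F i y * \prod_(i <- s) F i y)).
  by move=> y; rewrite big_cons.
by apply: cvgM; [exact: cF|exact: IH].
Qed.

Lemma continuous_for_det (V : normedModType R) n (A : V -> 'M[R]_n) x :
  (forall i j, {for x, continuous (fun y => A y i j)}) ->
  {for x, continuous (fun y => \det (A y))}.
Proof.
move=> cA; rewrite /determinant; apply: continuous_for_sum => s.
apply: cvgM; first exact: cvg_cst.
by apply: continuous_for_prod => i; exact: cA.
Qed.

Lemma coord_for_continuous (V : normedModType R) n (g : V -> 'rV[R]_n) x j :
  {for x, continuous g} -> {for x, continuous (fun y => g y 0 j)}.
Proof.
move=> cg; apply/cvgrPdist_le => e e0.
have /cvgrPdist_le /(_ e e0) := cg; apply: filterS => y; apply: le_trans.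
by have := rV_entry_le (g x - g y) j; rewrite !mxE.
Qed.

Lemma is_diff_coord n (x : 'rV[R]_n) j :
  is_diff x (fun w : 'rV[R]_n => w 0 j) (fun w : 'rV[R]_n => w 0 j).
Proof.
have lin : linear (fun w : 'rV[R]_n => w 0 j : R^o) by move=> a u v; rewrite !mxE.
pose f : {linear 'rV[R]_n -> R^o} :=
  HB.pack (fun w : 'rV[R]_n => w 0 j : R^o) (GRing.isLinear.Build _ _ _ _ _ lin).
have cf : continuous f by move=> y; exact: coord_continuous.
by apply: DiffDef; [exact: differentiable_coord|exact: (@diff_lin _ _ _ f)].
Qed.

Lemma is_diff_component (V : normedModType R) n (g : V -> 'rV[R]_n) x j :
  differentiable g x -> is_diff x (fun y => g y 0 j) (fun w => ('d g x w) 0 j).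
Proof.
move=> dg; apply: (@is_diff_comp R _ _ _ g ('d g x) (fun w : 'rV[R]_n => w 0 j)
  (fun w : 'rV[R]_n => w 0 j) x (differentiableP dg)).
exact: is_diff_coord.
Qed.

Lemma jacobian_continuous m n (g : 'rV[R]_m -> 'rV[R]_n) W x i j :
  Ck_on 1 g W -> W x -> {for x, continuous (fun y => jacobian g y i j)}.
Proof.
move=> [_ cg] Wx; have -> : (fun y => jacobian g y i j) =
    (fun y => ('d g y (delta_mx 0 i)) 0 j).
  by apply/funext => y; rewrite diff_jacobian -rowE [RHS]mxE.
by apply: coord_for_continuous; exact: cg.
Qed.

(** The mean value theorem, applied to each component, leaves a difference of Jacobian entries at
    two nearby points, which is small by continuity, and uniformly so by compactness. *)
Lemma uniform_diff m n (g : 'rV[R]_m -> 'rV[R]_n) (K W : set 'rV[R]_m) (e : R) :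
  compact K -> open W -> K `<=` W -> Ck_on 1 g W -> 0 < e ->
  exists2 d : R, 0 < d & forall p v, K p -> `|v| < d ->
    `|g (p + v) - g p - v *m jacobian g p| <= e * `|v|.
Proof.
move=> cK oW KW c1 e0; have [dg _] := c1.
suff [d d0 hd] : exists2 d : R, 0 < d & forall p, K p -> forall v, `|v| < d ->
    `|g (p + v) - g p - v *m jacobian g p| <= e * `|v|.
  by exists d => // p v Kp; exact: hd.
apply: (compact_uniform cK) => p Kp.
have Wp := KW _ Kp.
(* Each of the [m] entries contributes at most [2 * e'], as both Jacobians are compared with the one
   at [p]; the [+ 1] covers [m = 0]. *)
pose e' := e / (2 * (m%:R + 1)).
have m1 : 0 < m%:R + 1 :> R by rewrite ltr_wpDl.
have e'0 : 0 < e' by rewrite divr_gt0// mulr_gt0.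
have [d d0 hd] : exists2 d : R, 0 < d & forall y, `|p - y| < d ->
    W y /\ forall i j, `|jacobian g p i j - jacobian g y i j| <= e'.
  have nW : \forall y \near p, W y by exact: open_nbhs_nbhs.
  have nJ : \forall y \near p, forall i j, `|jacobian g p i j - jacobian g y i j| <= e'.
    apply: (@filter_forall 'rV[R]_m 'I_m (fun i y => forall j,
      `|jacobian g p i j - jacobian g y i j| <= e') _ (nbhs_filter p)) => i.
    apply: (@filter_forall 'rV[R]_m 'I_n (fun j y =>
      `|jacobian g p i j - jacobian g y i j| <= e') _ (nbhs_filter p)) => j.
    by have /cvgrPdist_le /(_ e' e'0) := @jacobian_continuous _ _ _ _ _ i j c1 Wp.
  have [d /= d0 hd] := proj1 (@nbhs_ballP R 'rV[R]_m p _) (filterI nW nJ).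
  by exists d => // y py; apply: hd; rewrite -ball_normE.
exists (d / 2); first by rewrite divr_gt0.
move=> q r pq /andP[r0 rd] v vr; apply/rV_norm_leP => [|j].
  by rewrite mulr_ge0// ltW.
have hq s : 0 <= s <= 1 -> `|p - (q + s *: v)| < d.
  move=> /andP[s0 s1]; rewrite opprD addrA.
  apply: le_lt_trans (ler_normB _ _) _.
  rewrite normrZ ger0_norm//.
  have : s * `|v| <= `|v| by rewrite ler_piMl.
  by lra.
pose gj (y : 'rV[R]_m) : R := g y 0 j.
have dgj y : W y -> is_diff y gj (fun w => ('d g y w) 0 j).
  by move=> /dg; exact: is_diff_component.
have dl s : 0 <= s <= 1 -> derivable gj (q + s *: v) v.
  by move=> /hq/hd[Wy _]; apply: diff_derivable; case: (dgj _ Wy).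
have [c /andP[c0 c1'] E] := mvt_line ltr01 dl.
have [Wc Jc] := hd _ (hq c (introT andP (conj (ltW c0) (ltW c1')))).
have [Wq Jq] : W q /\ forall i j, `|jacobian g p i j - jacobian g q i j| <= e'.
  by apply: hd; lra.
rewrite scale1r mul1r in E.
have subE (a b : 'rV[R]_n) : (a - b) 0 j = a 0 j - b 0 j by rewrite !mxE.
have mulE (A : 'M[R]_(m, n)) : (v *m A) 0 j = \sum_i v 0 i * A i j by rewrite mxE.
rewrite (subE (g (q + v) - g q)) (subE (g (q + v))).
rewrite (_ : g (q + v) 0 j - g q 0 j = 'D_v gj (q + c *: v)); last exact: E.
move: E => _.
rewrite deriveE; last by case: (dgj _ Wc).
have -> : 'd gj (q + c *: v) v = (v *m jacobian g (q + c *: v)) 0 j.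
  by rewrite -diff_jacobian; case: (dgj _ Wc) => _ ->.
move: (jacobian g p) (jacobian g q) (jacobian g (q + c *: v)) Jq Jc => A B C AB AC.
rewrite (mulE B) (mulE C) -sumrB (le_trans (ler_norm_sum _ _ _))//.
apply: (@le_trans _ _ (\sum_(i < m) `|v| * (2 * e'))).
  apply: ler_sum => i _; rewrite -mulrBr normrM ler_pM// ?rV_entry_le//.
  have := ler_distD (A i j) (C i j) (B i j).
  by have := AC i j; have := AB i j; rewrite (distrC (A i j) (C i j)); lra.
rewrite sumr_const card_ord -[leLHS]mulr_natl.
have -> : e = 2 * (m%:R + 1) * e' by rewrite /e' mulrC divfK// gt_eqF// mulr_gt0.
have : 0 <= `|v| * e' by rewrite mulr_ge0// ltW.
by clearbody e'; move: (m%:R : R) m1 (`|v|) => M M1 w; nra.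
Qed.

End UniformDifferentiability.

Section GermOfDifferential.
Variables (R : realType) (U V : normedModType R).

(** Chart expressions agree only on open sets, so their differentials are compared through germs. *)
Lemma near_eq_diff (f g : U -> V) x : (\forall y \near x, f y = g y) ->
  differentiable f x -> differentiable g x /\ 'd g x = 'd f x :> (U -> V).
Proof.
move=> fg df; have [dfc dfE] := (diff_locallyP x f).1 df.
have gE : g \o shift x = cst (g x) + 'd f x +o_ 0 id.
  apply/eqaddoP => e e0.
  have /eqaddoP/(_ e e0) fe := dfE.
  have fg0 : \forall h \near (0 : U), f (h + x) = g (h + x).
    have /nbhs_ballP[d /= d0 hd] := fg.
    apply/nbhs_ballP; exists d => //= h; rewrite -ball_normE/= sub0r normrN => hh.
    by apply: hd; rewrite -ball_normE/= opprD addrCA subrr addr0 normrN.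
  have fgx : f x = g x by exact: nbhs_singleton fg.
  near=> h; rewrite /= -fgx.
  have -> : (g \o shift x - (cst (f x) + 'd f x)) h =
      (f \o shift x - (cst (f x) + 'd f x)) h.
    rewrite -[LHS]/(g (h + x) - (f x + 'd f x h)).
    rewrite -[RHS]/(f (h + x) - (f x + 'd f x h)).
    by congr (_ - _); apply/esym; near: h.
  by near: h.
have dg : 'd g x = 'd f x :> (U -> V) by exact: diff_unique.
split; last exact: dg.
by apply/diff_locallyP; rewrite dg; split; [exact: dfc|exact: gE].
Unshelve. all: by end_near. Qed.

End GermOfDifferential.

(** * Scaling of the integral, and a mollifier *)

Section VolumeScaling.
Variables (R : realType) (n : nat).
Implicit Types (f g h : 'rV[R]_n -> R).

Lemma vol_int_norm_le f g : cc f -> cc g -> (forall x, `|f x| <= g x) ->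
  `|vol_int f| <= vol_int g.
Proof.
move=> cf cg fg; have hb := @vol_int_bf R n.
have fg' x : - g x <= f x <= g x by rewrite -ler_norml.
have p : 0 <= vol_int g - vol_int f.
  by rewrite -(bfB hb cg cf); apply: vol_int_ge0 => x; have := fg' x; lra.
have q : 0 <= vol_int g + vol_int f.
  by rewrite -(bfD hb cg cf); apply: vol_int_ge0 => x; have := fg' x; lra.
rewrite ler_norml; lra.
Qed.

Lemma vol_int_scale h x (r : R) : cc h -> r != 0 ->
  vol_int h = `|r| ^+ n * vol_int (fun w => h (x + r *: w)).
Proof.
move=> ch r0; rewrite -(vol_int_translate x ch).
have uA : (r%:M : 'M[R]_n) \in unitmx by rewrite unitmxE det_scalar unitfE expf_neq0.
have -> : (fun w => h (x + r *: w)) = (fun w => h (w *m r%:M + x)).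
  by apply/funext => w; rewrite mul_mx_scalar addrC.
rewrite (vol_int_mulmx uA (cc_translate x ch)) det_scalar normrX mulrA mulfV ?mul1r//.
by rewrite expf_neq0// normr_eq0.
Qed.

Lemma cc_scale h x (r : R) : cc h -> r != 0 -> cc (fun w => h (x + r *: w)).
Proof.
move=> ch r0.
have uA : (r%:M : 'M[R]_n) \in unitmx by rewrite unitmxE det_scalar unitfE expf_neq0.
have -> : (fun w => h (x + r *: w)) = (fun w => h (w *m r%:M + x)).
  by apply/funext => w; rewrite mul_mx_scalar addrC.
exact: (cc_mulmx uA (cc_translate x ch)).
Qed.

(** The profile of the mollifier. Being 1-Lipschitz, it passes an error on its argument to its value
    without amplifying it. *)
Definition tent (x : 'rV[R]_n) : R := Num.max 0 (1 - `|x|).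

Lemma tent_ge0 x : 0 <= tent x.
Proof. by rewrite le_max lexx. Qed.

Lemma tent_le1 x : tent x <= 1.
Proof. by rewrite ge_max ler01/= lerBlDr lerDl. Qed.

Lemma tent_out x : 1 <= `|x| -> tent x = 0.
Proof. by move=> x1; apply/max_idPl; rewrite subr_le0. Qed.

Lemma tentN x : tent (- x) = tent x.
Proof. by rewrite /tent normrN. Qed.

Lemma tent_lipschitz x y : `|tent x - tent y| <= `|x - y|.
Proof.
have h (a b : 'rV[R]_n) : tent a - tent b <= `|a - b|.
  rewrite lerBlDr ge_max addr_ge0 ?tent_ge0//=.
  have : 1 - `|b| <= tent b by rewrite le_max lexx orbT.
  have : `|b| <= `|a| + `|a - b|.
    by rewrite distrC -{1}(subrK a b) addrC ler_normD.
  by lra.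
by rewrite ler_norml h andbT lerNl opprB distrC h.
Qed.

Lemma tent_continuous : continuous tent.
Proof.
apply: continuous_norm => x e e0; exists e => // y xy.
by apply: le_trans (tent_lipschitz _ _) _; exact: ltW.
Qed.

Lemma cc_tent : cc tent.
Proof. by split; [exact: tent_continuous|exists 1 => x /ltW /tent_out]. Qed.

Lemma vol_int_tent_gt0 : 0 < vol_int tent.
Proof.
apply: (@vol_int_gt0 _ _ _ 0); [exact: cc_tent|exact: tent_ge0|].
by rewrite /tent normr0 subr0 lt_max ltr01 orbT.
Qed.

End VolumeScaling.

(** * Change of variables *)

Section ChangeOfVariables.
Local Opaque vol_int.
Variables (R : realType) (n : nat) (U V : set 'rV[R]_n).
Variables (psi theta : 'rV[R]_n -> 'rV[R]_n).
Hypotheses (oU : open U) (oV : open V).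
Hypothesis psiV : forall x, U x -> V (psi x).
Hypotheses (psiK : forall x, U x -> theta (psi x) = x).
Hypotheses (thetaK : forall y, V y -> psi (theta y) = y).
Hypotheses (psi1 : Ck_on 1 psi U) (theta1 : Ck_on 1 theta V).

(** Cut off outside [V], where [theta] is arbitrary, so that multiplying by it yields a function on
    the whole space. *)
Definition jac_factor (y : 'rV[R]_n) : R :=
  if `[< V y >] then `|\det (jacobian theta y)| else 0.

Lemma jac_factor_ge0 y : 0 <= jac_factor y.
Proof. by rewrite /jac_factor; case: ifPn. Qed.

Lemma jac_factorE y : V y -> jac_factor y = `|\det (jacobian theta y)|.
Proof. by move=> Vy; rewrite /jac_factor asboolT. Qed.

Lemma jac_factor_out y : ~ V y -> jac_factor y = 0.
Proof. by move=> Vy; rewrite /jac_factor asboolF. Qed.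

Lemma jac_factor_continuous y : V y -> {for y, continuous jac_factor}.
Proof.
move=> Vy.
have cd : {for y, continuous (fun z => `|\det (jacobian theta z)| : R)}.
  apply: continuous_for_norm; apply: continuous_for_det => i j.
  exact: (jacobian_continuous theta1 Vy).
by apply: continuous_for_open_eq oV Vy _ cd => z Vz; rewrite jac_factorE.
Qed.

Lemma psi_continuous x : U x -> {for x, continuous psi}.
Proof. by move=> Ux; apply: differentiable_continuous; case: psi1 => + _; exact. Qed.

Lemma theta_continuous y : V y -> {for y, continuous theta}.
Proof. by move=> Vy; apply: differentiable_continuous; case: theta1 => + _; exact. Qed.

Lemma compact_psi K : compact K -> K `<=` U -> compact (psi @` K).
Proof.
move=> cK KU; apply: continuous_compact => //.
by apply: continuous_in_subspaceT => x /[1!inE] /KU; exact: psi_continuous.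
Qed.

Lemma jacobian_inverse x : U x -> jacobian psi x *m jacobian theta (psi x) = 1%:M.
Proof.
move=> Ux; have Vx := psiV Ux.
have dp : differentiable psi x by case: psi1 => + _; exact.
have dt : differentiable theta (psi x) by case: theta1 => + _; exact.
have near_id : \forall y \near x, (id : 'rV[R]_n -> 'rV[R]_n) y = (theta \o psi) y.
  have nU : \forall y \near x, U y by exact: open_nbhs_nbhs.
  by apply: filterS nU => y Uy /=; rewrite psiK.
have did : differentiable (id : 'rV[R]_n -> 'rV[R]_n) x by [].
have [_ E] := near_eq_diff near_id did.
apply/row_matrixP => i; rewrite !rowE mulmxA -!diff_jacobian mulmx1.
have -> : 'd theta (psi x) ('d psi x (delta_mx 0 i)) = 'd (theta \o psi) x (delta_mx 0 i).
  exact: (esym (congr1 (@^~ (delta_mx 0 i)) (diff_comp dp dt))).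
apply: etrans (congr1 (@^~ (delta_mx 0 i)) E) _.
by have [_ Eid] := @is_diff_id R _ x; exact: (congr1 (@^~ (delta_mx 0 i)) Eid).
Qed.

Variables (u : 'rV[R]_n -> R) (K : set 'rV[R]_n).
Hypotheses (cu : cc u) (cK : compact K) (KU : K `<=` U).
Hypothesis u0 : forall x, ~ K x -> u x = 0.

Definition pullback (y : 'rV[R]_n) : R := u (theta y) * jac_factor y.

Lemma cc_pullback : cc pullback.
Proof.
apply: (@cc_extend _ _ (psi @` K) V).
- exact: compact_psi.
- by move=> _ [x /KU Ux <-]; exact: psiV.
- move=> y Vy; apply: continuous_forM; last exact: jac_factor_continuous.
  apply: continuous_for_comp; first exact: theta_continuous.
  by case: cu => cu' _; exact: cu'.
- move=> y nK; rewrite /pullback; have [Vy|nVy] := pselect (V y).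
    rewrite u0 ?mul0r// => Kt; apply: nK; exists (theta y) => //; exact: thetaK.
  by rewrite jac_factor_out// mulr0.
Qed.

(** A bump of size [r] around [z], transported to the target by [theta]. The Jacobian factor makes
    its integral over [y] close to [r ^+ n * c0], whatever the point [z] of [K]. *)
Definition kernel_fun (r : R) (z y : 'rV[R]_n) : R :=
  tent (r^-1 *: (theta y - z)) * jac_factor y.

Lemma kernel_near r z y : 0 < r -> kernel_fun r z y != 0 -> V y /\ `|theta y - z| < r.
Proof.
move=> r0 h; split.
  by apply: contrapT => nV; move: h; rewrite /kernel_fun jac_factor_out// mulr0 eqxx.
rewrite ltNge; apply/negP => rz; move: h.
rewrite /kernel_fun tent_out ?mul0r ?eqxx//.
by rewrite normrZ gtr0_norm ?invr_gt0// mulrC ler_pdivlMr// mul1r.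
Qed.

Lemma kernel_continuous r (p : 'rV[R]_n * 'rV[R]_n) : V p.2 ->
  {for p, continuous (fun p => kernel_fun r p.1 p.2)}.
Proof.
move=> Vp; apply: cvgM.
  apply: (@continuous_comp _ _ _ (fun p : 'rV[R]_n * 'rV[R]_n =>
    r^-1 *: (theta p.2 - p.1)) (@tent R n)); last exact: tent_continuous.
  apply: cvgZr; apply: cvgB; last exact: cvg_fst.
  by apply: (@continuous_comp _ _ _ snd theta); [exact: cvg_snd|exact: theta_continuous].
by apply: (@continuous_comp _ _ _ snd jac_factor); [exact: cvg_snd|exact: jac_factor_continuous].
Qed.

Let c0 := vol_int (@tent R n).

(* The constants do not depend on the mollification scale [r < r0]. *)
Record scale_data (K3 : set 'rV[R]_n) (r0 Lam MJ : R) : Prop := ScaleData {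
  sd_compact : compact K3;
  sd_V : K3 `<=` V;
  sd_K : forall z, K z -> K3 (psi z);
  sd_r0 : 0 < r0;
  sd_Lam : 0 < Lam;
  sd_MJ : 0 < MJ;
  sd_ker : forall (r : R) z y, 0 < r < r0 -> K z -> kernel_fun r z y != 0 -> K3 y;
  sd_bound : forall y, K3 y -> jac_factor y <= MJ;
  sd_lip : forall z (v : 'rV[R]_n), K z -> `|v| < r0 -> `|psi (z + v) - psi z| <= Lam * `|v|;
  sd_inv : forall z (w : 'rV[R]_n), K z -> `|w| <= Lam * `|w *m jacobian theta (psi z)| }.

(** The set [K3] is the image of a compact thickening of [K] inside [U]; it contains the supports of
    all kernels of scale below [r0] centred on [K]. *)
Lemma scale_data_exists : exists K3 r0 Lam MJ, scale_data K3 r0 Lam MJ.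
Proof.
have [r1 r10 hr1] := compact_open_thicken cK oU KU.
pose K2 := [set x | exists p v, [/\ K p, `|v| <= r1 / 2 & x = p + v]].
have cK2 : compact K2 := compact_thicken (@compact_balls_rV R n) cK.
have K2U : K2 `<=` U.
  by move=> _ [p [v [Kp vr ->]]]; apply: hr1 => //; lra.
have KK2 : K `<=` K2.
  by move=> p Kp; exists p, 0; rewrite normr0 addr0; split => //; lra.
pose K3 := psi @` K2.
have cK3 : compact K3 by exact: compact_psi.
have K3V : K3 `<=` V by move=> _ [x /K2U Ux <-]; exact: psiV.
have [MJ MJ0 hMJ] := compact_bounded_for cK3 (fun y Ky => jac_factor_continuous (K3V _ Ky)).
have [r2 r20 hr2] := uniform_diff cK oU KU psi1 ltr01.
have cS : forall z, K z ->
    {for z, continuous (fun z => \sum_i \sum_j `|jacobian psi z i j|)}.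
  move=> z Kz; apply: continuous_for_sum => i; apply: continuous_for_sum => j.
  by apply: continuous_for_norm; exact: (jacobian_continuous psi1 (KU Kz)).
have [M M0 hM] := compact_bounded_for cK cS.
have hM' z (v : 'rV[R]_n) : K z -> `|v *m jacobian psi z| <= M * `|v|.
  move=> Kz; apply: (le_trans (norm_mulmx_le _ _)); rewrite mulrC ler_wpM2r//.
  exact: le_trans (ler_norm _) (hM _ Kz).
(* Here [M] bounds the Jacobian of [psi] on [K] and 1 its linearisation error. The sum is thus a
   Lipschitz constant, and it serves in [sd_inv] too, since the Jacobians of [psi] and [theta] are
   inverse to each other. *)
exists K3, (Num.min (r1 / 2) r2), (1 + M), MJ; split => //.
- by move=> z Kz; exists z => //; exact: KK2.
- by rewrite lt_min divr_gt0.
- by rewrite addr_gt0.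
- move=> r z y /andP[r0]; rewrite lt_min => /andP[rr1 _] Kz.
  move=> /(kernel_near r0)[Vy ty]; exists (theta y); last exact: thetaK.
  exists z, (theta y - z); split => //; last by rewrite addrC subrK.
  by lra.
- by move=> y /hMJ; rewrite ger0_norm// jac_factor_ge0.
- move=> z v Kz; rewrite lt_min => /andP[_ /(hr2 _ _ Kz)]; rewrite mul1r => h.
  rewrite mulrDl mul1r -(subrK (v *m jacobian psi z) (psi (z + v) - psi z)).
  by apply: (le_trans (ler_normD _ _)); rewrite lerD// hM'.
- move=> z w Kz; have {1}-> : w = (w *m jacobian theta (psi z)) *m jacobian psi z.
    by rewrite -mulmxA (mulmx1C (jacobian_inverse (KU Kz))) mulmx1.
  apply: (le_trans (hM' _ _ Kz)); rewrite ler_wpM2r// lerDr//.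
Qed.

Section Estimates.
Variables (K3 : set 'rV[R]_n) (r0 Lam MJ : R).
Hypothesis sd : scale_data K3 r0 Lam MJ.

Lemma cc_kernel r z : 0 < r < r0 -> K z -> cc (kernel_fun r z).
Proof.
move=> r0r Kz; apply: (@cc_extend _ _ K3 V); [exact: sd_compact sd|exact: sd_V sd| |].
  move=> y Vy.
  have ck := @kernel_continuous r (z, y) Vy.
  have cp := @continuous_for_pair _ 'rV[R]_n 'rV[R]_n z y.
  exact: (@continuous_for_comp R 'rV[R]_n ('rV[R]_n * 'rV[R]_n)%type R
    (fun p => kernel_fun r p.1 p.2) (fun y => (z, y)) y cp ck).
move=> y nK; apply/eqP; apply: contrapT => /negP h; apply: nK.
exact: (sd_ker sd r0r Kz h).
Qed.

Lemma cc_joint r : 0 < r < r0 ->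
  cc (fun p : 'rV[R]_n * 'rV[R]_n => u p.1 * kernel_fun r p.1 p.2).
Proof.
move=> r0r; apply: (@cc_extend _ _ (K `*` K3) (fun p => V p.2)).
- by apply: compact_setX => //; exact: sd_compact sd.
- by move=> p [_ /(sd_V sd)].
- move=> p Vp; apply: cvgM; last exact: kernel_continuous.
  apply: (@continuous_comp _ _ _ fst u); first exact: cvg_fst.
  by case: cu => cu' _; exact: cu'.
move=> [z y] /= nK; have [Kz|nKz] := pselect (K z); last by rewrite u0// mul0r.
have [->|h] := eqVneq (kernel_fun r z y) 0; first by rewrite mulr0.
by exfalso; apply: nK; split => //; exact: (sd_ker sd r0r Kz h).
Qed.

(** With [y] fixed, the kernel is an exact rescaling of [tent] around [theta y], so the error comes
    only from the oscillation of [u] at distance less than [r]. *)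
Lemma inner_target (e r : R) y : 0 < e -> 0 < r < r0 ->
  (forall x x', `|x - x'| < r -> `|u x - u x'| <= e) ->
  `|vol_int (fun z => u z * kernel_fun r z y) - r ^+ n * c0 * pullback y|
    <= r ^+ n * (e * c0 * MJ).
Proof.
move=> e0 rr hu; have /andP[rp _] := rr; have rn0 : 0 < r ^+ n by rewrite exprn_gt0.
have c0p : 0 < c0 by exact: vol_int_tent_gt0.
have MJ0 := sd_MJ sd.
have rhs0 : 0 <= r ^+ n * (e * c0 * MJ) by rewrite !mulr_ge0// ltW.
have [K3y|nK3y] := pselect (K3 y); last first.
  have p0 : pullback y = 0.
    rewrite /pullback; have [Vy|nVy] := pselect (V y); last by rewrite jac_factor_out// mulr0.
    rewrite u0 ?mul0r// => Kt; apply: nK3y.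
    by rewrite -(thetaK Vy); exact: sd_K sd _ Kt.
  have -> : (fun z => u z * kernel_fun r z y) = (fun=> 0).
    apply/funext => z; have [Kz|nKz] := pselect (K z); last by rewrite u0// mul0r.
    have [->|h] := eqVneq (kernel_fun r z y) 0; first by rewrite mulr0.
    by exfalso; apply: nK3y; exact: (sd_ker sd rr Kz h).
  by rewrite (bf0 (@vol_int_bf R n)) p0 mulr0 subr0 normr0.
pose x := theta y; pose J := jac_factor y.
pose h z := u z * tent (r^-1 *: (x - z)).
have ch : cc h.
  have ri : r^-1 != 0 by rewrite invr_eq0 gt_eqF.
  have -> : h = (fun z => u z * tent (- (r^-1 *: x) + r^-1 *: z)).
    apply/funext => z; rewrite /h -tentN; congr (_ * tent _).
    by rewrite -scalerN opprB scalerBr addrC.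
  by apply: ccMl; [case: cu|exact: (cc_scale (- (r^-1 *: x)) (@cc_tent R n) ri)].
have -> : vol_int (fun z => u z * kernel_fun r z y) = J * vol_int h.
  rewrite -(bfZ (@vol_int_bf R n))//; congr vol_int; apply/funext => z.
  by rewrite /h /kernel_fun -/x -/J; ring.
have r0' : r != 0 by rewrite gt_eqF.
rewrite (vol_int_scale x ch r0') (gtr0_norm rp).
have E w : h (x + r *: w) = u (x + r *: w) * tent w.
  by rewrite /h opprD addrA subrr add0r scalerN scalerA mulVf// scale1r tentN.
have cs : cc (fun w => u (x + r *: w) * tent w).
  by have := cc_scale x ch r0'; under eq_fun do rewrite E.
have ct : cc (fun w => u x * @tent R n w) by apply: ccZ; exact: cc_tent.
have -> : vol_int (fun w => h (x + r *: w)) = vol_int (fun w => u (x + r *: w) * tent w).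
  by congr vol_int; apply/funext => w; rewrite E.
have -> : J * (r ^+ n * vol_int (fun w => u (x + r *: w) * tent w)) -
    r ^+ n * c0 * pullback y =
    r ^+ n * (J * (vol_int (fun w => u (x + r *: w) * tent w) - u x * c0)).
  by rewrite /pullback -/x -/J; ring.
rewrite normrM (gtr0_norm rn0) ler_pM2l// normrM (ger0_norm (jac_factor_ge0 y)) mulrC.
rewrite ler_pM ?jac_factor_ge0//; last exact: sd_bound sd _ K3y.
rewrite -(bfZ (@vol_int_bf R n) _ (@cc_tent R n)).
rewrite -(bfB (@vol_int_bf R n) cs ct) -(bfZ (@vol_int_bf R n) _ (@cc_tent R n)).
apply: vol_int_norm_le; [exact: ccB|by apply: ccZ; exact: cc_tent|].
move=> w; rewrite -mulrBl normrM (ger0_norm (tent_ge0 w)).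
have [w1|w1] := ltP `|w| 1; last by rewrite tent_out// !mulr0.
rewrite ler_wpM2r ?tent_ge0//; apply: hu.
by rewrite addrAC subrr add0r normrZ gtr0_norm// -[ltRHS]mulr1 ltr_pM2l.
Qed.

(** Put [y = psi z + r *: w]. Replacing [theta] by its linear part and the Jacobian factor by its
    value at [psi z] leaves [|det J| * tent (w *m J)], whose integral is [c0] by the linear case. *)
Lemma inner_source (e r C : R) z : 0 < e -> 0 < r < r0 -> K z -> 0 <= C ->
  (forall (f : 'rV[R]_n -> R) B, cc f -> 0 <= B ->
    (forall x, Lam < `|x| -> f x = 0) ->
    (forall x, `|f x| <= B) -> `|vol_int f| <= C * B) ->
  (forall v : 'rV[R]_n, `|v| <= r * Lam ->
    `|theta (psi z + v) - z - v *m jacobian theta (psi z)| <= e * `|v|) ->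
  (forall v : 'rV[R]_n, `|v| <= r * Lam ->
    `|jac_factor (psi z + v) - jac_factor (psi z)| <= e) ->
  `|vol_int (kernel_fun r z) - r ^+ n * c0| <= r ^+ n * (C * (e * (Lam * MJ + 1))).
Proof.
move=> e0 rr Kz C0 hC hd hj; have /andP[rp rlt] := rr.
have rn0 : 0 < r ^+ n by rewrite exprn_gt0.
have r0' : r != 0 by rewrite gt_eqF.
have Lam0 := sd_Lam sd; have MJ0 := sd_MJ sd.
have ck := cc_kernel rr Kz.
have Uz := KU Kz; have Vz := psiV Uz.
pose J := jacobian theta (psi z).
have uJ : J \in unitmx by have := mulmx1_unit (jacobian_inverse Uz) => -[].
have dJ : jac_factor (psi z) = `|\det J| by rewrite jac_factorE.
have dJ0 : `|\det J| != 0 by rewrite normr_eq0 -unitfE -unitmxE.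
have ctJ : cc (fun w : 'rV[R]_n => tent (w *m J)) by apply: cc_mulmx => //; exact: cc_tent.
have c0E : c0 = vol_int (fun w => `|\det J| * tent (w *m J)).
  by rewrite (bfZ (@vol_int_bf R n))// (vol_int_mulmx uJ (@cc_tent R n)) mulVKf.
rewrite (vol_int_scale (psi z) ck r0') (gtr0_norm rp) [X in _ - _ * X]c0E -mulrBr.
rewrite normrM (gtr0_norm rn0).
have cs := cc_scale (psi z) ck r0'.
have ct := ccZ `|\det J| ctJ.
rewrite ler_pM2l// -(bfB (@vol_int_bf R n) cs ct).
(* The linear term vanishes there by [sd_inv], the kernel by [sd_lip]; the domain of integration in
   [w] is therefore independent of [r]. *)
have far w : Lam < `|w| ->
    kernel_fun r z (psi z + r *: w) - `|\det J| * tent (w *m J) = 0.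
  move=> hw; have -> : tent (w *m J) = 0.
    apply: tent_out; have := sd_inv sd w Kz; rewrite -/J => h.
    by rewrite -(ler_pM2l Lam0) mulr1; apply: le_trans h; exact: ltW.
  rewrite mulr0 subr0; apply/eqP; apply: contrapT => /negP /(kernel_near rp)[Vy ty].
  have := sd_lip sd Kz (lt_trans ty rlt).
  rewrite (addrC z) subrK thetaK// addrAC subrr add0r normrZ (gtr0_norm rp).
  apply/negP; rewrite -ltNge; apply: (@lt_trans _ _ (Lam * r)).
    by rewrite ltr_pM2l.
  by rewrite mulrC ltr_pM2l.
apply: hC.
- exact: ccB.
- by rewrite mulr_ge0 ?addr_ge0 ?mulr_ge0// ltW.
- exact: far.
- move=> w; have [wL|wL] := leP `|w| Lam; last first.
    by rewrite far// normr0 mulr_ge0 ?addr_ge0 ?mulr_ge0// ltW.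
  have rw : `|r *: w| <= r * Lam by rewrite normrZ gtr0_norm// ler_pM2l.
  rewrite /kernel_fun; set a := r^-1 *: _; set b := w *m J.
  have ab : `|a - b| <= e * Lam.
    have -> : a - b = r^-1 *: (theta (psi z + r *: w) - z - (r *: w) *m J).
      by rewrite scalerBr -scalemxAl scalerA mulVf// scale1r.
    rewrite normrZ gtr0_norm ?invr_gt0// mulrC ler_pdivrMr//.
    apply: (le_trans (hd _ rw)); rewrite -mulrA ler_pM2l//.
    by rewrite mulrC.
  rewrite -dJ.
  set J1 := jac_factor (psi z + _); set J2 := jac_factor (psi z).
  have -> : tent a * J1 - J2 * tent b = (tent a - tent b) * J2 + tent a * (J1 - J2).
    by ring.
  apply: (le_trans (ler_normD _ _)).
  rewrite [e * _]mulrDr mulr1 lerD//.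
    rewrite normrM mulrA ler_pM//; first exact: le_trans (tent_lipschitz _ _) ab.
    rewrite ger0_norm ?jac_factor_ge0//.
    by apply: sd_bound sd _ _; exact: sd_K sd _ Kz.
  rewrite normrM (ger0_norm (tent_ge0 a)).
  apply: (@le_trans _ _ (1 * `|J1 - J2|)); first by rewrite ler_wpM2r// tent_le1.
  by rewrite mul1r; exact: hj.
Qed.

End Estimates.

(* Mollifying [u] at scale [r] on the source and integrating the resulting
   double integral in both orders. *)
Theorem change_of_variables : vol_int pullback = vol_int u.
Proof.
have [K3 [r0 [Lam [MJ sd]]]] := scale_data_exists.
have hb := @vol_int_bf R n.
have c0p : 0 < c0 by exact: vol_int_tent_gt0.
have [Lam0 MJ0] := (sd_Lam sd, sd_MJ sd).
have [Lu Lu0 hLu] := cc_support cu.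
have [Bu Bu0 hBu] := cc_bounded (@compact_balls_rV R n) cu.
have /compact_bounded[L3 [_ hL3]] := sd_compact sd.
have [L3' hL3'] : exists L : R, forall y, K3 y -> `|y| <= L.
  by exists (`|L3| + 1) => y /(hL3 (`|L3| + 1)); apply; rewrite ltr_pwDr// ler_norm.
have [C3 C30 hC3] := bf_bound hb L3'.
have [Cu Cu0 hCu] := bf_bound hb Lu.
have [CL CL0 hCL] := bf_bound hb Lam.
(* The sum of the errors of the two orders of integration, in units of [r ^+ n * e], plus 1 for
   positivity. *)
pose Q := C3 * (c0 * MJ) + Cu * (Bu * (CL * (Lam * MJ + 1))) + 1.
have Q0 : 0 < Q.
  by rewrite ltr_wpDl// addr_ge0// !mulr_ge0 ?addr_ge0 ?mulr_ge0// ltW.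
suff key e : 0 < e -> c0 * `|vol_int pullback - vol_int u| <= e * Q.
  apply/eqP; rewrite -subr_eq0 -normr_le0; apply/ler_addgt0Pl => e e0; rewrite addr0.
  rewrite -(ler_pM2l c0p); apply: (le_trans (key (c0 * e / Q) _)).
    by rewrite divr_gt0// mulr_gt0.
  by rewrite divfK// gt_eqF.
move=> e0.
have [du du0 hdu] := cc_unif (@compact_balls_rV R n) cu e0.
have cpK := compact_psi cK KU.
have pKV : psi @` K `<=` V by move=> _ [x /KU Ux <-]; exact: psiV.
have [d3 d30 hd3] := uniform_diff cpK oV pKV theta1 e0.
have [d4 d40 hd4] := compact_unif_continuous cpK
  (fun y Ky => jac_factor_continuous (pKV _ Ky)) e0.
have r00 := sd_r0 sd.
(* The displacement [r *: w] with [|w| <= Lam] has norm at most [r * Lam]; below [d3] and [d4], the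
   expansion of [theta] and the continuity of the Jacobian factor apply to it. *)
have [r [rp rr0 rdu rd3 rd4]] :
    exists r : R, [/\ 0 < r, r < r0, r < du, r * Lam < d3 & r * Lam < d4].
  pose d := Num.min (Num.min r0 du) (Num.min (d3 / Lam) (d4 / Lam)).
  have dp : 0 < d by rewrite !lt_min r00 du0 !divr_gt0.
  exists (d / 2); have d2 : d / 2 < d by lra.
  split; first by rewrite divr_gt0.
  - by apply: lt_le_trans d2 _; rewrite !ge_min lexx.
  - by apply: lt_le_trans d2 _; rewrite !ge_min lexx orbT.
  - by rewrite -ltr_pdivlMr//; apply: lt_le_trans d2 _; rewrite !ge_min lexx !orbT.
  - by rewrite -ltr_pdivlMr//; apply: lt_le_trans d2 _; rewrite !ge_min lexx !orbT.
have rr : 0 < r < r0 by rewrite rp.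
have rn0 : 0 < r ^+ n by rewrite exprn_gt0.
have cj := cc_joint sd rr.
have cV := @compact_balls_rV R n.
have swp := vol_int_swap cV hb cj.
have cj' : cc (fun p : 'rV[R]_n * 'rV[R]_n => u p.2 * kernel_fun r p.2 p.1).
  case: cj => cj [M hM]; split.
    apply: (@continuous_compT R _ _ _ _ (@unstable.swap 'rV[R]_n 'rV[R]_n) _ cj).
    exact: swap_continuous.
  by exists M => p; rewrite prod_normE maxC => hp; apply: (hM (p.2, p.1)).
have cy : cc (fun y => vol_int (fun z => u z * kernel_fun r z y)).
  exact: (cc_param cV cV hb cj').
have cz : cc (fun z => vol_int (fun y => u z * kernel_fun r z y)).
  exact: (cc_param cV cV hb cj).
pose A := vol_int (fun z => vol_int (fun y => u z * kernel_fun r z y)).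
have swpA : A = vol_int (fun y => vol_int (fun z => u z * kernel_fun r z y)) := swp.
have AE : A = vol_int (fun z => vol_int (fun y => u z * kernel_fun r z y)) := erefl A.
clearbody A; clear swp.
have estT : `|A - r ^+ n * c0 * vol_int pullback| <= r ^+ n * (e * (C3 * (c0 * MJ))).
  have -> : A - r ^+ n * c0 * vol_int pullback = vol_int (fun y =>
      vol_int (fun z => u z * kernel_fun r z y) - r ^+ n * c0 * pullback y).
    apply/esym; apply: etrans (bfB hb cy (ccZ (r ^+ n * c0) cc_pullback)) _.
    apply: etrans (congr1 (fun x => _ - x) (bfZ hb (r ^+ n * c0) cc_pullback)) _.
    exact: (congr1 (fun x => x - _) (esym swpA)).
  clear swpA AE.
  have -> : r ^+ n * (e * (C3 * (c0 * MJ))) = C3 * (r ^+ n * (e * c0 * MJ)) by ring.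
  have hI y := @inner_target K3 r0 Lam MJ sd e r y e0 rr
    (fun x x' xx' => hdu x x' (lt_trans xx' rdu)).
  apply: hC3; last exact: hI.
  - exact: (ccB cy (ccZ (r ^+ n * c0) cc_pullback)).
  - exact: (mulr_ge0 (ltW rn0) (mulr_ge0 (mulr_ge0 (ltW e0) (ltW c0p)) (ltW MJ0))).
  move=> y hy; have nK3 : ~ K3 y by move=> /hL3'; rewrite leNgt hy.
  rewrite /pullback; have -> : u (theta y) * jac_factor y = 0.
    have [Vy|nVy] := pselect (V y); last by rewrite jac_factor_out// mulr0.
    rewrite u0 ?mul0r// => Kt; apply: nK3.
    by rewrite -(thetaK Vy); exact: sd_K sd _ Kt.
  rewrite mulr0 subr0; have -> : (fun z => u z * kernel_fun r z y) = (fun=> 0).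
    apply/funext => z; have [Kz|nKz] := pselect (K z); last by rewrite u0// mul0r.
    have [->|h] := eqVneq (kernel_fun r z y) 0; first by rewrite mulr0.
    by exfalso; apply: nK3; exact: (sd_ker sd rr Kz h).
  exact: bf0.
have LM0 : 0 <= Lam * MJ + 1 := addr_ge0 (mulr_ge0 (ltW Lam0) (ltW MJ0)) ler01.
have rhs0 : 0 <= r ^+ n * (Bu * (CL * (e * (Lam * MJ + 1)))) :=
  mulr_ge0 (ltW rn0) (mulr_ge0 (ltW Bu0) (mulr_ge0 CL0 (mulr_ge0 (ltW e0) LM0))).
have estS : `|A - r ^+ n * c0 * vol_int u| <=
    r ^+ n * (e * (Cu * (Bu * (CL * (Lam * MJ + 1))))).
  have -> : A - r ^+ n * c0 * vol_int u = vol_int (fun z =>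
      vol_int (fun y => u z * kernel_fun r z y) - r ^+ n * c0 * u z).
    apply/esym; apply: etrans (bfB hb cz (ccZ (r ^+ n * c0) cu)) _.
    apply: etrans (congr1 (fun x => _ - x) (bfZ hb (r ^+ n * c0) cu)) _.
    exact: (congr1 (fun x => x - _) (esym AE)).
  clear swpA AE estT.
  have -> : r ^+ n * (e * (Cu * (Bu * (CL * (Lam * MJ + 1))))) =
    Cu * (r ^+ n * (Bu * (CL * (e * (Lam * MJ + 1))))) by ring.
  apply: hCu.
  - exact: (ccB cz (ccZ (r ^+ n * c0) cu)).
  - exact: rhs0.
  - move=> z hz; rewrite hLu// mulr0 subr0.
    have -> : (fun y => 0 * kernel_fun r z y) = (fun=> 0).
      by apply/funext => y; rewrite mul0r.
    exact: bf0.
  move=> z; have [Kz|nKz] := pselect (K z); last first.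
    rewrite u0// mulr0 subr0.
    have -> : (fun y => 0 * kernel_fun r z y) = (fun=> 0).
      by apply/funext => y; rewrite mul0r.
    by rewrite (bf0 hb) normr0; exact: rhs0.
  rewrite (bfZ hb); last exact: (cc_kernel sd rr Kz).
  rewrite (mulrC _ (u z)) -mulrBr normrM mulrCA ler_pM//.
  apply: (inner_source sd e0 rr Kz CL0) => //.
  - move=> v hv; have vd : `|v| < d3 by exact: le_lt_trans rd3.
    by have := hd3 (psi z) v (ex_intro2 _ _ z Kz erefl) vd; rewrite psiK//; exact: KU.
  - move=> v hv; apply: hd4; first by exists z.
    exact: le_lt_trans rd4.
clear swpA AE.
rewrite -(ler_pM2l rn0).
have -> : r ^+ n * (c0 * `|vol_int pullback - vol_int u|) =
    `|(A - r ^+ n * c0 * vol_int u) - (A - r ^+ n * c0 * vol_int pullback)|.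
  rewrite -[in LHS](gtr0_norm rn0) -[in LHS](gtr0_norm c0p) -!normrM.
  by congr `|_|; ring.
apply: (le_trans (ler_normB _ _)); apply: (le_trans (lerD estS estT)).
rewrite /Q -mulrDr ler_pM2l//.
by rewrite -mulrDr ler_pM2l//; lra.
Qed.

End ChangeOfVariables.

(** * Calculus of C^1 functions *)

Section FirstOrderCalculus.
Variables (R : realType) (V : normedModType R).
Implicit Types (f g : V -> R) (W : set V).

Lemma C1_differentiable (U : normedModType R) (g : V -> U) W x :
  Ck_on 1 g W -> W x -> differentiable g x.
Proof. by move=> [dg _]; exact: dg. Qed.

Lemma C1_continuous f W x : Ck_on 1 f W -> W x -> {for x, continuous f}.
Proof. by move=> /C1_differentiable h /h; exact: differentiable_continuous. Qed.

Lemma C1_diff_continuous (U : normedModType R) (g : V -> U) W v x :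
  Ck_on 1 g W -> W x -> {for x, continuous (fun y => 'd g y v)}.
Proof. by move=> [_ cg]; exact: cg. Qed.
Arguments C1_diff_continuous [U g W] v [x].

(** The formula [k] for the differential is valid on [W] only; as [W] is open, its continuity passes
    to the total function ['d f]. *)
Lemma C1_intro f W (k : V -> V -> R) : open W ->
  (forall x, W x -> differentiable f x) ->
  (forall x v, W x -> 'd f x v = k v x) ->
  (forall v x, W x -> {for x, continuous (k v)}) -> Ck_on 1 f W.
Proof.
move=> oW df dk ck; split => // v x Wx.
by apply: (continuous_for_open_eq oW Wx _ (ck v x Wx)) => y Wy; rewrite dk.
Qed.

Lemma near_eq_diffE (f g : V -> R) W x v : open W -> W x -> (forall y, W y -> f y = g y) ->
  differentiable f x -> 'd g x v = 'd f x v.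
Proof.
move=> oW Wx fg df.
have nW : \forall y \near x, f y = g y.
  by have : \forall y \near x, W y by [exact: open_nbhs_nbhs]; apply: filterS.
by have [_ E] := near_eq_diff nW df; exact: (congr1 (@^~ v) E).
Qed.

Lemma C1_eq (f g : V -> R) W : open W -> (forall y, W y -> f y = g y) ->
  Ck_on 1 f W -> Ck_on 1 g W.
Proof.
move=> oW fg c1; apply: (C1_intro (k := fun v x => 'd f x v) oW).
- move=> x Wx; have df := C1_differentiable c1 Wx.
  have nW : \forall y \near x, f y = g y.
    by have : \forall y \near x, W y by [exact: open_nbhs_nbhs]; apply: filterS.
  by have [] := near_eq_diff nW df.
- by move=> x v Wx; apply: (near_eq_diffE _ oW Wx fg); exact: (C1_differentiable c1 Wx).
- by move=> v x Wx; exact: C1_diff_continuous c1 Wx.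
Qed.

Lemma diff_cstE (c : R) x v : 'd (fun _ : V => c) x v = 0.
Proof. exact: (congr1 (@^~ v) (@diff_cst R V R c x)). Qed.

Lemma C1_cst (c : R) W : open W -> Ck_on 1 (fun _ : V => c) W.
Proof.
move=> oW; apply: (C1_intro (k := fun _ _ => 0) oW).
- by move=> x _; exact: differentiable_cst.
- by move=> x v _; exact: diff_cstE.
- by move=> v x _; exact: cvg_cst.
Qed.

Lemma diffDE f g x v : differentiable f x -> differentiable g x ->
  'd (fun y => f y + g y) x v = 'd f x v + 'd g x v.
Proof. by move=> df dg; exact: (congr1 (@^~ v) (diffD df dg)). Qed.

Lemma C1D f g W : open W -> Ck_on 1 f W -> Ck_on 1 g W ->
  Ck_on 1 (fun y => f y + g y) W.
Proof.
move=> oW cf cg; apply: (C1_intro (k := fun v x => 'd f x v + 'd g x v) oW).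
- move=> x Wx.
  exact: (differentiableD (C1_differentiable cf Wx) (C1_differentiable cg Wx)).
- move=> x v Wx.
  exact: (diffDE v (C1_differentiable cf Wx) (C1_differentiable cg Wx)).
- move=> v x Wx; 
  exact (continuous_forD (C1_diff_continuous v cf Wx) (C1_diff_continuous v cg Wx)).
Qed.

Lemma diffBE f g x v : differentiable f x -> differentiable g x ->
  'd (fun y => f y - g y) x v = 'd f x v - 'd g x v.
Proof. by move=> df dg; exact: (congr1 (@^~ v) (diffB df dg)). Qed.

Lemma C1B f g W : open W -> Ck_on 1 f W -> Ck_on 1 g W ->
  Ck_on 1 (fun y => f y - g y) W.
Proof.
move=> oW cf cg; apply: (C1_intro (k := fun v x => 'd f x v - 'd g x v) oW).
- move=> x Wx.
  exact: (differentiableB (C1_differentiable cf Wx) (C1_differentiable cg Wx)).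
- move=> x v Wx.
  exact: (diffBE v (C1_differentiable cf Wx) (C1_differentiable cg Wx)).
- move=> v x Wx.
  exact (continuous_forD (C1_diff_continuous v cf Wx)
    (continuous_forN (C1_diff_continuous v cg Wx))).
Qed.

Lemma diffME f g x v : differentiable f x -> differentiable g x ->
  'd (fun y => f y * g y) x v = f x * 'd g x v + g x * 'd f x v.
Proof. by move=> df dg; exact: (congr1 (@^~ v) (diffM df dg)). Qed.

Lemma C1M f g W : open W -> Ck_on 1 f W -> Ck_on 1 g W ->
  Ck_on 1 (fun y => f y * g y) W.
Proof.
move=> oW cf cg.
apply: (C1_intro (k := fun v x => f x * 'd g x v + g x * 'd f x v) oW).
- move=> x Wx.
  exact: (differentiableM (C1_differentiable cf Wx) (C1_differentiable cg Wx)).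
- move=> x v Wx.
  exact: (diffME v (C1_differentiable cf Wx) (C1_differentiable cg Wx)).
- move=> v x Wx; exact (continuous_forD
    (continuous_forM (C1_continuous cf Wx) (C1_diff_continuous v cg Wx))
    (continuous_forM (C1_continuous cg Wx) (C1_diff_continuous v cf Wx))).
Qed.

Lemma diff_sumE (I : Type) (s : seq I) (F : I -> V -> R) x v :
  (forall i, differentiable (F i) x) ->
  differentiable (fun y => \sum_(i <- s) F i y) x /\
  'd (fun y => \sum_(i <- s) F i y) x v = \sum_(i <- s) 'd (F i) x v.
Proof.
move=> dF; elim: s => [|i s [dI IH]].
  have -> : (fun y => \sum_(i <- [::]) F i y) = (fun _ : V => 0).
    by apply/funext => y; rewrite big_nil.
  by rewrite big_nil diff_cstE; split => //; exact: differentiable_cst.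
have -> : (fun y => \sum_(i <- i :: s) F i y) =
    (fun y => F i y + \sum_(i <- s) F i y).
  by apply/funext => y; rewrite big_cons.
split; first exact: differentiableD.
by rewrite big_cons -IH (diffDE v (dF i) dI).
Qed.

Lemma C1_sum (I : Type) (s : seq I) (F : I -> V -> R) W : open W ->
  (forall i, Ck_on 1 (F i) W) -> Ck_on 1 (fun y => \sum_(i <- s) F i y) W.
Proof.
move=> oW cF; elim: s => [|i s IH].
  by apply: C1_eq (C1_cst 0 oW) => // y _; rewrite big_nil.
by apply: C1_eq (C1D oW (cF i) IH) => // y _; rewrite big_cons.
Qed.

Lemma C1_prod (I : Type) (s : seq I) (F : I -> V -> R) W : open W ->
  (forall i, Ck_on 1 (F i) W) -> Ck_on 1 (fun y => \prod_(i <- s) F i y) W.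
Proof.
move=> oW cF; elim: s => [|i s IH].
  by apply: C1_eq (C1_cst 1 oW) => // y _; rewrite big_nil.
by apply: C1_eq (C1M oW (cF i) IH) => // y _; rewrite big_cons.
Qed.

Lemma C1_det n (A : V -> 'M[R]_n) W : open W ->
  (forall i j, Ck_on 1 (fun y => A y i j) W) -> Ck_on 1 (fun y => \det (A y)) W.
Proof.
move=> oW cA; rewrite /determinant; apply: C1_sum => // s.
by apply: C1M => //; [exact: C1_cst|apply: C1_prod].
Qed.

Lemma continuous_forV f x : f x != 0 -> {for x, continuous f} ->
  {for x, continuous (fun y => (f y)^-1 : R)}.
Proof. by move=> fx cf; apply: cvgV. Qed.

Lemma diffVE f x v : f x != 0 -> differentiable f x ->
  'd (fun y => (f y)^-1) x v = - (f x) ^- 2 * 'd f x v.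
Proof. by move=> fx df; exact: (congr1 (@^~ v) (diffV df fx)). Qed.

Lemma C1V f W : open W -> (forall x, W x -> f x != 0) -> Ck_on 1 f W ->
  Ck_on 1 (fun y => (f y)^-1) W.
Proof.
move=> oW f0 cf.
apply: (C1_intro (k := fun v x => - ((f x)^-1 * (f x)^-1) * 'd f x v) oW).
- by move=> x Wx; exact: (differentiableV (C1_differentiable cf Wx) (f0 _ Wx)).
- move=> x v Wx; rewrite (diffVE v (f0 _ Wx) (C1_differentiable cf Wx)).
  by rewrite expr2 invfM.
- move=> v x Wx; have h := continuous_forV (f0 _ Wx) (C1_continuous cf Wx).
  exact (continuous_forM (continuous_forN (continuous_forM h h))
    (C1_diff_continuous v cf Wx)).
Qed.

(** As the indices are distinct, the test [j == i] replaces exactly one factor by its derivative. *)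
Lemma diff_prodE n (F : 'I_n -> V -> R) x v (s : seq 'I_n) : uniq s ->
  (forall i, differentiable (F i) x) ->
  differentiable (fun y => \prod_(i <- s) F i y) x /\
  'd (fun y => \prod_(i <- s) F i y) x v =
    \sum_(i <- s) \prod_(j <- s) (if j == i then 'd (F i) x v else F j x).
Proof.
move=> us dF; elim: s us => [_|a s IH /= /andP[nas us]].
  have -> : (fun y => \prod_(i <- [::]) F i y) = (fun _ : V => 1).
    by apply/funext => y; rewrite big_nil.
  by rewrite big_nil diff_cstE; split => //; exact: differentiable_cst.
have {IH}[dI IH] := IH us.
have -> : (fun y => \prod_(i <- a :: s) F i y) =
    (fun y => F a y * \prod_(i <- s) F i y).
  by apply/funext => y; rewrite big_cons.
split; first exact: differentiableM.
apply: etrans (diffME v (dF a) dI) _.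
rewrite IH.
rewrite !big_cons.
rewrite eqxx addrC.
congr (_ + _).
  rewrite mulrC; congr (_ * _); rewrite !big_seq; apply: eq_bigr => j js.
  by case: eqVneq => // ja; rewrite -ja js in nas.
rewrite mulr_sumr !big_seq; apply: eq_bigr => i iis; rewrite big_cons.
by case: eqVneq => // ai; rewrite ai iis in nas.
Qed.

(** Jacobi's formula: the Leibniz rule differentiates one row at a time, giving the matrices [B i],
    whose determinants are expanded along the differentiated row. *)
Lemma diff_detE n (A : V -> 'M[R]_n) x v :
  (forall i j, differentiable (fun y => A y i j) x) ->
  'd (fun y => \det (A y)) x v =
  \sum_i \sum_j 'd (fun y => A y i j) x v * cofactor (A x) i j.
Proof.
move=> dA; rewrite /determinant.
pose P (s : {perm 'I_n}) (y : V) := \prod_i A y i (s i).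
have hP (s : {perm 'I_n}) := @diff_prodE n (fun i y => A y i (s i)) x v (index_enum 'I_n)
  (index_enum_uniq _) (fun i => dA i (s i)).
have dP (s : {perm 'I_n}) : differentiable (fun y => (-1) ^+ s * P s y) x.
  by apply: differentiableM; [exact: differentiable_cst|case: (hP s)].
have [_ ->] := @diff_sumE _ (index_enum {perm 'I_n}) (fun s y => (-1) ^+ s * P s y) x v dP.
pose B i : 'M[R]_n := \matrix_(j, k) if j == i then 'd (fun y => A y i k) x v else A x j k.
transitivity (\sum_i \det (B i)).
  rewrite /determinant exchange_big/=; apply: eq_bigr => s _.
  have [dPs _] := hP s.
  rewrite (diffME v (differentiable_cst ((-1) ^+ s : R) x) dPs).
  rewrite diff_cstE mulr0 addr0 -mulr_sumr; congr (_ * _).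
  have [_ ->] := hP s; apply: eq_bigr => i _; apply: eq_bigr => j _.
  by rewrite mxE; case: eqVneq => // ->.
apply: eq_bigr => i _; rewrite (expand_det_row _ i); apply: eq_bigr => j _.
rewrite mxE eqxx; congr (_ * _); rewrite /cofactor; congr (_ * \det _).
by apply/matrixP => k l; rewrite !mxE eq_sym (negbTE (neq_lift _ _)).
Qed.

End FirstOrderCalculus.

Arguments C1_diff_continuous [R V U g W] v [x].

(** * Square roots, and the symmetry of second derivatives *)

Section SquareRoot.
Variables (R : realType) (V : normedModType R).

Lemma diff_estimate (f : V -> R) x (e : R) : differentiable f x -> 0 < e ->
  exists2 d : R, 0 < d & forall h, `|h| < d -> `|f (x + h) - f x - 'd f x h| <= e * `|h|.
Proof.
move=> df e0; have [_ dfE] := (diff_locallyP x f).1 df.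
have /eqaddoP/(_ e e0) /nbhs_ballP[d /= d0 hd] := dfE.
exists d => // h hh; have /= := hd h; rewrite -ball_normE/= sub0r normrN => /(_ hh).
rewrite -[X in `|X|]/(f (h + x) - (f x + 'd f x h)).
by rewrite opprD addrA (addrC x).
Qed.

Lemma diff_sqrtE (D : V -> R) x v : 0 < D x -> differentiable D x ->
  differentiable (fun y => Num.sqrt (D y)) x /\
  'd (fun y => Num.sqrt (D y)) x v = (2 * Num.sqrt (D x))^-1 * 'd D x v.
Proof.
move=> D0 dD; have h := is_derive1_sqrt D0.
have ds : differentiable (Num.sqrt : R -> R) (D x) by apply/derivable1_diffP; case: h.
split; first exact: (differentiable_comp dD ds).
have E := congr1 (@^~ v) (diff_comp dD ds).
apply: etrans E _ => /=; rewrite (@diff1E _ _ _ _ ds) derive1E.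
have -> : 'D_1 (Num.sqrt : R -> R) (D x) = (2 * Num.sqrt (D x))^-1 by case: h.
exact: mulrC.
Qed.

(** Near [x] the sign [s] of [D] is constant, so the absolute value is [s * D] there; since
    [s * s = 1], the sign disappears from the derivative once it is written with [D x] in the
    denominator. *)
Lemma C1_sqrt_norm (D : V -> R) W : open W -> (forall x, W x -> D x != 0) ->
  Ck_on 1 D W ->
  Ck_on 1 (fun y => Num.sqrt `|D y|) W /\
  forall x v, W x -> 'd (fun y => Num.sqrt `|D y|) x v =
    Num.sqrt `|D x| * (2 * D x)^-1 * 'd D x v.
Proof.
move=> oW D0 c1.
have cD x : W x -> {for x, continuous D} by move=> Wx; exact: (C1_continuous c1 Wx).
have loc x : W x -> differentiable (fun y => Num.sqrt `|D y|) x /\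
    forall v, 'd (fun y => Num.sqrt `|D y|) x v =
      Num.sqrt `|D x| * (2 * D x)^-1 * 'd D x v.
  move=> Wx; pose s : R := Num.sg (D x).
  have s2 : s * s = 1 by rewrite -expr2 sqr_sg D0.
  have sDx : `|D x| = s * D x by rewrite /s normrEsg.
  have sD0 : 0 < s * D x by rewrite -sDx normr_gt0 D0.
  have dD := C1_differentiable c1 Wx.
  have dsD : differentiable (fun y => s * D y) x.
    by apply: differentiableM => //; exact: differentiable_cst.
  have nE : \forall y \near x, Num.sqrt (s * D y) = Num.sqrt `|D y|.
    have cs : {for x, continuous (fun y => s * D y)}.
      by apply: continuous_forM; [exact: cvg_cst|exact: cD].
    have /cvgrPdist_lt/(_ _ sD0) := cs.
    apply: filterS => y; rewrite ltr_norml => /andP[_ h]; congr (Num.sqrt _).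
    have sy : 0 < s * D y by lra.
    have s1 : `|s| = 1 by rewrite /s normr_sg D0.
    by rewrite -[RHS]mul1r -s1 -normrM gtr0_norm.
  have [d1 _] := diff_sqrtE 0 sD0 dsD.
  have [d2 E] := near_eq_diff nE d1.
  split => // v.
  apply: etrans (congr1 (@^~ v) E) _.
  apply: etrans (proj2 (diff_sqrtE v sD0 dsD)) _.
  have dsE : 'd (fun y => s * D y) x v = s * 'd D x v.
    apply: etrans (diffME v (differentiable_cst s x) dD) _.
    by rewrite diff_cstE mulr0 addr0.
  apply: etrans (congr1 (fun z => _ * z) dsE) _; rewrite sDx mulrA.
  have q0 : Num.sqrt (s * D x) != 0 by rewrite gt_eqF// sqrtr_gt0.
  have q2 : Num.sqrt (s * D x) ^+ 2 = s * D x by rewrite sqr_sqrtr// ltW.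
  congr (_ * _); move: (Num.sqrt (s * D x)) q0 q2 => q q0 q2.
  have s0 : s != 0 by apply/eqP => z; move: s2; rewrite z mul0r => /eqP; rewrite eq_sym oner_eq0.
  have si : s^-1 = s by apply: (mulIf s0); rewrite s2 mulVf.
  have -> : D x = s * q ^+ 2 by rewrite q2 mulrA s2 mul1r.
  clearbody s; rewrite -{1}si; field.
  by rewrite q0 s0.
split; last by move=> x v Wx; exact: (proj2 (loc x Wx) v).
apply: (C1_intro (k := fun v x => Num.sqrt `|D x| * (2 * D x)^-1 * 'd D x v) oW).
- by move=> x /loc[].
- by move=> x v Wx; exact: (proj2 (loc x Wx) v).
- move=> v x Wx.
  have c2 : {for x, continuous (fun y => 2 * D y)}.
    by apply: continuous_forM; [exact: cvg_cst|exact: cD].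
  have D2 : 2 * D x != 0 by rewrite mulf_neq0// D0.
  have ci := @continuous_forV _ _ (fun y => 2 * D y) x D2 c2.
  have cs : {for x, continuous (fun y => Num.sqrt `|D y|)}.
    by have [ds _] := loc x Wx; exact: differentiable_continuous.
  exact (continuous_forM (continuous_forM cs ci) (C1_diff_continuous v c1 Wx)).
Qed.

(** The mean value theorem in direction [v], applied to the increment [k], leaves a difference of
    two values of ['d g _ v], each expanded to first order at [x]. *)
Lemma mixed_differences (g : V -> R) (W : set V) x v w (e : R) : open W -> W x -> 0 < e ->
  Ck_on 2 g W -> exists2 d : R, 0 < d & forall t, 0 < t < d ->
  `|t ^- 2 * (g (x + t *: v + t *: w) - g (x + t *: v) - (g (x + t *: w) - g x)) -
    'd (fun y => 'd g y v) x w| <= e.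
Proof.
move=> oW Wx e0 [dg cg]; have [dgv _] := cg v.
have N0 : 0 < 2 * `|v| + `|w| + 1 by rewrite ltr_wpDl// addr_ge0// mulr_ge0.
(* The two expansions are taken at the increments [c *: v + t *: w] and [c *: v], of total norm at
   most [t] times [2 * |v| + |w|]. *)
pose e' := e / (2 * `|v| + `|w| + 1).
have e'0 : 0 < e' by rewrite divr_gt0.
have [d1 d10 hd1] := diff_estimate (dgv x Wx) e'0.
have [d2 d20 hd2] : exists2 d2 : R, 0 < d2 & forall y, `|x - y| < d2 -> W y.
  have /nbhs_ballP[d2 /= d20 h] := open_nbhs_nbhs (conj oW Wx).
  by exists d2 => // y hy; apply: h; rewrite -ball_normE.
pose d := Num.min d1 d2.
have dp : 0 < d by rewrite lt_min d10.
have M0 : 0 < `|v| + `|w| + 1 by rewrite ltr_wpDl// addr_ge0.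
exists (d / (`|v| + `|w| + 1)); first by rewrite divr_gt0.
move=> t /andP[t0]; rewrite ltr_pdivlMr// => td.
have small c : 0 <= c <= t -> `|c *: v| + `|t *: w| < d.
  move=> /andP[c0 ct]; rewrite !normrZ !ger0_norm// ?(ltW t0)//.
  have : c * `|v| <= t * `|v| by rewrite ler_wpM2r.
  have := normr_ge0 v; have := normr_ge0 w; nra.
pose L h := 'd (fun y => 'd g y v) x h.
pose k y := g (y + t *: w) - g y.
have Wc c : 0 <= c <= t -> W (x + c *: v) /\ W (x + c *: v + t *: w).
  move=> /small; rewrite lt_min => /andP[_ h]; split; apply: hd2.
    rewrite opprD addrA subrr add0r normrN; apply: le_lt_trans h.
    by rewrite lerDl.
  rewrite -addrA opprD addrA subrr add0r normrN; apply: le_lt_trans h.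
  exact: ler_normD.
have dk c : 0 <= c <= t ->
    is_derive (x + c *: v) v k ('d g (x + c *: v + t *: w) v - 'd g (x + c *: v) v).
  move=> /Wc[W1 W2].
  have h1 : is_derive (x + c *: v) v (fun y => g (y + t *: w)) ('d g (x + c *: v + t *: w) v).
    have := @is_diff_comp R _ _ _ (fun y => y + t *: w) id g
      ('d g (x + c *: v + t *: w)) (x + c *: v) _ (differentiableP (dg _ W2)).
    have hs : is_diff (x + c *: v) (fun y : V => y + t *: w) id.
      have := is_diffD (is_diff_id (x + c *: v)) (is_diff_cst (t *: w) (x + c *: v)).
      by move=> h; apply: is_diff_eq h _; apply/funext => z; rewrite /= fctE addr0.
    move=> /(_ hs) [d3 E3]; split; first exact: diff_derivable.
    by rewrite deriveE// E3.
  have h2 : is_derive (x + c *: v) v g ('d g (x + c *: v) v).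
    by split; [exact: diff_derivable (dg _ W1)|rewrite deriveE//; exact: dg].
  exact: is_deriveB.
have dk' s : 0 <= s <= t -> derivable k (x + s *: v) v by move=> /dk[].
have [c /andP[c0 ct] E] := mvt_line t0 dk'.
have cct : 0 <= c <= t by rewrite !ltW.
have Ek : g (x + t *: v + t *: w) - g (x + t *: v) - (g (x + t *: w) - g x) =
    t * ('d g (x + c *: v + t *: w) v - 'd g (x + c *: v) v).
  by have [_ <-] := dk c cct.
have /small := cct; rewrite lt_min => /andP[sm _].
have b1 : `|c *: v + t *: w| < d1 by apply: le_lt_trans (ler_normD _ _) _.
have b2 : `|c *: v| < d1 by apply: le_lt_trans sm; rewrite lerDl.
have lv : 'd (fun y => 'd g y v) x (c *: v) = c * L v by rewrite linearZ.
have lw : 'd (fun y => 'd g y v) x (t *: w) = t * L w by rewrite linearZ.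
have lvw : 'd (fun y => 'd g y v) x (c *: v + t *: w) = c * L v + t * L w.
  by rewrite linearD lv lw.
have := hd1 _ b1; rewrite lvw addrA => h1.
have := hd1 _ b2; rewrite lv => h2.
rewrite Ek -/(L w); move: h1 h2.
move: ('d g (x + c *: v + t *: w) v) ('d g (x + c *: v) v) ('d g x v) (L v) (L w).
move=> A B G lV lW h1 h2.
have -> : t ^- 2 * (t * (A - B)) - lW = t^-1 * ((A - B) - t * lW).
  by field; rewrite gt_eqF.
rewrite normrM gtr0_norm ?invr_gt0// ler_pdivrMl//.
have -> : A - B - t * lW = (A - G - (c * lV + t * lW)) - (B - G - c * lV) by ring.
apply: (le_trans (ler_normB _ _)); apply: (le_trans (lerD h1 h2)).
have hn : `|c *: v + t *: w| + `|c *: v| <= t * (2 * `|v| + `|w|).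
  apply: (@le_trans _ _ ((`|c *: v| + `|t *: w|) + `|c *: v|)).
    by rewrite lerD2r ler_normD.
  rewrite !normrZ !gtr0_norm//.
  have : c * `|v| <= t * `|v| by rewrite ler_wpM2r// ltW.
  by lra.
rewrite -mulrDr; apply: (@le_trans _ _ (e' * (t * (2 * `|v| + `|w|)))).
  by rewrite ler_pM2l.
have -> : e = e' * (2 * `|v| + `|w| + 1) by rewrite divfK// gt_eqF.
rewrite mulrCA ler_pM2l// ler_pM2l// lerDl//.
Qed.

(** Schwarz's theorem: the second difference is symmetric in [v] and [w], and it approximates both
    sides. *)
Lemma diff_comm (g : V -> R) (W : set V) x v w : open W -> W x -> Ck_on 2 g W ->
  'd (fun y => 'd g y v) x w = 'd (fun y => 'd g y w) x v.
Proof.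
move=> oW Wx c2; apply/eqP; rewrite -subr_eq0 -normr_le0.
apply/ler_addgt0Pl => e e0; rewrite addr0.
have e2 : 0 < e / 2 by rewrite divr_gt0.
have [d1 d10 h1] := mixed_differences v w oW Wx e2 c2.
have [d2 d20 h2] := mixed_differences w v oW Wx e2 c2.
pose t := Num.min d1 d2 / 2.
have dp : 0 < Num.min d1 d2 by rewrite lt_min d10.
have tp : 0 < t by rewrite divr_gt0.
have tl : t < Num.min d1 d2 by rewrite /t; lra.
move: (tl); rewrite lt_min => /andP[t1 t2].
have := h1 t; have := h2 t; rewrite tp t1 t2 => /(_ isT) + /(_ isT).
rewrite (addrAC x (t *: w)).
set A := g _; set B := g _; set C := g _; set D := g x.
have -> : A - B - (C - D) = A - C - (B - D) by ring.
set X := _ * _ => hw hv; rewrite (splitr e).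
apply: (le_trans (ler_distD X _ _)); rewrite lerD//.
by rewrite distrC.
Qed.

End SquareRoot.

(** * The Liouville field *)

Section LiouvilleAlgebra.
Variables (R : realType) (n : nat).
Implicit Types (M W : 'M[R]_n) (T : 'I_n -> 'M[R]_n).

(* [M] is the inverse of a 2-form [W] and [T a c d] stands for the derivative of
   [W c d] along the [a]-th coordinate: the cyclic hypothesis says that [W] is
   closed. *)
Lemma closed_contraction M T b : (forall i j, M i j = - M j i) ->
  (forall a c d, T a c d = - T a d c) ->
  (forall a c d, T a c d + T c d a + T d a c = 0) ->
  \sum_a \sum_c \sum_d T a c d * M d c * M a b =
  2 * \sum_a \sum_c \sum_d M a c * T a c d * M d b.
Proof.
move=> aM aT cyc.
(* Renaming indices brings all sums to the common shape [M a c * _ * M d b], so that the cyclic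
   identity can be used term by term. *)
have S2 : \sum_a \sum_c \sum_d M a c * T a c d * M d b =
    - \sum_a \sum_c \sum_d M a c * T c a d * M d b.
  rewrite exchange_big/= -sumrN; apply: eq_bigr => a _.
  rewrite -sumrN; apply: eq_bigr => c _; rewrite -sumrN; apply: eq_bigr => d _.
  by rewrite (aM c a) !mulNr.
have S1 : \sum_a \sum_c \sum_d T a c d * M d c * M a b =
    - \sum_a \sum_c \sum_d M a c * T d a c * M d b.
  rewrite [RHS](_ : _ = - \sum_d \sum_a \sum_c M a c * T d a c * M d b); last first.
    congr (- _); rewrite [RHS]exchange_big/=; apply: eq_bigr => a _.
    by rewrite exchange_big.
  rewrite -sumrN; apply: eq_bigr => d _; rewrite -sumrN; apply: eq_bigr => a _.
  rewrite -sumrN; apply: eq_bigr => c _.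
  by rewrite (aM c a); ring.
rewrite mulr2n mulrDl mul1r {1}S2 S1 -!sumrN -big_split/=; apply: eq_bigr => a _.
rewrite -!sumrN -big_split/=; apply: eq_bigr => c _.
rewrite -!sumrN -big_split/=; apply: eq_bigr => d _.
have E : T d a c = - T a c d + T c a d by rewrite (aT c a d); have := cyc a c d; lra.
by rewrite E; ring.
Qed.

(** By antisymmetry of [M], twice the sum is the contraction of [M] with [W], that is, minus the
    trace of [M *m W]. The factor [n / 2] originates here. *)
Lemma exact_contraction M W (L : 'M[R]_n) : M *m W = 1%:M ->
  (forall i j, M i j = - M j i) -> (forall i j, L i j - L j i = W i j) ->
  \sum_a \sum_b M a b * L a b = - (n%:R / 2).
Proof.
move=> MW aM LW; set S := \sum_a _.
have S' : S = - \sum_a \sum_b M a b * L b a.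
  rewrite /S exchange_big/= -sumrN; apply: eq_bigr => a _.
  by rewrite -sumrN; apply: eq_bigr => b _; rewrite (aM b a) mulNr.
have : S + S = - n%:R.
  rewrite {1}S' /S addrC -sumrB -(@mxtrace1 R n) -MW /mxtrace -sumrN.
  apply: eq_bigr => a _; rewrite mxE -sumrB -sumrN; apply: eq_bigr => b _.
  have -> : W b a = - W a b by rewrite -!LW opprB.
  by rewrite -LW; ring.
lra.
Qed.

(** The matrix [- M^T] is an inverse of [W] as well. *)
Lemma inverse_antisym M W : M *m W = 1%:M -> (forall i j, W i j = - W j i) ->
  forall i j, M i j = - M j i.
Proof.
move=> MW aW i j.
have WT : W^T = - W by apply/matrixP => a b; rewrite !mxE aW.
suff E : M^T = - M by have := congr1 (fun A : 'M[R]_n => A j i) E; rewrite !mxE.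
have MTW : (- M^T) *m W = 1%:M.
  by rewrite mulNmx -mulmxN -WT -trmx_mul (mulmx1C MW) trmx1.
have E : - M^T = M by rewrite -[LHS]mulmx1 -(mulmx1C MW) mulmxA MTW mul1mx.
by rewrite -{2}E opprK.
Qed.

(** The divergence of [rho X] at a point, where [M] is the inverse of [W], [T] holds the derivatives
    of [W], [la] is [al], [L] holds its derivatives, and [r] is [rho]. The terms in [la] cancel by
    [closed_contraction]; [exact_contraction] evaluates the rest. *)
Lemma flux_contraction M W (L : 'M[R]_n) T (la : 'I_n -> R) (r : R) :
  M *m W = 1%:M -> (forall i j, M i j = - M j i) ->
  (forall i j, L i j - L j i = W i j) ->
  (forall a c d, T a c d = - T a d c) ->
  (forall a c d, T a c d + T c d a + T d a c = 0) ->
  \sum_k (r * (\sum_l (M k l * L k l + la l * - \sum_c \sum_d M k c * T k c d * M d l)) +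
    (\sum_l M k l * la l) * (r / 2 * \sum_c \sum_d T k c d * M d c)) =
  - (n%:R / 2) * r.
Proof.
move=> MW aM LW aT cyc; pose tr k := \sum_c \sum_d T k c d * M d c.
transitivity (\sum_k \sum_l r * (M k l * L k l + la l *
    (2^-1 * (tr k * M k l) - \sum_c \sum_d M k c * T k c d * M d l))).
  apply: eq_bigr => k _; rewrite -/(tr k).
  rewrite mulr_sumr mulr_suml -big_split/=; apply: eq_bigr => l _.
  by move: (tr k) (\sum_c _) => t Q; field.
have -> : \sum_k \sum_l r * (M k l * L k l + la l *
    (2^-1 * (tr k * M k l) - \sum_c \sum_d M k c * T k c d * M d l)) =
  r * (\sum_k \sum_l M k l * L k l + \sum_l la l * (2^-1 *
    (\sum_k tr k * M k l) - \sum_k \sum_c \sum_d M k c * T k c d * M d l)).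
  rewrite mulrDr !mulr_sumr [X in _ = _ + X](_ : _ = \sum_l \sum_k r * (la l *
      (2^-1 * (tr k * M k l) - \sum_c \sum_d M k c * T k c d * M d l))); last first.
    apply: eq_bigr => l _; rewrite -mulr_sumr; congr (_ * _).
    by rewrite -mulr_sumr sumrB mulr_sumr.
  rewrite [X in _ = _ + X]exchange_big -big_split/=; apply: eq_bigr => k _.
  by rewrite mulr_sumr -big_split/=; apply: eq_bigr => l _; rewrite mulrDr.
rewrite mulrC (exact_contraction MW aM LW) big1 ?addr0// => l _.
have := closed_contraction l aM aT cyc.
have -> : \sum_a \sum_c \sum_d T a c d * M d c * M a l = \sum_k tr k * M k l.
  apply: eq_bigr => k _; rewrite mulr_suml; apply: eq_bigr => c _.
  by rewrite mulr_suml.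
by move=> ->; rewrite mulKf ?subrr ?mulr0// pnatr_eq0.
Qed.

End LiouvilleAlgebra.

(** * The pulled-back Kaehler form and its Liouville field in coordinates *)

Section LiouvilleField.
Variables (R : realType) (n m : nat) (D : set 'rV[R]_n).
Variables (a b : 'I_m -> 'rV[R]_n -> R).
Hypothesis oD : open D.
Hypotheses (sa : forall j, smooth_on (a j) D) (sb : forall j, smooth_on (b j) D).

Definition pd (g : 'rV[R]_n -> R) (i : 'I_n) (y : 'rV[R]_n) : R :=
  'd g y (delta_mx 0 i).

(* For the map [a + i b] into C^m, [symp] is the matrix of the pull-back [w] of the
   form [sum_j dx_j /\ dy_j], [primitive] that of the pull-back [al] of
   [sum_j x_j dy_j], hence [d al = w]; [liouville] is the vector field [X] with
   [i_X w = - al], so that [L_X w = - w], and [density] is the volume density of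
   [w ^ (n / 2)] up to a constant. *)
Definition symp (y : 'rV[R]_n) : 'M[R]_n :=
  \matrix_(i, k) \sum_j (pd (a j) i y * pd (b j) k y - pd (b j) i y * pd (a j) k y).

Definition primitive (y : 'rV[R]_n) (k : 'I_n) : R := \sum_j a j y * pd (b j) k y.

Definition density (y : 'rV[R]_n) : R := Num.sqrt `|\det (symp y)|.

Definition liouville (k : 'I_n) (y : 'rV[R]_n) : R :=
  \sum_l invmx (symp y) k l * primitive y l.

Hypothesis uS : forall y, D y -> symp y \in unitmx.

Lemma smooth_C1 (g : 'rV[R]_n -> R) : smooth_on g D -> Ck_on 1 g D.
Proof. by move=> /(_ 1%N). Qed.

Lemma smooth_pd_C1 (g : 'rV[R]_n -> R) i : smooth_on g D -> Ck_on 1 (pd g i) D.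
Proof. by move=> /(_ 2%N)[_ h]; exact: h. Qed.

Lemma symp_C1 i k : Ck_on 1 (fun y => symp y i k) D.
Proof.
have h : Ck_on 1 (fun y => \sum_j (pd (a j) i y * pd (b j) k y -
    pd (b j) i y * pd (a j) k y)) D.
  by apply: (C1_sum _ oD) => j; apply: (C1B oD); apply: (C1M oD); apply: smooth_pd_C1.
by apply: (C1_eq oD _ h) => y _; rewrite mxE.
Qed.

Lemma primitive_C1 k : Ck_on 1 (primitive ^~ k) D.
Proof.
apply: (C1_sum _ oD) => j; apply: (C1M oD); first exact: smooth_C1.
exact: smooth_pd_C1.
Qed.

Lemma pd_primitive y i k : D y ->
  pd (primitive ^~ k) i y =
  \sum_j (pd (a j) i y * pd (b j) k y + a j y * pd (pd (b j) k) i y).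
Proof.
move=> Dy.
have da j := C1_differentiable (smooth_C1 (sa j)) Dy.
have db j := C1_differentiable (smooth_pd_C1 k (sb j)) Dy.
have dab j : differentiable (fun z => a j z * pd (b j) k z) y.
  exact: (differentiableM (da j) (db j)).
have [_ E] := diff_sumE (index_enum 'I_m) (delta_mx 0 i) dab.
apply: etrans E _; apply: eq_bigr => j _.
apply: etrans (diffME (delta_mx 0 i) (da j) (db j)) _.
by rewrite addrC mulrC.
Qed.

Lemma pdC (g : 'rV[R]_n -> R) y i k : smooth_on g D -> D y ->
  pd (pd g k) i y = pd (pd g i) k y.
Proof. by move=> sg Dy; exact: (diff_comm _ _ oD Dy (sg 2%N)). Qed.

(** The second derivatives of the components [b j] cancel by symmetry, which leaves [d al = w] in
    coordinates. *)
Lemma primitive_exact y i k : D y ->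
  pd (primitive ^~ k) i y - pd (primitive ^~ i) k y = symp y i k.
Proof.
move=> Dy; rewrite !pd_primitive// mxE -sumrB; apply: eq_bigr => j _.
have := pdC i k (sb j) Dy.
move: (pd (pd (b j) k) i y) (pd (pd (b j) i) k y) (a j y) => p q r.
move: (pd (a j) i y) (pd (b j) k y) (pd (a j) k y) (pd (b j) i y) => s t u v ->.
by ring.
Qed.

Lemma pd_symp y e i k : D y ->
  pd (fun y => symp y i k) e y =
  \sum_j (pd (pd (a j) i) e y * pd (b j) k y + pd (a j) i y * pd (pd (b j) k) e y
    - pd (pd (b j) i) e y * pd (a j) k y - pd (b j) i y * pd (pd (a j) k) e y).
Proof.
move=> Dy.
have da i j := C1_differentiable (smooth_pd_C1 i (sa j)) Dy.
have db i j := C1_differentiable (smooth_pd_C1 i (sb j)) Dy.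
have d1 j := differentiableM (da i j) (db k j).
have d2 j := differentiableM (db i j) (da k j).
have dd j := differentiableB (d1 j) (d2 j).
have -> : (fun y => symp y i k) = (fun y => \sum_j (pd (a j) i y * pd (b j) k y -
    pd (b j) i y * pd (a j) k y)).
  by apply/funext => z; rewrite mxE.
have [_ E] := diff_sumE (index_enum 'I_m) (delta_mx 0 e) dd.
apply: etrans E _; apply: eq_bigr => j _.
apply: etrans (diffBE _ (d1 j) (d2 j)) _.
have E1 : 'd (fun z => pd (a j) i z * pd (b j) k z) y (delta_mx 0 e) =
    pd (a j) i y * pd (pd (b j) k) e y + pd (b j) k y * pd (pd (a j) i) e y.
  exact: diffME (delta_mx 0 e) (da i j) (db k j).
have E2 : 'd (fun z => pd (b j) i z * pd (a j) k z) y (delta_mx 0 e) =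
    pd (b j) i y * pd (pd (a j) k) e y + pd (a j) k y * pd (pd (b j) i) e y.
  exact: diffME (delta_mx 0 e) (db i j) (da k j).
apply: etrans (congr2 (fun p q => p - q) E1 E2) _.
have alg (s t p q x1 x2 x3 x4 : R) :
    s * x2 + t * x1 - (p * x4 + q * x3) = x1 * t + s * x2 - x3 * q - p * x4 by ring.
exact: alg.
Qed.

Lemma symp_antisym y i k : symp y i k = - symp y k i.
Proof.
have alg (s t p q : R) : s * t - p * q = - (q * p - t * s) by ring.
by rewrite !mxE -sumrN; apply: eq_bigr => j _; exact: alg.
Qed.

(** Written out in the components of the map, each second derivative occurs twice, with the same
    cofactor and opposite signs. *)
Lemma symp_closed y i k l : D y ->
  pd (fun y => symp y k l) i y + pd (fun y => symp y l i) k y +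
  pd (fun y => symp y i k) l y = 0.
Proof.
move=> Dy; rewrite !pd_symp// -!big_split/= big1// => j _.
have alg (x1 x2 x3 x4 x5 x6 z1 z2 z3 z4 z5 z6 p q r s t u : R) :
    x1 = x2 -> x3 = x4 -> x5 = x6 -> z1 = z2 -> z3 = z4 -> z5 = z6 ->
    x1 * u + q * z3 - z1 * r - t * x3 +
    (x5 * s + r * z2 - z5 * p - u * x2) +
    (x4 * t + p * z6 - z4 * q - s * x6) = 0.
  by move=> -> -> -> -> -> ->; ring.
by apply: alg; apply: pdC.
Qed.

Lemma det_symp_C1 : Ck_on 1 (fun y => \det (symp y)) D.
Proof. by apply: (C1_det oD) => i j; exact: symp_C1. Qed.

Lemma det_symp_neq0 y : D y -> \det (symp y) != 0.
Proof. by move=> /uS; rewrite unitmxE unitfE. Qed.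

Lemma density_gt0 y : D y -> 0 < density y.
Proof. by move=> /det_symp_neq0 h; rewrite sqrtr_gt0 normr_gt0. Qed.

Lemma density_C1 : Ck_on 1 density D.
Proof. by have [] := C1_sqrt_norm oD det_symp_neq0 det_symp_C1. Qed.

Lemma invmx_symp_C1 i k : Ck_on 1 (fun y => invmx (symp y) i k) D.
Proof.
have h : Ck_on 1 (fun y => (\det (symp y))^-1 * cofactor (symp y) k i) D.
  apply: (C1M oD); first exact: (C1V oD det_symp_neq0 det_symp_C1).
  apply: (C1M oD); first exact: (C1_cst _ oD).
  apply: (C1_det oD) => p q.
  have := symp_C1 (lift k p) (lift i q).
  by apply: (C1_eq oD) => z _; rewrite !mxE.
by apply: (C1_eq oD _ h) => y Dy; rewrite /invmx uS// !mxE.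
Qed.

Lemma liouville_C1 k : Ck_on 1 (liouville k) D.
Proof.
apply: (C1_sum _ oD) => l.
by apply: (C1M oD); [exact: invmx_symp_C1|exact: primitive_C1].
Qed.

Lemma flux_C1 k : Ck_on 1 (fun y => density y * liouville k y) D.
Proof. by apply: (C1M oD); [exact: density_C1|exact: liouville_C1]. Qed.

(** Obtained by differentiating the identity $W^{-1} W = 1$, which holds on the open set [D], and
    multiplying by $W^{-1}$ on the right. *)
Lemma pd_invmx y e i k : D y ->
  pd (fun z => invmx (symp z) i k) e y =
  - \sum_c \sum_d invmx (symp y) i c * pd (fun z => symp z c d) e y * invmx (symp y) d k.
Proof.
move=> Dy; pose M := invmx (symp y).
pose T : 'M[R]_n := \matrix_(c, d) pd (fun z => symp z c d) e y.
pose dM : 'M[R]_n := \matrix_(c, d) pd (fun z => invmx (symp z) c d) e y.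
have dI p q := C1_differentiable (invmx_symp_C1 p q) Dy.
have dS p q := C1_differentiable (symp_C1 p q) Dy.
have rel : M *m T + dM *m symp y = 0.
  have TE c q : T c q = 'd (fun z => symp z c q) y (delta_mx 0 e) by rewrite mxE.
  have dMc p c : dM p c = 'd (fun z => invmx (symp z) p c) y (delta_mx 0 e) by rewrite mxE.
  have mulE (A B : 'M[R]_n) p q : (A *m B) p q = \sum_c A p c * B c q by rewrite mxE.
  have addE (A B : 'M[R]_n) p q : (A + B) p q = A p q + B p q by rewrite mxE.
  apply/matrixP => p q; rewrite addE mulE mulE -big_split/= [RHS]mxE.
  have dIS c := differentiableM (dI p c) (dS c q).
  have [_ E] := diff_sumE (index_enum 'I_n) (delta_mx 0 e) dIS.
  have dsum : differentiable (fun z => \sum_c invmx (symp z) p c * symp z c q) y.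
    by have [] := diff_sumE (index_enum 'I_n) 0 dIS.
  have E0 : 'd (fun z => \sum_c invmx (symp z) p c * symp z c q) y (delta_mx 0 e) = 0.
    have cE z : D z -> (1%:M : 'M[R]_n) p q = \sum_c invmx (symp z) p c * symp z c q.
      by move=> Dz; rewrite -(mulVmx (uS Dz)) mxE.
    apply: etrans (near_eq_diffE (delta_mx 0 e) oD Dy cE (differentiable_cst _ _)) _.
    exact: diff_cstE.
  rewrite -[RHS]E0; apply/esym; apply: etrans E _; apply: eq_bigr => c _.
  apply: etrans (diffME (delta_mx 0 e) (dI p c) (dS c q)) _.
  by rewrite TE dMc; congr (_ + _); exact: mulrC.
have dME : dM = - (M *m T *m M).
  have : dM *m symp y = - (M *m T) by apply/eqP; rewrite -addr_eq0 addrC rel.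
  by move=> /(congr1 (mulmx^~ M)); rewrite mulmxK ?uS// mulNmx.
have -> : pd (fun z => invmx (symp z) i k) e y = dM i k by rewrite mxE.
have triple (A B C : 'M[R]_n) : (- (A *m B *m C)) i k =
    - \sum_c \sum_d A i c * B c d * C d k.
  rewrite mxE; congr (- _); rewrite -mulmxA mxE; apply: eq_bigr => c _.
  by rewrite mxE mulr_sumr; apply: eq_bigr => d _; rewrite mulrA.
rewrite dME triple; congr (- _); apply: eq_bigr => c _; apply: eq_bigr => d _.
by congr (_ * _ * _); rewrite mxE.
Qed.

(** Jacobi's formula, in which the cofactors divided by the determinant are the entries of the
    inverse. *)
Lemma pd_density y e : D y ->
  pd density e y = density y / 2 *
  \sum_c \sum_d pd (fun z => symp z c d) e y * invmx (symp y) d c.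
Proof.
move=> Dy.
have [_ E] := C1_sqrt_norm oD det_symp_neq0 det_symp_C1.
apply: etrans (E y (delta_mx 0 e) Dy) _.
have dS p q := C1_differentiable (symp_C1 p q) Dy.
apply: etrans (congr1 (fun q => _ * q) (diff_detE (delta_mx 0 e) dS)) _.
rewrite -/(density y) invfM !mulrA -!mulrA; congr (_ * (_ * _)).
rewrite mulr_sumr; apply: eq_bigr => c _; rewrite mulr_sumr; apply: eq_bigr => d _.
by rewrite /invmx (uS Dy) !mxE mulrCA.
Qed.

(** The derivatives computed above instantiate [flux_contraction], whose hypotheses on [L] and [T]
    are [primitive_exact] and [symp_closed]. *)
Lemma div_flux y : D y ->
  \sum_k pd (fun z => density z * liouville k z) k y = - (n%:R / 2) * density y.
Proof.
move=> Dy; pose M := invmx (symp y).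
pose T e : 'M[R]_n := \matrix_(c, d) pd (fun z => symp z c d) e y.
pose L : 'M[R]_n := \matrix_(e, k) pd (primitive ^~ k) e y.
pose la := primitive y.
have MW : M *m symp y = 1%:M by rewrite mulVmx ?uS.
have aM := inverse_antisym MW (symp_antisym y).
have dr := C1_differentiable density_C1 Dy.
have dI p q := C1_differentiable (invmx_symp_C1 p q) Dy.
have dp k := C1_differentiable (primitive_C1 k) Dy.
have dIp k l := differentiableM (dI k l) (dp l).
have pdl k e : pd (liouville k) e y = \sum_l (M k l * L e l +
    la l * - \sum_c \sum_d M k c * T e c d * M d l).
  have [_ E] := diff_sumE (index_enum 'I_n) (delta_mx 0 e) (dIp k).
  apply: etrans E _; apply: eq_bigr => l _.
  apply: etrans (diffME (delta_mx 0 e) (dI k l) (dp l)) _.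
  have := pd_invmx e k l Dy; rewrite /pd => ->.
  congr (_ + _); first by rewrite mxE.
  congr (_ * - _); apply: eq_bigr => c _; apply: eq_bigr => d _.
  by rewrite mxE.
have dl k : differentiable (liouville k) y.
  by have [] := diff_sumE (index_enum 'I_n) 0 (dIp k).
have pdr e : pd density e y = density y / 2 * \sum_c \sum_d T e c d * M d c.
  rewrite pd_density//; congr (_ * _); apply: eq_bigr => c _; apply: eq_bigr => d _.
  by rewrite mxE.
have LW i j : L i j - L j i = symp y i j.
  have LE p q : L p q = pd (primitive ^~ q) p y by rewrite mxE.
  by rewrite LE LE primitive_exact.
have TE e c d : T e c d = pd (fun z => symp z c d) e y by rewrite mxE.
have aT e c d : T e c d = - T e d c.
  have dS := C1_differentiable (symp_C1 d c) Dy.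
  have E : 'd (fun z => 0 - symp z d c) y (delta_mx 0 e) =
      - 'd (fun z => symp z d c) y (delta_mx 0 e).
    apply: etrans (diffBE _ (differentiable_cst (0 : R) y) dS) _.
    by rewrite diff_cstE sub0r.
  rewrite (TE e d c); apply: etrans _ E; rewrite TE /pd; congr ('d _ y _).
  by apply/funext => z; rewrite sub0r -symp_antisym.
have cyc e c d : T e c d + T c d e + T d e c = 0.
  by rewrite !TE symp_closed.
apply: etrans _ (flux_contraction la (density y) MW aM LW aT cyc).
apply: eq_bigr => k _; rewrite -pdl -pdr.
exact: diffME (delta_mx 0 k) dr (dl k).
Qed.

End LiouvilleField.

(** * Chain rule, extension by zero and bump functions *)

Section CompositionAndBumps.
Variable R : realType.

Lemma continuous_for_cst (V : normedModType R) (c : R) x :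
  {for x, continuous (fun _ : V => c)}.
Proof. exact: cvg_cst. Qed.

Lemma diff_pdE n (g : 'rV[R]_n -> R) y v :
  'd g y v = \sum_k v 0 k * pd g k y.
Proof.
rewrite {1}(row_sum_delta v) linear_sum; apply: eq_bigr => k _.
by rewrite linearZ.
Qed.

Lemma pd_continuous n (g : 'rV[R]_n -> R) W k y :
  Ck_on 1 g W -> W y -> {for y, continuous (pd g k)}.
Proof. by move=> c1 Wy; exact: (C1_diff_continuous (delta_mx 0 k) c1 Wy). Qed.

Lemma pd_open_eq n (g h : 'rV[R]_n -> R) W k y : open W -> W y ->
  (forall z, W z -> g z = h z) -> differentiable g y -> pd h k y = pd g k y.
Proof. by move=> oW Wy gh dg; exact: (near_eq_diffE (delta_mx 0 k) oW Wy gh dg). Qed.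

Lemma pdM n (g h : 'rV[R]_n -> R) k y : differentiable g y -> differentiable h y ->
  pd (fun z => g z * h z) k y = g y * pd h k y + h y * pd g k y.
Proof. by move=> dg dh; exact: (diffME (delta_mx 0 k) dg dh). Qed.

Lemma pd_chain n p (g : 'rV[R]_p -> R) (tau : 'rV[R]_n -> 'rV[R]_p) y i :
  differentiable tau y -> differentiable g (tau y) ->
  pd (fun z => g (tau z)) i y = \sum_k jacobian tau y i k * pd g k (tau y).
Proof.
move=> dt dg; apply: etrans (congr1 (@^~ (delta_mx 0 i)) (diff_comp dt dg)) _.
apply: etrans (diff_pdE _ _ _) _; apply: eq_bigr => k _; congr (_ * _).
by rewrite diff_jacobian -rowE [LHS]mxE.
Qed.

Lemma C1_comp n p (g : 'rV[R]_p -> R) (tau : 'rV[R]_n -> 'rV[R]_p)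
    (W : set 'rV[R]_n) (W' : set 'rV[R]_p) :
  open W -> (forall y, W y -> W' (tau y)) -> Ck_on 1 tau W -> Ck_on 1 g W' ->
  Ck_on 1 (fun y => g (tau y)) W.
Proof.
move=> oW WW' ct cg.
have dt y Wy := C1_differentiable (x := y) ct Wy.
have dg y Wy := C1_differentiable (x := tau y) cg (WW' y Wy).
apply: (C1_intro (k := fun v y => \sum_k ('d tau y v) 0 k * pd g k (tau y)) oW).
- by move=> y Wy; exact: (differentiable_comp (dt y Wy) (dg y Wy)).
- move=> y v Wy; apply: etrans (congr1 (@^~ v) (diff_comp (dt y Wy) (dg y Wy))) _.
  exact: diff_pdE.
move=> v y Wy; apply: continuous_for_sum => k.
apply: continuous_forM.
  by apply: coord_for_continuous; exact: (C1_diff_continuous v ct Wy).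
have h := pd_continuous (k:=k) cg (WW' y Wy).
exact: (continuous_for_comp (differentiable_continuous (dt y Wy)) h).
Qed.

(** Functions read in a chart have arbitrary values outside its image; these are replaced by 0
    before integrating. *)
Definition zero_ext (V : normedModType R) (W : set V) (g : V -> R) (y : V) : R :=
  if `[< W y >] then g y else 0.

Lemma zero_extE (V : normedModType R) (W : set V) g y : W y -> zero_ext W g y = g y.
Proof. by move=> Wy; rewrite /zero_ext asboolT. Qed.

Lemma zero_ext_out (V : normedModType R) (W : set V) g y : ~ W y -> zero_ext W g y = 0.
Proof. by move=> Wy; rewrite /zero_ext asboolF. Qed.

Lemma cc_zero_ext (V : normedModType R) (W K : set V) (g : V -> R) :
  open W -> compact K -> K `<=` W -> (forall y, W y -> {for y, continuous g}) ->
  (forall y, W y -> ~ K y -> g y = 0) -> cc (zero_ext W g).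
Proof.
move=> oW cK KW cg g0; apply: (cc_extend cK KW) => [y Wy|y nK].
  by apply: (continuous_for_open_eq oW Wy _ (cg y Wy)) => z Wz; rewrite zero_extE.
have [Wy|nW] := pselect (W y); first by rewrite zero_extE// g0.
by rewrite zero_ext_out.
Qed.

(** The open sets [W] and the complement of [K] cover the space, and the extension of [g] by 0 is
    differentiable on each; [vol_int_derive0] then applies to it. *)
Lemma vol_int_pd0 n (W K : set 'rV[R]_n) (g : 'rV[R]_n -> R) k :
  open W -> compact K -> K `<=` W -> Ck_on 1 g W ->
  (forall y, W y -> ~ K y -> g y = 0) ->
  cc (zero_ext W (pd g k)) /\ vol_int (zero_ext W (pd g k)) = 0.
Proof.
move=> oW cK KW c1 g0; pose G := zero_ext W g; pose e : 'rV[R]_n := delta_mx 0 k.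
have oK : open (~` K).
  by apply: closed_openC; exact: (compact_closed (@norm_hausdorff _ _)).
have Gout y : (~` K) y -> 0 = G y.
  move=> nK; have [Wy|nW] := pselect (W y); first by rewrite /G zero_extE// g0.
  by rewrite /G zero_ext_out.
have cG : cc G.
  by apply: (cc_zero_ext oW cK KW) => // y Wy; exact: (C1_continuous c1 Wy).
have EW y : W y -> differentiable G y /\ 'd G y e = pd g k y.
  move=> Wy; have dg := C1_differentiable c1 Wy.
  have gG z : W z -> g z = G z by move=> Wz; rewrite /G zero_extE.
  split; last exact: (near_eq_diffE e oW Wy gG dg).
  exact: (C1_differentiable (C1_eq oW gG c1) Wy).
have EK y : ~ K y -> differentiable G y /\ 'd G y e = 0.
  move=> nK; have d0 : differentiable (fun _ : 'rV[R]_n => 0 : R) y by exact: differentiable_cst.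
  have cst0 := C1_cst 0 oK.
  split; first exact: (C1_differentiable (C1_eq oK Gout cst0) nK).
  by apply: etrans (near_eq_diffE e oK nK Gout d0) _; exact: diff_cstE.
have dG y : differentiable G y.
  have [Ky|nK] := pselect (K y); first by have [] := EW y (KW _ Ky).
  by have [] := EK y nK.
have dGE : (fun y => 'D_e G y) = zero_ext W (pd g k).
  apply/funext => y; rewrite deriveE//; have [Wy|nW] := pselect (W y).
    by rewrite (zero_extE _ Wy); exact: (proj2 (EW y Wy)).
  rewrite (zero_ext_out _ nW); exact: (proj2 (EK y (fun Ky => nW (KW _ Ky)))).
have cdG : cc (zero_ext W (pd g k)).
  apply: (cc_zero_ext oW cK KW) => y Wy; first exact: (pd_continuous (k:=k) c1 Wy).
  by move=> nK; have [_ <-] := EW y Wy; have [_ ->] := EK y nK.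
split => //; rewrite -dGE; apply: vol_int_derive0 => //.
  by move=> y; exact: diff_derivable.
by rewrite dGE.
Qed.

(** A C^1 cut-off: the partition of unity built from it is differentiated only once. *)
Definition posq (t : R) : R := Num.max 0 t ^+ 2.

Lemma posq_derive t : is_derive t (1 : R) posq (2 * Num.max 0 t).
Proof.
(* A quadratic remainder, uniform in [s] and checked in the four sign cases; after division by [h]
   it is at most the absolute value of [h]. *)
have est (s h : R) : `|posq (h + s) - posq s - 2 * Num.max 0 s * h| <= h ^+ 2.
  rewrite /posq; have h2 := sqr_ge0 h.
  case: (leP 0 s) => s0; case: (leP 0 (h + s)) => hs; rewrite ler_norml.
  - by rewrite (_ : _ - _ = h ^+ 2); [rewrite lexx andbT; lra|ring].
  - by apply/andP; split; nra.
  - by apply/andP; split; nra.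
  - by rewrite !expr0n/= mulr0 mul0r !subr0; apply/andP; split; lra.
have lim : h^-1 *: ((posq \o shift t) (h *: (1 : R)) - posq t) @[h --> 0^'] -->
    2 * Num.max 0 t.
  apply/cvgrPdist_le => e e0; near=> h.
  have h0 : h != 0 by near: h; exact: nbhs_dnbhs_neq.
  have he : `|h| <= e by near: h; apply: dnbhs0_le.
  have -> : (h *: (1 : R)) = h by exact: mulr1.
  rewrite distrC.
  have -> : h^-1 *: ((posq \o shift t) h - posq t) - 2 * Num.max 0 t =
      h^-1 * (posq (h + t) - posq t - 2 * Num.max 0 t * h).
    by rewrite [RHS]mulrBr (mulrC _ h) mulKf.
  rewrite normrM normfV ler_pdivrMl ?normr_gt0//.
  apply: (le_trans (est t h)); rewrite -(real_normK (num_real h)) expr2.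
  by rewrite ler_wpM2l.
split; first by apply/cvg_ex; exists (2 * Num.max 0 t).
exact: cvg_lim lim.
Unshelve. all: by end_near. Qed.

Lemma posq_ge0 t : 0 <= posq t. Proof. exact: sqr_ge0. Qed.

Lemma posq_gt0 t : 0 < t -> 0 < posq t.
Proof. by move=> t0; rewrite exprn_gt0// lt_max t0 orbT. Qed.

Lemma posq_out t : t <= 0 -> posq t = 0.
Proof. by move=> t0; rewrite /posq max_l// expr0n. Qed.

Lemma C1_posq (V : normedModType R) (g : V -> R) W : open W -> Ck_on 1 g W ->
  Ck_on 1 (fun y => posq (g y)) W.
Proof.
move=> oW c1; have dq t : differentiable posq t.
  by apply/derivable1_diffP; case: (posq_derive t).
have dg y Wy := C1_differentiable (x := y) c1 Wy.
apply: (C1_intro (k := fun v y => 2 * Num.max 0 (g y) * 'd g y v) oW).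
- by move=> y Wy; exact: (differentiable_comp (dg y Wy) (dq (g y))).
- move=> y v Wy; apply: etrans (congr1 (@^~ v) (diff_comp (dg y Wy) (dq (g y)))) _.
  rewrite /= (diff1E (dq (g y))) derive1E.
  have -> : 'D_1 posq (g y) = 2 * Num.max 0 (g y) by case: (posq_derive (g y)).
  exact: mulrC.
move=> v y Wy; apply: continuous_forM; last exact: (C1_diff_continuous v c1 Wy).
apply: continuous_forM; first exact: cvg_cst.
have cm : {for g y, continuous (fun t : R => Num.max 0 t)}.
  by apply: continuous_max; [exact: cvg_cst|exact: cvg_id].
exact: (continuous_for_comp (C1_continuous c1 Wy) cm).
Qed.

(** A product over the coordinates, because the norm of R^n is the maximum norm: for [0 < r] the
    positivity set is the open ball of radius [r]. *)
Definition bump n (y0 : 'rV[R]_n) (r : R) (y : 'rV[R]_n) : R :=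
  \prod_i posq (r ^+ 2 - (y 0 i - y0 0 i) ^+ 2).

Lemma bump_ge0 n (y0 : 'rV[R]_n) r y : 0 <= bump y0 r y.
Proof. by apply: prodr_ge0 => i _; exact: posq_ge0. Qed.

Lemma bump_gt0 n (y0 : 'rV[R]_n) r y : `|y - y0| < r -> 0 < bump y0 r y.
Proof.
move=> yr; apply: prodr_gt0 => i _; apply: posq_gt0.
have := rV_entry_le (y - y0) i; rewrite !mxE => /le_lt_trans/(_ yr) h.
by rewrite subr_gt0 -[X in X < _]real_normK ?num_real// ltr_pXn2r ?nnegrE//; exact: ltW (le_lt_trans _ h).
Qed.

Lemma bump_out n (y0 : 'rV[R]_n) r y : 0 <= r -> r < `|y - y0| -> bump y0 r y = 0.
Proof.
move=> r0 yr; have [i hi] : exists i, r < `|(y - y0) 0 i|.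
  apply: contrapT => h; move: yr; rewrite ltNge => /negP; apply.
  apply/rV_norm_leP => // i; rewrite leNgt; apply/negP => hi.
  by apply: h; exists i.
rewrite /bump (bigD1 i)//= posq_out ?mul0r// subr_le0.
rewrite !mxE in hi.
by rewrite -[leRHS]real_normK ?num_real// ler_pXn2r ?nnegrE// ltW.
Qed.

Lemma C1_coord n i (W : set 'rV[R]_n) : open W -> Ck_on 1 (fun y : 'rV[R]_n => y 0 i : R) W.
Proof.
move=> oW; apply: (C1_intro (k := fun v _ : 'rV[R]_n => v 0 i : R) oW).
- by move=> y _; exact: differentiable_coord.
- by move=> y v _; case: (is_diff_coord y i) => _ E; exact: (congr1 (@^~ v) E).
- by move=> v y _; exact: (@continuous_for_cst 'rV[R]_n (v 0 i) y).
Qed.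

Lemma C1_bump n (y0 : 'rV[R]_n) r : Ck_on 1 (bump y0 r) setT.
Proof.
have oT := @openT 'rV[R]_n.
apply: (C1_prod _ oT) => i; apply: (C1_posq oT); apply: (C1B oT); first exact: C1_cst.
have h : Ck_on 1 (fun y : 'rV[R]_n => y 0 i - y0 0 i) setT.
  by apply: (C1B oT); [exact: C1_coord|exact: C1_cst].
exact: (C1M oT h h).
Qed.

End CompositionAndBumps.

(** * Charts *)

Section Charts.
Variables (R : realType) (n : nat) (N : smoothManifold R n).
Implicit Types (c d : chart R n N) (y : 'rV[R]_n).

Definition transition c d y := chart_map d (chart_inv c y).

Definition overlap c d : set 'rV[R]_n := chart_map c @` (chart_dom c `&` chart_dom d).

Lemma codom_inv c y : chart_codom c y ->
  chart_dom c (chart_inv c y) /\ chart_map c (chart_inv c y) = y.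
Proof. by move=> [x cx <-]; rewrite chart_mapK. Qed.

Lemma codom_map c x : chart_dom c x -> chart_codom c (chart_map c x).
Proof. by move=> cx; exists x. Qed.

Lemma overlapP c d y :
  overlap c d y <-> chart_codom c y /\ chart_dom d (chart_inv c y).
Proof.
split=> [[x [cx dx] <-]|[/codom_inv[cy E] dy]].
  by rewrite chart_mapK//; split => //; exact: codom_map.
by exists (chart_inv c y).
Qed.

Lemma open_preimage_inv c (A : set N) : open A ->
  open [set y | chart_codom c y /\ A (chart_inv c y)].
Proof.
move=> oA; rewrite openE => y [cy Ay]; apply: filterI.
  by apply: open_nbhs_nbhs; split => //; exact: chart_codom_open.
have := chart_inv_continuous cy; apply.
exact: open_nbhs_nbhs.
Qed.

Lemma open_overlap c d : open (overlap c d).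
Proof.
have -> : overlap c d = [set y | chart_codom c y /\ chart_dom d (chart_inv c y)].
  by apply/seteqP; split => y /overlapP.
by apply: open_preimage_inv; exact: chart_dom_open.
Qed.

Lemma overlap_codom c d y : overlap c d y -> chart_codom c y.
Proof. by move=> /overlapP[]. Qed.

Lemma overlap_map c d x : chart_dom c x -> chart_dom d x -> overlap c d (chart_map c x).
Proof. by move=> cx dx; exists x. Qed.

Lemma inv_transition c d y : overlap c d y -> chart_inv d (transition c d y) = chart_inv c y.
Proof. by move=> /overlapP[_ dy]; rewrite /transition chart_mapK. Qed.

Lemma transition_map c d x : chart_dom c x -> transition c d (chart_map c x) = chart_map d x.
Proof. by move=> cx; rewrite /transition chart_mapK. Qed.

Lemma transition_overlap c d y : overlap c d y -> overlap d c (transition c d y).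
Proof.
move=> oy; apply/overlapP; rewrite inv_transition//.
move: oy => /overlapP[/codom_inv[cy _] dy]; split => //.
exact: codom_map.
Qed.

Lemma transitionK c d y : overlap c d y -> transition d c (transition c d y) = y.
Proof.
move=> oy; rewrite {1}/transition inv_transition//.
by move: oy => /overlapP[/codom_inv[]].
Qed.

Lemma transition_C1 c d : atlas c -> atlas d -> Ck_on 1 (transition c d) (overlap c d).
Proof. by move=> ac ad; exact: (atlas_compatible ac ad 1%N). Qed.

Lemma jacobian_transition c d y : atlas c -> atlas d -> overlap c d y ->
  jacobian (transition c d) y *m jacobian (transition d c) (transition c d y) = 1%:M.
Proof.
move=> ac ad oy.
apply: (@jacobian_inverse R n (overlap c d) (overlap d c) (transition c d) (transition d c)).
- exact: open_overlap.
- exact: transition_overlap.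
- exact: transitionK.
- exact: transition_C1.
- exact: transition_C1.
- exact: oy.
Qed.

Lemma jacobian_transition_unit c d y : atlas c -> atlas d -> overlap c d y ->
  jacobian (transition c d) y \in unitmx.
Proof. by move=> ac ad oy; exact: (proj1 (mulmx1_unit (jacobian_transition ac ad oy))). Qed.

Lemma pd_transition c d (u : N -> R) y i : atlas c -> atlas d -> overlap c d y ->
  differentiable (fun z => u (chart_inv d z)) (transition c d y) ->
  pd (fun z => u (chart_inv c z)) i y =
  \sum_k jacobian (transition c d) y i k *
    pd (fun z => u (chart_inv d z)) k (transition c d y).
Proof.
move=> ac ad oy du.
have dt := C1_differentiable (transition_C1 ac ad) oy.
have E := pd_chain i dt du.
apply: etrans E.
have gh z : overlap c d z -> u (chart_inv d (transition c d z)) = u (chart_inv c z).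
  by move=> oz; rewrite inv_transition.
exact: (@pd_open_eq R n (fun z => u (chart_inv d (transition c d z)))
  (fun z => u (chart_inv c z)) _ i y (@open_overlap c d) oy gh (differentiable_comp dt du)).
Qed.

End Charts.

(** The inverse of the matrix of a 2-form transforms contravariantly; this is what makes the
    Liouville field independent of the chart. *)
Lemma congruence_inv (F : fieldType) n (J S : 'M[F]_n) :
  J \in unitmx -> S \in unitmx -> J^T *m invmx (J *m S *m J^T) *m J = invmx S.
Proof.
move=> uJ uS; have uJT : J^T \in unitmx by rewrite unitmx_tr.
have uA : J *m S *m J^T \in unitmx by rewrite !unitmx_mul uJ uS.
have : J *m S *m J^T *m (invmx J^T *m invmx S *m invmx J) = 1%:M.
  by rewrite !mulmxA mulmxK// mulmxK// mulmxV.
move=> /(congr1 (mulmx (invmx (J *m S *m J^T)))); rewrite mulKmx// mulmx1 => <-.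
by rewrite !mulmxA mulmxV// mul1mx mulmxKV.
Qed.

(** * Change of charts for the form, the density and the Liouville field *)

Section SymplecticStructure.
Variables (R : realType) (n m : nat) (N : smoothManifold R n).
Variable f : N -> 'rV[R[i]]_m.
Hypothesis sf : smooth_map f.
Implicit Types (c d : chart R n N) (y : 'rV[R]_n).

Definition chart_symp c := symp (re_in_chart f c) (im_in_chart f c).
Definition chart_density c := density (re_in_chart f c) (im_in_chart f c).
Definition chart_primitive c := primitive (re_in_chart f c) (im_in_chart f c).
Definition chart_liouville c := liouville (re_in_chart f c) (im_in_chart f c).

Lemma smooth_re c j : atlas c -> smooth_on (re_in_chart f c j) (chart_codom c).
Proof. by move=> ac; case: (sf ac j). Qed.

Lemma smooth_im c j : atlas c -> smooth_on (im_in_chart f c j) (chart_codom c).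
Proof. by move=> ac; case: (sf ac j). Qed.

Lemma pd_re_transition c d y i j : atlas c -> atlas d -> overlap c d y ->
  pd (re_in_chart f c j) i y =
  \sum_k jacobian (transition c d) y i k * pd (re_in_chart f d j) k (transition c d y).
Proof.
move=> ac ad oy; apply: (@pd_transition _ _ _ _ _ (fun x => complex.Re (f x 0 j))) => //.
apply: (C1_differentiable (smooth_re j ad 1%N)).
by have /transition_overlap/overlap_codom := oy.
Qed.

Lemma pd_im_transition c d y i j : atlas c -> atlas d -> overlap c d y ->
  pd (im_in_chart f c j) i y =
  \sum_k jacobian (transition c d) y i k * pd (im_in_chart f d j) k (transition c d y).
Proof.
move=> ac ad oy; apply: (@pd_transition _ _ _ _ _ (fun x => complex.Im (f x 0 j))) => //.
apply: (C1_differentiable (smooth_im j ad 1%N)).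
by have /transition_overlap/overlap_codom := oy.
Qed.

(** The form is bilinear in the first derivatives of [f], which the chain rule transforms by [J]. *)
Lemma symp_transition c d y : atlas c -> atlas d -> overlap c d y ->
  let J := jacobian (transition c d) y in
  chart_symp c y = J *m chart_symp d (transition c d y) *m J^T.
Proof.
move=> ac ad oy J.
have conj3 (A S : 'M[R]_n) i k :
    (A *m S *m A^T) i k = \sum_p \sum_q A i p * S p q * A k q.
  rewrite -mulmxA mxE; apply: eq_bigr => p _; rewrite mxE mulr_sumr.
  by apply: eq_bigr => q _; rewrite mxE mulrA.
have sympE (a b : 'I_m -> 'rV[R]_n -> R) z i k : symp a b z i k =
    \sum_j (pd (a j) i z * pd (b j) k z - pd (b j) i z * pd (a j) k z).
  by rewrite mxE.
apply/matrixP => i k.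
apply: etrans (sympE (re_in_chart f c) (im_in_chart f c) y i k) _.
apply: etrans _ (esym (conj3 J (chart_symp d (transition c d y)) i k)).
have alg (u v : 'I_n -> R) : \sum_p \sum_q J i p * (u p * v q - v p * u q) * J k q =
    (\sum_p J i p * u p) * (\sum_p J k p * v p) -
    (\sum_p J i p * v p) * (\sum_p J k p * u p).
  rewrite !mulr_suml -sumrB; apply: eq_bigr => p _.
  by rewrite !mulr_sumr -sumrB; apply: eq_bigr => q _; ring.
transitivity (\sum_j \sum_p \sum_q J i p *
    (pd (re_in_chart f d j) p (transition c d y) * pd (im_in_chart f d j) q (transition c d y) -
     pd (im_in_chart f d j) p (transition c d y) * pd (re_in_chart f d j) q (transition c d y))
    * J k q).
  apply: eq_bigr => j _; apply: etrans (esym (alg _ _)).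
  by congr (_ * _ - _ * _); [exact: pd_re_transition|exact: pd_im_transition|
    exact: pd_im_transition|exact: pd_re_transition].
rewrite exchange_big; apply: eq_bigr => p _; rewrite exchange_big; apply: eq_bigr => q _.
rewrite -mulr_suml -mulr_sumr; congr (_ * _ * _).
exact: (esym (sympE (re_in_chart f d) (im_in_chart f d) (transition c d y) p q)).
Qed.

Lemma primitive_transition c d y i : atlas c -> atlas d -> overlap c d y ->
  chart_primitive c y i =
  \sum_k jacobian (transition c d) y i k * chart_primitive d (transition c d y) k.
Proof.
move=> ac ad oy; rewrite /chart_primitive /primitive.
under eq_bigr do rewrite (pd_im_transition _ _ ac ad oy) mulr_sumr.
rewrite exchange_big; apply: eq_bigr => k _; rewrite mulr_sumr; apply: eq_bigr => j _.
rewrite mulrCA; congr (_ * (_ * _)).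
by rewrite /re_in_chart inv_transition.
Qed.

(** The determinant of the form is multiplied by the square of [det J]; the square root leaves the
    absolute value found in the change of variables formula. *)
Lemma density_transition c d y : atlas c -> atlas d -> overlap c d y ->
  chart_density c y =
  `|\det (jacobian (transition c d) y)| * chart_density d (transition c d y).
Proof.
move=> ac ad oy; rewrite /chart_density /density.
have -> : symp (re_in_chart f c) (im_in_chart f c) y = _ := symp_transition ac ad oy.
rewrite !det_mulmx det_tr mulrAC -expr2 normrM sqrtrM// normrX.
by rewrite sqrtr_sqr normr_id.
Qed.

Hypothesis uS : forall c y, atlas c -> chart_codom c y -> chart_symp c y \in unitmx.

Definition chart_lie c (u : N -> R) y : R :=
  \sum_k chart_liouville c k y * pd (fun z => u (chart_inv c z)) k y.

(** In matrix form the derivative is $du^T S^{-1} al$; both [du] and [al] transform by [J], and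
    [congruence_inv] absorbs the two factors. *)
Lemma lie_transition c d u y : atlas c -> atlas d -> overlap c d y ->
  differentiable (fun z => u (chart_inv d z)) (transition c d y) ->
  chart_lie c u y = chart_lie d u (transition c d y).
Proof.
move=> ac ad oy du; pose J := jacobian (transition c d) y.
pose Sc := chart_symp c y; pose Sd := chart_symp d (transition c d y).
have uJ : J \in unitmx by exact: jacobian_transition_unit.
have uSd : Sd \in unitmx.
  by apply: uS => //; have /transition_overlap/overlap_codom := oy.
have ScE : Sc = J *m Sd *m J^T by exact: symp_transition.
have uSc : Sc \in unitmx by apply: uS => //; exact: overlap_codom oy.
pose l e z : 'cV[R]_n := \col_k chart_primitive e z k.
pose g e z : 'cV[R]_n := \col_k pd (fun z => u (chart_inv e z)) k z.
have lieE e z : chart_lie e u z = ((g e z)^T *m (invmx (chart_symp e z) *m l e z)) 0 0.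
  rewrite mxE; apply: eq_bigr => k _; rewrite mulrC; congr (_ * _).
    by rewrite !mxE.
  by rewrite mxE; apply: eq_bigr => p _; rewrite mxE.
have gE : g c y = J *m g d (transition c d y).
  apply/colP => k; rewrite mxE (pd_transition k ac ad oy du) mxE.
  by apply: eq_bigr => p _; congr (_ * _); rewrite [RHS]mxE.
have lE : l c y = J *m l d (transition c d y).
  apply/colP => k; rewrite mxE (primitive_transition k ac ad oy) mxE.
  by apply: eq_bigr => p _; congr (_ * _); rewrite [RHS]mxE.
have mid : J^T *m invmx Sc *m J = invmx Sd :=
  etrans (congr1 (fun S => J^T *m invmx S *m J) ScE) (congruence_inv uJ uSd).
have assoc (A : 'rV[R]_n) (C B : 'M[R]_n) (v : 'cV[R]_n) :
    A *m B^T *m (C *m (B *m v)) = A *m (B^T *m C *m B *m v) by rewrite !mulmxA.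
apply: etrans (lieE c y) _; apply: etrans _ (esym (lieE d (transition c d y))).
have E1 : (g c y)^T = (g d (transition c d y))^T *m J^T by rewrite gE trmx_mul.
apply: etrans (congr2 (fun (A : 'rV[R]_n) (v : 'cV[R]_n) =>
  (A *m (invmx (chart_symp c y) *m v)) 0 0) E1 lE) _.
apply: etrans (congr1 (fun A : 'M[R]_1 => A 0 0)
  (assoc (g d (transition c d y))^T (invmx Sc) J (l d (transition c d y)))) _.
exact: (congr1 (fun B : 'M[R]_n => ((g d (transition c d y))^T *m
  (B *m l d (transition c d y))) 0 0) mid).
Qed.

End SymplecticStructure.

(** * Slant immersions *)

Section SlantAngle.
Variable R : realType.

(** Outside [-1, 1] [acos] takes the default value 0, which allows the bounds below to be stated for
    every real [t]. *)
Lemma acos_range_or0 (t : R) : -1 <= t <= 1 \/ acos t = 0.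
Proof.
have [|nt] := boolP (-1 <= t <= 1); [by left|right].
rewrite unlock; case: xgetP => //= y _ [_ yt]; exfalso; move/negP: nt; apply.
by rewrite -yt cos_geN1 cos_le1.
Qed.

Lemma acos_nneg (t : R) : 0 <= acos t.
Proof. by have [/acos_ge0|->] := acos_range_or0 t. Qed.

Lemma acos_ge_pihalf (t : R) : pi / 2 <= acos t -> t <= 0.
Proof.
have p0 := pi_gt0 R.
have [t1|->] := acos_range_or0 t; last by lra.
move=> h; have [/andP[a0 api] tE] := acos_def t1.
rewrite leNgt; apply/negP => t0.
have : cos (pi / 2) < cos (acos t) by rewrite cos_pihalf tE.
rewrite ltr_cos ?ltNge ?h// in_itv/=; apply/andP; split => //; lra.
Qed.

Lemma Re_sum (I : Type) (s : seq I) (F : I -> R[i]) :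
  complex.Re (\sum_(j <- s) F j) = \sum_(j <- s) complex.Re (F j).
Proof.
elim: s => [|j s IH]; first by rewrite !big_nil.
by rewrite !big_cons -IH; case: (F j) => a b; case: (\sum_(_ <- _) _).
Qed.

Variable m : nat.
Implicit Types u v : 'rV[R[i]]_m.

Lemma innerE u v : inner u v =
  \sum_j (complex.Re (u 0 j) * complex.Re (v 0 j) + complex.Im (u 0 j) * complex.Im (v 0 j)).
Proof.
rewrite /inner Re_sum; apply: eq_bigr => j _.
by case: (u 0 j) => a b; case: (v 0 j) => c d; rewrite /= mulrN opprK.
Qed.

Lemma innerN u v : inner u (- v) = - inner u v.
Proof.
rewrite !innerE -sumrN; apply: eq_bigr => j _; rewrite mxE.
by case: (v 0 j) => c d /=; rewrite !mulrN opprD.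
Qed.

Lemma inner0l v : inner 0 v = 0.
Proof. by rewrite innerE big1// => j _; rewrite mxE !mul0r addr0. Qed.

Lemma inner0r v : inner v 0 = 0.
Proof. by rewrite innerE big1// => j _; rewrite [in X in _ * X]mxE !mulr0 mxE mulr0 addr0. Qed.

Lemma enormN v : enorm (- v) = enorm v.
Proof.
rewrite /enorm; congr Num.sqrt; rewrite !innerE; apply: eq_bigr => j _.
by rewrite mxE; case: (v 0 j) => c d /=; rewrite !mulrNN.
Qed.

Lemma enorm_gt0 v : v != 0 -> 0 < enorm v.
Proof.
move=> /rV0Pn[j vj]; rewrite sqrtr_gt0 innerE (bigD1 j)//=.
have sq (z : R[i]) : 0 <= complex.Re z * complex.Re z + complex.Im z * complex.Im z.
  by rewrite addr_ge0// -expr2 sqr_ge0.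
apply: ltr_pwDl; last by apply: sumr_ge0.
rewrite lt_neqAle sq andbT eq_sym; move: vj; apply: contra.
case: (v 0 j) => a b /=; rewrite -!expr2 paddr_eq0 ?sqr_ge0// !expf_eq0/=.
by move=> /andP[/eqP -> /eqP ->].
Qed.

Lemma J0_neq0 v : v != 0 -> J0 v != 0.
Proof.
move=> v0; rewrite /J0 scaler_eq0 negb_or v0 andbT.
by apply/eqP => -[] /eqP; rewrite oner_eq0.
Qed.

End SlantAngle.

Section SlantImmersions.
Variables (R : realType) (n m : nat) (N : smoothManifold R n).
Variable f : N -> 'rV[R[i]]_m.
Hypothesis sf : smooth_map f.
Implicit Types (c d : chart R n N) (v w : 'rV[R]_n).

(** Since [J0] sends [a + i b] to [- b + i a], the real inner product with [c + i d] is [a d - b c]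
    in each coordinate: the Kaehler form. *)
Lemma inner_J0_differential c x v w :
  inner (J0 (differential f c x v)) (differential f c x w) =
  (v *m chart_symp f c (chart_map c x) *m w^T) 0 0.
Proof.
pose y := chart_map c x.
have trip (S : 'M[R]_n) : (v *m S *m w^T) 0 0 = \sum_p \sum_q v 0 p * S p q * w 0 q.
  rewrite -mulmxA mxE; apply: eq_bigr => p _; rewrite mxE mulr_sumr.
  by apply: eq_bigr => q _; rewrite mxE mulrA.
have alg (g h : 'I_n -> R) : \sum_p \sum_q v 0 p * (g p * h q - h p * g q) * w 0 q =
    (\sum_p v 0 p * g p) * (\sum_p w 0 p * h p) -
    (\sum_p v 0 p * h p) * (\sum_p w 0 p * g p).
  rewrite !mulr_suml -sumrB; apply: eq_bigr => p _.
  by rewrite !mulr_sumr -sumrB; apply: eq_bigr => q _; ring.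
apply: etrans _ (esym (trip _)); rewrite innerE.
transitivity (\sum_j \sum_p \sum_q v 0 p *
    (pd (re_in_chart f c j) p y * pd (im_in_chart f c j) q y -
     pd (im_in_chart f c j) p y * pd (re_in_chart f c j) q y) * w 0 q).
  apply: eq_bigr => j _; apply: etrans _ (esym (alg _ _)); rewrite !mxE.
  rewrite -!diff_pdE /=.
  have alg2 (p q r s : R) : (0 * p - 1 * q) * r + (0 * q + 1 * p) * s = p * s - q * r by ring.
  exact: alg2.
rewrite exchange_big; apply: eq_bigr => p _; rewrite exchange_big; apply: eq_bigr => q _.
by rewrite -mulr_suml -mulr_sumr; congr (_ * _ * _); rewrite /chart_symp mxE.
Qed.

(** Elements of [tangent_space] may come from different charts; this brings them all into one. *)
Lemma differential_change c d x v : atlas c -> atlas d -> chart_dom c x -> chart_dom d x ->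
  differential f d x v =
  differential f c x ('d (transition d c) (chart_map d x) v).
Proof.
move=> ac ad cx dx; have oy := overlap_map dx cx.
have dt := C1_differentiable (transition_C1 ad ac) oy.
have tE : transition d c (chart_map d x) = chart_map c x by exact: transition_map.
have key (u : N -> R) : differentiable (fun z => u (chart_inv c z)) (chart_map c x) ->
    'd (fun z => u (chart_inv d z)) (chart_map d x) v =
    'd (fun z => u (chart_inv c z)) (chart_map c x) ('d (transition d c) (chart_map d x) v).
  rewrite -tE => du.
  have gh z : overlap d c z -> u (chart_inv c (transition d c z)) = u (chart_inv d z).
    by move=> oz; rewrite inv_transition.
  apply: etrans (near_eq_diffE v (@open_overlap _ _ _ d c) oy gh (differentiable_comp dt du)) _.
  exact: (congr1 (@^~ v) (diff_comp dt du)).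
have cy := codom_map cx.
apply/rowP => j; rewrite !mxE; congr Complex.
  apply: (key (fun x => complex.Re (f x 0 j))).
  exact: (C1_differentiable (smooth_re sf j ac 1%N) cy).
apply: (key (fun x => complex.Im (f x 0 j))).
exact: (C1_differentiable (smooth_im sf j ac 1%N) cy).
Qed.

Lemma tangent_in_chart c x X : atlas c -> chart_dom c x -> tangent_space f x X ->
  exists w, X = differential f c x w.
Proof.
move=> ac cx [d [v [ad dx ->]]].
by eexists; exact: differential_change.
Qed.

Lemma tangent_differential c x v : atlas c -> chart_dom c x ->
  tangent_space f x (differential f c x v).
Proof. by move=> ac cx; exists c, v. Qed.

Lemma differential0 c x : differential f c x 0 = 0.
Proof. by apply/rowP => j; rewrite !mxE !linear0. Qed.

Lemma differentialN c x v : differential f c x (- v) = - differential f c x v.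
Proof. by apply/rowP => j; rewrite !mxE !linearN. Qed.

Hypothesis slant : slant_immersion f.

(* A kernel vector [v] of the pulled back Kaehler form at a single point makes
   [J0 (df v)] orthogonal to the tangent space, so the constant angle is [pi / 2]. *)
Lemma slant_dichotomy : totally_real f \/
  forall c y, atlas c -> chart_codom c y -> chart_symp f c y \in unitmx.
Proof.
have [[_ inj] [theta hth]] := slant.
have p0 := pi_gt0 R.
have [thE|thN] := eqVneq theta (pi / 2); [left|right].
  move=> x _ [X TX <-] Y TY.
  have [->|X0] := eqVneq X 0.
    by rewrite /J0 scaler0 inner0l.
  have [->|Y0] := eqVneq Y 0.
    by rewrite inner0r.
  have TNY : tangent_space f x (- Y).
    move: TY => [c [v [ac cx ->]]]; exists c, (- v); split => //.
    by rewrite differentialN.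
  have lb : has_lbound [set angle (J0 X) w | w in [set w | tangent_space f x w /\ w != 0]].
    by exists 0 => _ [w _ <-]; exact: acos_nneg.
  (* The infimum being [pi / 2], no angle is acute; applied to [Y] and to [- Y], this gives
     orthogonality. *)
  have le0 Z : tangent_space f x Z -> Z != 0 ->
      inner (J0 X) Z / (enorm (J0 X) * enorm Z) <= 0.
    move=> TZ Z0; apply: acos_ge_pihalf; rewrite -thE -(hth x X TX X0).
    by apply: (ge_inf lb); exists Z.
  have nX := enorm_gt0 (J0_neq0 X0); have nY := enorm_gt0 Y0.
  have nXY : 0 < (enorm (J0 X) * enorm Y)^-1 by rewrite invr_gt0 mulr_gt0.
  have := le0 _ TNY; rewrite oppr_eq0 innerN enormN mulNr oppr_le0 => /(_ Y0).
  have := le0 _ TY Y0.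
  rewrite pmulr_lle0// pmulr_lge0// => h1 h2.
  by apply/eqP; rewrite eq_le h1 h2.
move=> c y ac cy; have [cx yE] := codom_inv cy; rewrite -yE.
set x := chart_inv c y in cx *.
rewrite -row_free_unit -kermx_eq0; apply: contrapT => /negP /rowV0Pn[v /sub_kermxP vS v0].
pose X := differential f c x v.
have X0 : X != 0.
  apply: contra v0 => /eqP XE; apply/eqP; apply: (inj c x ac cx).
  by rewrite differential0.
have TX : tangent_space f x X by exact: tangent_differential.
move/eqP: thN; apply; rewrite -(hth x X TX X0) /angle_to_subspace.
(* Every angle is [pi / 2] as the inner products vanish, and the set is nonempty because [X] itself
   is a nonzero tangent vector. *)
have -> : [set angle (J0 X) w | w in [set w | tangent_space f x w /\ w != 0]] = [set pi / 2].
  have ang (w : 'rV[R[i]]_m) : tangent_space f x w -> angle (J0 X) w = pi / 2.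
    move=> Tw; have [w' ->] := tangent_in_chart ac cx Tw.
    by rewrite /angle inner_J0_differential vS mul0mx mxE mul0r acos0.
  apply/seteqP; split => [_ [w [Tw _] <-]|_ ->]; first exact: ang.
  by exists X; [split|exact: ang].
exact: inf1.
Qed.

End SlantImmersions.

(** * Integration in charts *)

Section ManifoldIntegral.
Variables (R : realType) (n m : nat) (N : smoothManifold R n).
Variable f : N -> 'rV[R[i]]_m.
Hypothesis sf : smooth_map f.
Hypothesis uS : forall c y, atlas c -> chart_codom c y -> chart_symp f c y \in unitmx.
Implicit Types (c d : chart R n N) (h u : N -> R) (K : set N).

Definition manifold_C1 u :=
  forall c, atlas c -> Ck_on 1 (fun y => u (chart_inv c y)) (chart_codom c).

Definition chart_continuous u := forall c y, atlas c -> chart_codom c y ->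
  {for y, continuous (fun y => u (chart_inv c y))}.

Lemma manifold_C1_continuous u : manifold_C1 u -> chart_continuous u.
Proof. by move=> u1 c y ac cy; exact: (C1_continuous (u1 c ac) cy). Qed.

Definition chart_ext c h : 'rV[R]_n -> R :=
  zero_ext (chart_codom c) (fun y => chart_density f c y * h (chart_inv c y)).

(** The integral of [h] against the volume density, meaningful when the support of [h] is a compact
    subset of the domain of [c]. *)
Definition chart_int c h : R := vol_int (chart_ext c h).

Lemma chart_density_C1 c : atlas c -> Ck_on 1 (chart_density f c) (chart_codom c).
Proof.
move=> ac; apply: density_C1; first exact: chart_codom_open.
- by move=> j; exact: (smooth_re sf j ac).
- by move=> j; exact: (smooth_im sf j ac).
- by move=> y cy; exact: (uS ac cy).
Qed.

Lemma chart_density_gt0 c y : atlas c -> chart_codom c y -> 0 < chart_density f c y.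
Proof.
move=> ac cy; apply: (@density_gt0 _ _ _ (chart_codom c)) => //.
by move=> z cz; exact: (uS ac cz).
Qed.

Lemma compact_chart_map c K : compact K -> K `<=` chart_dom c -> compact (chart_map c @` K).
Proof.
move=> cK Kc; apply: continuous_compact => //.
by apply: continuous_in_subspaceT => x /[1!inE] /Kc; exact: chart_map_continuous.
Qed.

Lemma chart_map_codom c K : K `<=` chart_dom c -> chart_map c @` K `<=` chart_codom c.
Proof. by move=> Kc _ [x /Kc cx <-]; exact: codom_map. Qed.

Lemma chart_inv_notin c K y : chart_codom c y -> ~ (chart_map c @` K) y ->
  ~ K (chart_inv c y).
Proof.
by move=> /codom_inv[_ yE] nK Ky; apply: nK; exists (chart_inv c y).
Qed.

Lemma cc_chart_ext c h K : atlas c -> compact K -> K `<=` chart_dom c ->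
  chart_continuous h -> (forall x, ~ K x -> h x = 0) -> cc (chart_ext c h).
Proof.
move=> ac cK Kc ch h0.
apply: (cc_zero_ext (chart_codom_open (c := c)) (compact_chart_map cK Kc) (chart_map_codom Kc)).
  move=> y cy; apply: continuous_forM; last exact: (ch c y ac cy).
  exact: (C1_continuous (chart_density_C1 ac) cy).
by move=> y cy /(chart_inv_notin cy)/h0 ->; rewrite mulr0.
Qed.

(** The Jacobian factor of the change of variables is the one by which the density transforms. *)
Lemma chart_int_change c d h K : atlas c -> atlas d -> compact K ->
  K `<=` chart_dom c -> K `<=` chart_dom d -> chart_continuous h ->
  (forall x, ~ K x -> h x = 0) -> chart_int c h = chart_int d h.
Proof.
move=> ac ad cK Kc Kd ch h0.
have cu := cc_chart_ext ad cK Kd ch h0.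
have cKd := compact_chart_map cK Kd.
have KU : chart_map d @` K `<=` overlap d c.
  by move=> _ [x Kx <-]; apply: overlap_map; [exact: Kd|exact: Kc].
have u0 y : ~ (chart_map d @` K) y -> chart_ext d h y = 0.
  move=> nK; have [dy|ndy] := pselect (chart_codom d y); last by rewrite /chart_ext zero_ext_out.
  by rewrite /chart_ext zero_extE// (h0 _ (chart_inv_notin dy nK)) mulr0.
have := @change_of_variables R n (overlap d c) (overlap c d) (transition d c) (transition c d)
  (@open_overlap _ _ _ d c) (@open_overlap _ _ _ c d)
  (@transition_overlap _ _ _ d c)
  (@transitionK _ _ _ d c) (@transitionK _ _ _ c d)
  (transition_C1 ad ac) (transition_C1 ac ad) (chart_ext d h) _ cu cKd KU u0.
rewrite /chart_int => <-; congr vol_int; apply/funext => y; rewrite /pullback.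
have [oy|noy] := pselect (overlap c d y).
  rewrite jac_factorE// /chart_ext zero_extE; last exact: overlap_codom oy.
  rewrite zero_extE; last by have /transition_overlap/overlap_codom := oy.
  by rewrite (density_transition sf ac ad oy) inv_transition//; ring.
rewrite jac_factor_out// mulr0 /chart_ext.
have [cy|ncy] := pselect (chart_codom c y); last by rewrite zero_ext_out.
rewrite zero_extE// h0 ?mulr0// => /Kd dy; apply: noy.
by apply/overlapP.
Qed.

Variable chart_at : N -> chart R n N.
Hypothesis atlas_at : forall x, atlas (chart_at x).
Hypothesis dom_at : forall x, chart_dom (chart_at x) x.

(* The choice of the charts is immaterial, see [lieE]. *)
Definition lie u (x : N) : R := chart_lie f (chart_at x) u (chart_map (chart_at x) x).

Lemma lieE u c y : manifold_C1 u -> atlas c -> chart_codom c y ->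
  lie u (chart_inv c y) = chart_lie f c u y.
Proof.
move=> u1 ac cy; have [cx yE] := codom_inv cy; pose x := chart_inv c y.
have oy : overlap c (chart_at x) y by apply/overlapP; split => //; exact: dom_at.
apply/esym; apply: (lie_transition sf uS ac (atlas_at x) oy).
apply: (C1_differentiable (u1 _ (atlas_at x))).
by have /transition_overlap/overlap_codom := oy.
Qed.

Lemma chart_lie_continuous u c y : manifold_C1 u -> atlas c -> chart_codom c y ->
  {for y, continuous (chart_lie f c u)}.
Proof.
move=> u1 ac cy; apply: continuous_for_sum => k; apply: continuous_forM.
  apply: (C1_continuous _ cy); apply: liouville_C1; first exact: chart_codom_open.
  - by move=> j; exact: (smooth_re sf j ac).
  - by move=> j; exact: (smooth_im sf j ac).
  - by move=> z cz; exact: (uS ac cz).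
exact: (pd_continuous (k := k) (u1 c ac) cy).
Qed.

Lemma lie_continuous u : manifold_C1 u -> chart_continuous (lie u).
Proof.
move=> u1 c y ac cy.
apply: (continuous_for_open_eq (chart_codom_open (c := c)) cy _ (chart_lie_continuous u1 ac cy)).
by move=> z cz; rewrite lieE.
Qed.

(** A point off the closed set [K] has a neighbourhood on which [u] is 0, so all partial derivatives
    vanish there. *)
Lemma lie_out u K x : manifold_C1 u -> closed K -> (forall x, ~ K x -> u x = 0) ->
  ~ K x -> lie u x = 0.
Proof.
move=> u1 cK u0 nKx; rewrite /lie /chart_lie big1// => k _.
set c := chart_at x; set y := chart_map c x.
have oW := @open_preimage_inv _ _ _ c _ (closed_openC cK).
have xE : chart_inv c y = x by apply: chart_mapK; exact: dom_at.
have Wy : chart_codom c y /\ (~` K) (chart_inv c y).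
  by split; [exact: codom_map (dom_at x)|rewrite xE].
have E0 z : chart_codom c z /\ (~` K) (chart_inv c z) -> 0 = u (chart_inv c z).
  by move=> [_ /u0].
have := @pd_open_eq R n (fun=> 0) (fun z => u (chart_inv c z)) _ k y oW Wy E0
  (differentiable_cst _ _).
by move=> ->; rewrite /pd diff_cstE mulr0.
Qed.

(** Integrating [div (u rho X) = rho (X u - (n / 2) u)] in the chart: the left side contributes 0,
    since [u] vanishes off the compact [K]. *)
Lemma chart_int_lie c u K : atlas c -> compact K -> K `<=` chart_dom c ->
  manifold_C1 u -> (forall x, ~ K x -> u x = 0) -> closed K ->
  n%:R / 2 * chart_int c u = chart_int c (lie u).
Proof.
move=> ac cK Kc u1 u0 clK; have oc := chart_codom_open (c := c).
have hb := @vol_int_bf R n.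
have cu := cc_chart_ext ac cK Kc (manifold_C1_continuous u1) u0.
have cl := cc_chart_ext ac cK Kc (lie_continuous u1) (fun x => @lie_out u K x u1 clK u0).
have sa j := smooth_re sf j ac.
have sb j := smooth_im sf j ac.
have uc y (cy : chart_codom c y) := uS ac cy.
pose F k y := chart_density f c y * chart_liouville f c k y.
have F1 k : Ck_on 1 (F k) (chart_codom c) by exact: (flux_C1 oc sa sb uc k).
pose g k y := u (chart_inv c y) * F k y.
have g1 k : Ck_on 1 (g k) (chart_codom c) by exact: (C1M oc (u1 c ac) (F1 k)).
have g0 k y : chart_codom c y -> ~ (chart_map c @` K) y -> g k y = 0.
  by move=> cy /(chart_inv_notin cy)/u0 E; rewrite /g E mul0r.
have hk k := vol_int_pd0 k oc (compact_chart_map cK Kc) (chart_map_codom Kc) (g1 k) (g0 k).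
have sumE : (fun y => \sum_k zero_ext (chart_codom c) (pd (g k) k) y) =
    (fun y => chart_ext c (lie u) y - n%:R / 2 * chart_ext c u y).
  apply/funext => y; have [cy|ncy] := pselect (chart_codom c y); last first.
    rewrite /chart_ext !zero_ext_out// mulr0 subr0 big1// => k _.
    by rewrite zero_ext_out.
  rewrite /chart_ext !zero_extE// lieE//.
  transitivity (\sum_k (u (chart_inv c y) * pd (F k) k y +
      F k y * pd (fun z => u (chart_inv c z)) k y)).
    apply: eq_bigr => k _; rewrite zero_extE//.
    apply: pdM; [exact: (C1_differentiable (u1 c ac) cy)|exact: (C1_differentiable (F1 k) cy)].
  rewrite big_split/= -mulr_sumr.
  have -> : \sum_k pd (F k) k y = - (n%:R / 2) * chart_density f c y.
    exact: (div_flux oc sa sb uc cy).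
  have -> : \sum_k F k y * pd (fun z => u (chart_inv c z)) k y =
      chart_density f c y * chart_lie f c u y.
    by rewrite mulr_sumr; apply: eq_bigr => k _; rewrite /F mulrA.
  by move: (chart_density f c y) (u (chart_inv c y)) (chart_lie f c u y) => a b e; ring.
have : vol_int (fun y => \sum_k zero_ext (chart_codom c) (pd (g k) k) y) = 0.
  rewrite (bf_sum _ hb) => [|k]; last by have [] := hk k.
  by rewrite big1// => k _; have [] := hk k.
rewrite sumE (bfB hb cl (ccZ (n%:R / 2) cu)) (bfZ hb _ cu) => /eqP.
by rewrite subr_eq0 => /eqP.
Qed.

End ManifoldIntegral.

(** * The compact case *)

Lemma closed_norm_ball (R : realType) (V : normedModType R) (x : V) (r : R) :
  closed [set y | `|y - x| <= r].
Proof.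
have -> : [set y | `|y - x| <= r] = closed_ball_ (fun z : V => `|z|) x r.
  by apply/seteqP; split => y /=; rewrite /closed_ball_ /= distrC.
exact: closed_closed_ball_.
Qed.

Section ChartBumps.
Variables (R : realType) (n : nat) (N : smoothManifold R n).
Implicit Types (c d : chart R n N).

Lemma chart_ball c x : chart_dom c x -> exists r : R, 0 < r /\
  [set y | `|y - chart_map c x| <= r] `<=` chart_codom c.
Proof.
move=> cx; have cy := codom_map cx.
have /nbhs_ballP[e /= e0 he] := open_nbhs_nbhs (conj (chart_codom_open (c := c)) cy).
exists (e / 2); split; first by rewrite divr_gt0.
move=> y /= yr; apply: he; rewrite -ball_normE/= distrC; lra.
Qed.

Definition chart_bump c x (r : R) (z : N) : R :=
  if `[< chart_dom c z >] then bump (chart_map c x) r (chart_map c z) else 0.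

Definition chart_closed_ball c x (r : R) : set N :=
  chart_inv c @` [set y | `|y - chart_map c x| <= r].

Variables (c : chart R n N) (x : N) (r : R).
Hypotheses (cx : chart_dom c x) (r0 : 0 < r).
Hypothesis rc : [set y | `|y - chart_map c x| <= r] `<=` chart_codom c.

Lemma compact_chart_closed_ball : compact (chart_closed_ball c x r).
Proof.
apply: continuous_compact.
  by apply: continuous_in_subspaceT => y /[1!inE] /rc; exact: chart_inv_continuous.
have cT := compact_thicken (d := r) (@compact_balls_rV R n) (@compact_set1 _ (chart_map c x)).
apply: (subclosed_compact (@closed_norm_ball R _ (chart_map c x) r) cT).
move=> y /= yr; exists (chart_map c x), (y - chart_map c x); split => //.
by rewrite addrC subrK.
Qed.

(** The Hausdorff property enters here: the complement is open, so that a bump extended by 0 remains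
    regular across the edge of its chart. *)
Lemma closed_chart_closed_ball : closed (chart_closed_ball c x r).
Proof. exact: (compact_closed (@manifold_hausdorff R n N) compact_chart_closed_ball). Qed.

Lemma chart_closed_ball_dom : chart_closed_ball c x r `<=` chart_dom c.
Proof. by move=> _ [y /rc /codom_inv[cy _] <-]. Qed.

Lemma chart_bump_ge0 z : 0 <= chart_bump c x r z.
Proof. by rewrite /chart_bump; case: ifPn => // _; exact: bump_ge0. Qed.

Lemma chart_bump_out z : ~ chart_closed_ball c x r z -> chart_bump c x r z = 0.
Proof.
move=> nz; rewrite /chart_bump; case: ifPn => // /asboolP cz.
apply: bump_out; first exact: ltW.
rewrite ltNge; apply/negP => h; apply: nz; exists (chart_map c z) => //.
exact: chart_mapK.
Qed.

Lemma chart_bump_near : \forall z \near x, 0 < chart_bump c x r z.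
Proof.
have nd : \forall z \near x, chart_dom c z.
  by apply: open_nbhs_nbhs; split => //; exact: chart_dom_open.
have nr : \forall z \near x, ball (chart_map c x) r (chart_map c z).
  by have := chart_map_continuous cx; apply; exact: nbhsx_ballx.
apply: filterS (filterI nd nr) => z [cz zr].
rewrite /chart_bump asboolT//; apply: bump_gt0.
by move: zr; rewrite -ball_normE/= distrC.
Qed.

(** The image of any chart [d] is covered by two open sets: the overlap with [c], where the bump has
    an explicit formula, and the part off the closed ball, where it is 0. *)
Lemma chart_bump_C1 : atlas c -> manifold_C1 (chart_bump c x r).
Proof.
move=> ac d ad.
pose W := [set y | chart_codom d y /\ (~` chart_closed_ball c x r) (chart_inv d y)].
have oW : open W by apply: open_preimage_inv; exact: closed_openC closed_chart_closed_ball.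
have c1 : Ck_on 1 (fun y => chart_bump c x r (chart_inv d y)) (overlap d c).
  have h := @C1_comp R n n _ _ _ setT (@open_overlap _ _ _ d c) (fun _ _ => I)
    (transition_C1 ad ac) (C1_bump (chart_map c x) r).
  apply: C1_eq h; first exact: open_overlap.
  by move=> y /overlapP[_ cy]; rewrite /chart_bump asboolT.
have c2 : Ck_on 1 (fun y => chart_bump c x r (chart_inv d y)) W.
  apply: C1_eq (C1_cst 0 oW) => //.
  by move=> y [_ /chart_bump_out].
have cov y : chart_codom d y -> overlap d c y \/ W y.
  move=> dy; have [Ky|nKy] := pselect (chart_closed_ball c x r (chart_inv d y)).
    by left; apply/overlapP; split => //; exact: chart_closed_ball_dom.
  by right.
split=> [y|v y] /cov[]; [exact: (C1_differentiable c1)|exact: (C1_differentiable c2)|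
  exact: (C1_diff_continuous v c1)|exact: (C1_diff_continuous v c2)].
Qed.

End ChartBumps.

Lemma finite_subcover_near (T : topologicalType) (A : T -> set T) :
  compact [set: T] -> (forall p, \forall x \near p, A p x) ->
  exists s : seq T, forall x, exists2 p, p \in s & A p x.
Proof.
move=> /compact_near_coveringP ncov nA.
(* Finite lists ordered by inclusion: eventually means for all lists containing some [s0].
   Near-covering compactness along this filter yields a finite subcover. *)
pose F : set_system (seq T) := [set S : set (seq T) | exists s0 : seq T, forall s : seq T, {subset s0 <= s} -> S s].
have fF : Filter F.
  split; first by exists [::].
  - move=> S1 S2 [s1 h1] [s2 h2]; exists (s1 ++ s2) => s h; split.
      by apply: h1 => p ps; apply: h; rewrite mem_cat ps.
    by apply: h2 => p ps; apply: h; rewrite mem_cat ps orbT.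
  - by move=> S1 S2 S12 [s0 h0]; exists s0 => s /h0; exact: S12.
have loc x : [set: T] x ->
    \forall x' \near x & s \near F, exists2 p, p \in s & A p x'.
  move=> _; exists (A x, [set s : seq T | x \in s]) => /=.
    split; first exact: nA.
    by exists [:: x] => s /(_ x); apply; rewrite inE.
  by move=> [y s] /= [Ay xs]; exists x.
have [s0 h0] := ncov _ F (fun s x => exists2 p, p \in s & A p x) fF loc.
by exists s0 => x; exact: h0.
Qed.

Theorem theorem1p5 (R : realType) (n m : nat) (N : smoothManifold R n)
    (f : N -> 'rV[R[i]]_m) :
  (0 < n)%N -> slant_immersion f -> compact [set: N] -> totally_real f.
Proof.
move=> n0 slant cN; have [[sf _] _] := slant.
have [//|uS] := slant_dichotomy sf slant.
(* Total reality is a claim about a point [x0], which now witnesses that [N] is nonempty; positivity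
   of the total volume will rest on it. *)
move=> x0; exfalso.
have hb := @vol_int_bf R n.
have [ch hch] := choice (fun x => let: ex_intro2 c ac cx := @atlas_cover R n N x in
  ex_intro (fun c => atlas c /\ chart_dom c x) c (conj ac cx)).
have ac x := proj1 (hch x); have dc x := proj2 (hch x).
have [r hr] := choice (fun x => chart_ball (dc x)).
have r0 x := proj1 (hr x); have rc x := proj2 (hr x).
pose b p := chart_bump (ch p) p (r p).
pose K p := chart_closed_ball (ch p) p (r p).
have cK p : compact (K p) by exact: compact_chart_closed_ball.
have clK p : closed (K p) by exact: closed_chart_closed_ball.
have Kd p : K p `<=` chart_dom (ch p) by exact: chart_closed_ball_dom.
have b0 p z : 0 <= b p z by exact: chart_bump_ge0.
have bout p z : ~ K p z -> b p z = 0 by exact: chart_bump_out.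
have b1 p : manifold_C1 (b p) by exact: chart_bump_C1.
have [P hP] := finite_subcover_near cN (fun p => chart_bump_near (dc p) (r0 p)).
pose B z := \sum_(p <- P) b p z.
have Bpos z : 0 < B z.
  have [p pP bp] := hP z.
  rewrite /B (big_rem p)//=; apply: ltr_pwDl => //.
  by apply: sumr_ge0 => q _; exact: b0.
pose phi p z := b p z * (B z)^-1.
have B1 : manifold_C1 B.
  move=> c acc; apply: (C1_sum _ (chart_codom_open (c := c))) => p; exact: b1.
have phi1 p : manifold_C1 (phi p).
  move=> c acc; apply: (C1M (chart_codom_open (c := c)) (b1 p c acc)).
  apply: (C1V (chart_codom_open (c := c)) _ (B1 c acc)) => y _.
  by rewrite gt_eqF.
have phiout p z : ~ K p z -> phi p z = 0 by move=> /bout E; rewrite /phi E mul0r.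
have phi0 p z : 0 <= phi p z by rewrite mulr_ge0// invr_ge0 ltW.
have phisum z : \sum_(p <- P) phi p z = 1.
  by rewrite -mulr_suml -/(B z) mulfV// gt_eqF.
pose L p := lie f ch (phi p).
have Lc p : chart_continuous (L p) by exact: (lie_continuous sf uS ac dc (phi1 p)).
have Lout p z : ~ K p z -> L p z = 0.
  exact: (lie_out f dc (phi1 p) (clK p) (phiout p)).
(* All terms use the one chart chosen at [z], so the sum is the derivative of the constant 1. *)
have Lsum z : \sum_(p <- P) L p z = 0.
  rewrite /L /lie /chart_lie exchange_big big1// => k _.
  rewrite -mulr_sumr; set y := chart_map (ch z) z.
  have dz : chart_codom (ch z) y by exact: codom_map (dc z).
  have oc := chart_codom_open (c := ch z).
  have dphi p := C1_differentiable (phi1 p _ (ac z)) dz.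
  have [_ E] := diff_sumE P (delta_mx 0 k) dphi.
  have one w : chart_codom (ch z) w -> 1 = \sum_(p <- P) phi p (chart_inv (ch z) w).
    by rewrite phisum.
  have E0 := pd_open_eq k oc dz one (differentiable_cst _ _).
  have -> : \sum_(p <- P) pd (fun w => phi p (chart_inv (ch z) w)) k y = 0.
    apply: etrans (esym E) _; apply: etrans E0 _; exact: diff_cstE.
  by rewrite mulr0.
(* Vanishing off the intersection of [K p] and [K q], this product can be integrated in the chart of
   [p] as well as in that of [q]. *)
pose h p q z := phi q z * L p z.
have hc p q : chart_continuous (h p q).
  move=> c y acc cy; apply: continuous_forM; last exact: Lc.
  exact: (manifold_C1_continuous (phi1 q) acc cy).
have hout p q z : ~ (K p `&` K q) z -> h p q z = 0.
  move=> nK; have [Kp|nKp] := pselect (K p z); last by rewrite /h Lout// mulr0.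
  by rewrite /h phiout ?mul0r// => Kq; apply: nK.
have cKK p q : compact (K p `&` K q).
  apply: (subclosed_compact _ (cK p)); last by move=> z [].
  exact: closedI.
have hswap p q : chart_int f (ch p) (h p q) = chart_int f (ch q) (h p q).
  apply: (chart_int_change sf uS (ac p) (ac q) (cKK p q)) => //.
  - by move=> z [Kp _]; exact: Kd.
  - by move=> z [_ Kq]; exact: Kd.
  - exact: hout.
have cch p q c : c = ch p \/ c = ch q -> cc (chart_ext f c (h p q)).
  move=> cE; have acc : atlas c by case: cE => ->.
  apply: (cc_chart_ext sf uS acc (cKK p q)) => //; last exact: hout.
  by move=> z [Kp Kq]; case: cE => ->; exact: Kd.
have int_sum p : chart_int f (ch p) (L p) = \sum_(q <- P) chart_int f (ch p) (h p q).
  rewrite /chart_int -(bf_sum _ hb) => [|q]; last by apply: cch; left.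
  congr vol_int; apply/funext => y; rewrite /chart_ext /zero_ext.
  case: ifPn => _; last by rewrite big1.
  by rewrite -mulr_sumr /h -mulr_suml phisum mul1r.
have int_zero q : \sum_(p <- P) chart_int f (ch q) (h p q) = 0.
  rewrite /chart_int -(bf_sum _ hb) => [|p]; last by apply: cch; right.
  rewrite -[RHS](bf0 hb); congr vol_int; apply/funext => y; rewrite /chart_ext /zero_ext.
  case: (boolP `[< chart_codom (ch q) y >]) => _; last by rewrite big1.
  by rewrite -mulr_sumr /h -mulr_sumr Lsum !mulr0.
(* Each integral is split by the [phi q], moved to the chart of [q], and summed over [p] first,
   where [Lsum] applies. *)
have total : \sum_(p <- P) chart_int f (ch p) (L p) = 0.
  under eq_bigr do rewrite int_sum.
  rewrite exchange_big big1// => q _.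
  under eq_bigr do rewrite hswap.
  exact: int_zero.
have [p0 p0P bp0] := hP x0.
have cphi p := cc_chart_ext sf uS (ac p) (cK p) (Kd p) (manifold_C1_continuous (phi1 p)) (phiout p).
have ext0 p y : 0 <= chart_ext f (ch p) (phi p) y.
  rewrite /chart_ext /zero_ext; case: ifPn => // _.
  by rewrite mulr_ge0// sqrtr_ge0.
have pos : 0 < \sum_(p <- P) chart_int f (ch p) (phi p).
  rewrite (big_rem p0)//=; apply: ltr_pwDl; last first.
    by apply: sumr_ge0 => p _; apply: vol_int_ge0; exact: ext0.
  have Kx0 : K p0 x0.
    by apply: contrapT => /bout E; move: bp0; rewrite -/(b p0 x0) E ltxx.
  have dx0 := Kd _ _ Kx0; have cy := codom_map dx0.
  apply: (@vol_int_gt0 _ _ _ (chart_map (ch p0) x0) (cphi p0) (ext0 p0)).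
  rewrite /chart_ext zero_extE// chart_mapK// mulr_gt0//.
    exact: (chart_density_gt0 uS (ac p0) cy).
  by rewrite /phi mulr_gt0// invr_gt0.
(* The identities of [chart_int_lie] add up: [n / 2] times the positive total volume equals the
   vanishing sum, which [0 < n] contradicts. *)
have : n%:R / 2 * (\sum_(p <- P) chart_int f (ch p) (phi p)) = 0.
  rewrite mulr_sumr -[RHS]total; apply: eq_bigr => p _.
  exact: (chart_int_lie sf uS ac dc (ac p) (cK p) (Kd p) (phi1 p) (phiout p) (clK p)).
apply/eqP; rewrite mulf_neq0//; last by rewrite gt_eqF.
by rewrite mulf_neq0// ?invr_eq0 ?pnatr_eq0// -lt0n.
Qed.
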